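(* Let $n\ge1$, $0\le t<1$, and let $a_1,a_2,\ldots,a_n>0$ be real numbers. For any partition $\lambda$ with $\lambda_1'\le n$ (that is, with at most $n$ nonzero parts), the matrix of $$\frac{\Theta(P_\lambda)}{P_\lambda(a_1,a_2,\ldots,a_n)}$$ with respect to the basis $\{\mathsf1,\mathsf2\}^{\otimes n}$ of $V^{\otimes n}$ is stochastic.
   Context: Fix $n\ge1$ and a real number $t$ with $0\le t<1$; $a_1,\dots,a_n$ are parameters and $\alpha$ is a formal variable. An operator on $V^{\otimes n}$ is called stochastic with respect to a basis if it sends each basis vector to a linear combination of basis vectors with non-negative real coefficients summing to $1$. Hall-Littlewood polynomials. $\Lambda_n$ is the algebra of symmetric polynomials in $n$ variables $x_1,\dots,x_n$ over $\mathbb R$. For a partition $\lambda=(\lambda_1\ge\dots\ge\lambda_n\ge0)$ with at most $n$ nonzero parts, let $m_k(\lambda)$ be the number of $i\in\{1,\dots,n\}$ with $\lambda_i=k$ and $$P_\lambda=\frac1{v_\lambda(t)}\sum_{w\in S_n}w\Big(x_1^{\lambda_1}\cdots x_n^{\lambda_n}\prod_{1\le i<j\le n}\frac{x_i-tx_j}{x_i-x_j}\Big),\qquad v_\lambda(t)=\prod_{k\ge0}\prod_{i=1}^{m_k(\lambda)}\frac{1-t^i}{1-t},$$ where $w$ permutes the variables. Put $g_k=(1-t)P_{(k)}$ for $k\ge1$; then $1+\sum_{k\ge1}g_k\alpha^k=\prod_{i=1}^n\frac{1-t\alpha x_i}{1-\alpha x_i}$ and $\Lambda_n=\mathbb R[g_1,\dots,g_n]$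 with $g_1,\dots,g_n$ algebraically independent. Six-vertex operators. $V$ is the two-dimensional vector space with basis $\mathsf 1,\mathsf 2$; $\{\mathsf 1,\mathsf 2\}^{\otimes n}$ is the basis of $V^{\otimes n}$ of vectors $e_1\otimes\cdots\otimes e_n$ with each $e_i\in\{\mathsf 1,\mathsf 2\}$. Define $R=R(a,t):V\otimes V\to V\otimes V$ by $R(\mathsf2\otimes\mathsf2)=\mathsf2\otimes\mathsf2$, $R(\mathsf1\otimes\mathsf1)=\mathsf1\otimes\mathsf1$, $R(\mathsf2\otimes\mathsf1)=\frac{1-a}{1-ta}\,\mathsf2\otimes\mathsf1+\frac{(1-t)a}{1-ta}\,\mathsf1\otimes\mathsf2$, $R(\mathsf1\otimes\mathsf2)=\frac{1-t}{1-ta}\,\mathsf2\otimes\mathsf1+\frac{t(1-a)}{1-ta}\,\mathsf1\otimes\mathsf2$. Here $R$ is read as a vertex (bottom edge)$\otimes$(left edge) $\mapsto$ (top edge)$\otimes$(right edge); write $R(a,t)[b,l;u,r]$ for the coefficient of $u\otimes r$ in $R(a,t)(b\otimes l)$. The transfer operator $T(\alpha):V^{\otimes n}\to V^{\otimes n}$, with left boundary fixed to be $\mathsf 1$ and free right boundary, has matrix elements: the coefficient of $e_1'\otimes\cdots\otimes e_n'$ in $T(\alpha)(e_1\otimes\cdots\otimes e_n)$ is $$\sum_{h_1,\dots,h_n\in\{\mathsf1,\mathsf2\}}\ \prod_{i=1}^nR(\alpha a_i,t)[e_i,h_{i-1};e_i',h_i],\qquad h_0=\mathsf1.$$ Set $\widetilde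 T(\alpha)=\Big(\prod_{i=1}^n\frac{1-t\alpha a_i}{1-\alpha a_i}\Big)T(\alpha)$ and expand in powers of $\alpha$: $\widetilde T(\alpha)=\mathrm{Id}+\sum_{k\ge1}T_k\alpha^k$. The matrix elements of $T_k$ are polynomials in $a_1,\dots,a_n$, and the operators $T_k$ ($k\ge1$) commute with each other. $\Theta$ is the $\mathbb R$-algebra homomorphism from $\Lambda_n$ to operators on $V^{\otimes n}$ determined by $\Theta(g_k)=T_k$ for $1\le k\le n$. *)

(* Defs.v *)
Set Warnings "-all".
From HB Require Import structures.
From mathcomp Require Import all_boot all_order all_fingroup all_algebra.
From mathcomp Require Import reals.
From mathcomp.multinomials Require Import mpoly.

Set Implicit Arguments.
Unset Strict Implicit.
Unset Printing Implicit Defensive.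
Import Order.TTheory GRing.Theory Num.Theory.
Local Open Scope ring_scope.

Local Notation "p %:F" := (tofrac p).

Section SymmetricPolynomials.
Variables (n : nat) (R : fieldType).

Record sympoly := Sympoly {
  mpoly_of_sym :> {mpoly R[n]};
  _ : mpoly_of_sym \is symmetric }.

HB.instance Definition _ := [isSub for mpoly_of_sym].
HB.instance Definition _ := [Choice of sympoly by <:].
HB.instance Definition _ := [SubChoice_isSubComNzRing of sympoly by <:].
HB.instance Definition _ := [SubZmodule_isSubLmodule of sympoly by <:].
HB.instance Definition _ := [SubNzRing_SubLmodule_isSubLalgebra of sympoly by <:].
HB.instance Definition _ := [SubLalgebra_isSubAlgebra of sympoly by <:].

End SymmetricPolynomials.

Section HallLittlewood.
Variables (R : realType) (n : nat) (t : R).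
Implicit Types (lam : n.-tuple nat) (i j : 'I_n).

Local Notation K := {fraction {mpoly R[n]}}.

Definition constF (c : R) : K := (c%:MP_[n])%:F.
Definition varF i : K := ('X_i : {mpoly R[n]})%:F.

Definition HL_summand lam (x : 'I_n -> K) : K :=
  (\prod_(i < n) x i ^+ tnth lam i) *
  \prod_(i < n) \prod_(j < n | (i < j)%N) ((x i - constF t * x j) / (x i - x j)).

(* The factors with [k] larger than every part are empty products. *)
Definition HL_v lam : R :=
  \prod_(k < (\max_(i < n) tnth lam i).+1)
    \prod_(1 <= i < (count_mem (k : nat) lam).+1) ((1 - t ^+ i) / (1 - t)).

Definition HL_frac lam : K :=
  (constF (HL_v lam))^-1 * \sum_(w : 'S_n) HL_summand lam (fun i => varF (w i)).

Lemma msymXU (s : 'S_n) i : msym s 'X_i = 'X_(s i) :> {mpoly R[n]}.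
Proof.
rewrite msymX; congr mpolyX; apply/mnmP => j.
by rewrite mnmE !mnm1E -(inj_eq (@perm_inj _ s)) permKV.
Qed.

Let merge i j : n.-tuple {mpoly R[n]} :=
  [tuple if k == i then 'X_j else 'X_k | k < n].

Let merge_dvd i j (p : {mpoly R[n]}) :
  exists q, p - (p \mPo (merge i j)) = ('X_i - 'X_j) * q.
Proof.
pose P p := exists q, p - (p \mPo (merge i j)) = ('X_i - 'X_j) * q.
have PM a b : P a -> P b -> P (a * b).
  move=> [qa ea] [qb eb]; exists (qa * b + (a \mPo merge i j) * qb).
  by rewrite rmorphM /= mulrDr mulrA -ea mulrCA -eb mulrBl mulrBr addrA subrK.
have P1 : P 1 by exists 0; rewrite rmorph1 subrr mulr0.
have PX k : P 'X_k.
  rewrite /P comp_mpolyXU -tnth_nth tnth_mktuple; case: eqP => [->|_].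
    by exists 1; rewrite mulr1.
  by exists 0; rewrite subrr mulr0.
rewrite -/(P p); elim/mpolyind: p => [|c m p _ _ [q eq]].
  by exists 0; rewrite rmorph0 subrr mulr0.
have [r er] : P 'X_[m].
  rewrite mpolyXE_id; elim/big_ind: _ => // k _.
  by elim: (m k) => [|d IH]; rewrite ?expr0 // exprS; apply: PM.
exists (c *: r + q).
by rewrite linearP /= opprD addrACA -scalerBr er eq mulrDr scalerAr.
Qed.

Let diff_neq0 i j : i != j -> 'X_i - 'X_j != 0 :> {mpoly R[n]}.
Proof.
move=> ne; apply/eqP => /(congr1 (mcoeff U_(i)%MM)).
rewrite mcoeffB !mcoeffX mcoeff0 eqxx.
have -> : (U_(j)%MM == U_(i)%MM :> 'X_{1..n}) = false.
  apply/negbTE/eqP => /(congr1 (fun m : 'X_{1..n} => m i)).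
  by rewrite !mnm1E eqxx eq_sym (negbTE ne).
by rewrite subr0 => /eqP; rewrite oner_eq0.
Qed.

Let pairs_dvd (s : seq ('I_n * 'I_n)) (p : {mpoly R[n]}) :
    uniq s -> all (fun ij : 'I_n * 'I_n => (ij.1 < ij.2)%N) s ->
    all (fun ij : 'I_n * 'I_n => p \mPo (merge ij.1 ij.2) == 0) s ->
  exists q, p = (\prod_(ij <- s) ('X_ij.1 - 'X_ij.2)) * q.
Proof.
elim: s p => [|[i j] s IH] p /=; first by exists p; rewrite big_nil mul1r.
move=> /andP [ijNs us] /andP [ij os] /andP [/eqP p0 ps].
have [q eq] := merge_dvd i j p; rewrite p0 subr0 in eq.
have [|r er] := IH q us os _; last first.
  by exists r; rewrite eq er big_cons mulrA.
apply/allP => -[k l] kls; have := allP ps _ kls; rewrite eq rmorphM /=.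
rewrite mulf_eq0 => /orP [|//].
rewrite rmorphB /= !comp_mpolyXU -!tnth_nth !tnth_mktuple => /eqP abs.
have kl := allP os _ kls; rewrite /= in kl ij.
have nel : (k, l) != (i, j) by apply: contraNneq ijNs => <-.
exfalso; move: abs; case: (eqVneq i k) => [eik|nik]; case: (eqVneq j k) => [ejk|njk].
- by move: ij; rewrite eik ejk ltnn.
- apply/eqP/diff_neq0; apply: contraNneq nel => ->; by rewrite eik.
- apply/eqP/diff_neq0; apply/eqP => eil.
  by move: kl ij; rewrite eil ejk => /ltn_trans h /h; rewrite ltnn.
- by apply/eqP/diff_neq0; apply: contraTneq ij => ->; rewrite ltnn.
Qed.

Let Delta : {mpoly R[n]} := \prod_(i < n) \prod_(j < n | (i < j)%N) ('X_j - 'X_i).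

Let Delta_perm (s : 'S_n) : msym s Delta = (-1) ^+ s *: Delta.
Proof.
pose a := \row_(i < n) ('X_i : {mpoly R[n]}).
have eD : Delta = \det (Vandermonde n a).
  rewrite det_Vandermonde; apply: eq_bigr => i _; apply: eq_bigr => j _.
  by rewrite !mxE.
have -> : msym s Delta = \det (col_perm s (Vandermonde n a)).
  have -> : col_perm s (Vandermonde n a) = Vandermonde n (col_perm s a).
    by apply/matrixP => i j; rewrite !mxE.
  rewrite det_Vandermonde rmorph_prod; apply: eq_bigr => i _.
  rewrite rmorph_prod; apply: eq_bigr => j _.
  by rewrite rmorphB /= !msymXU !mxE.
rewrite col_permE det_mulmx det_perm -eD mulrC odd_permV.
by rewrite -[RHS]mulr_algl scaler_sign; case: (odd_perm s); rewrite ?expr1 ?expr0.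
Qed.

Let D0 : {mpoly R[n]} := \prod_(i < n) \prod_(j < n | (i < j)%N) ('X_i - 'X_j).

Let D0_perm (s : 'S_n) : msym s D0 = (-1) ^+ s *: D0.
Proof.
pose c : R := \prod_(i < n) \prod_(j < n | (i < j)%N) (-1).
have -> : D0 = c *: Delta.
  rewrite /c /Delta -scaler_prod; apply: eq_bigr => i _.
  rewrite -scaler_prod; apply: eq_bigr => j _.
  by rewrite scaleN1r opprB.
by rewrite linearZ /= Delta_perm scalerA mulrC -scalerA.
Qed.

Let D0_neq0 : D0 != 0.
Proof.
apply/prodf_neq0 => i _; apply/prodf_neq0 => j ij; apply: diff_neq0.
by apply: contraTneq ij => ->; rewrite ltnn.
Qed.

Let num lam : {mpoly R[n]} :=
  (\prod_(i < n) 'X_i ^+ tnth lam i) *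
  \prod_(i < n) \prod_(j < n | (i < j)%N) ('X_i - t *: 'X_j).

Let alt lam : {mpoly R[n]} := \sum_(w : 'S_n) (-1) ^+ w *: msym w (num lam).

Let alt_perm lam (s : 'S_n) : msym s (alt lam) = (-1) ^+ s *: alt lam.
Proof.
rewrite /alt raddf_sum /= scaler_sumr [RHS](reindex_inj (mulIg s)) /=.
apply: eq_bigr => w _; rewrite linearZ /= -msymMm scalerA odd_permM addbC.
by rewrite signr_addb mulrA -signr_addb addbb mul1r.
Qed.

Let alt_vanish lam i j : i != j -> alt lam \mPo merge i j = 0.
Proof.
move=> nij; have e : msym (tperm i j) (alt lam) \mPo merge i j
    = alt lam \mPo merge i j.
  rewrite msym_mPo; congr comp_mpoly; apply: eq_from_tnth => k.
  rewrite !tnth_mktuple; case: tpermP => [->|->|//].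
    by rewrite eqxx eq_sym (negbTE nij).
  by rewrite eqxx eq_sym (negbTE nij).
move: e; rewrite alt_perm odd_tperm nij expr1 scaleN1r raddfN /= => /eqP.
by rewrite eq_sym -subr_eq0 opprK -mulr2n -scaler_nat scaler_eq0 pnatr_eq0
  => /eqP.
Qed.

Let quotient_ex lam : exists q, alt lam = D0 * q.
Proof.
pose s := [seq ij : 'I_n * 'I_n <- index_enum _ | (ij.1 < ij.2)%N].
have [|||q eq] := @pairs_dvd s (alt lam).
- by rewrite filter_uniq ?index_enum_uniq.
- by apply/allP => ij; rewrite mem_filter => /andP [].
- apply/allP => ij; rewrite mem_filter => /andP [lt _].
  by rewrite alt_vanish //; apply: contraTneq lt => ->; rewrite ltnn.
exists q; rewrite eq; congr (_ * _).
by rewrite big_filter /D0 pair_big_dep.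
Qed.

Let HL_summand_perm lam (w : 'S_n) :
  HL_summand lam (fun i => varF (w i)) =
    ((-1) ^+ w *: msym w (num lam))%:F / D0%:F.
Proof.
have sgnD : D0%:F = ((-1) ^+ w)%:F * (msym w D0)%:F.
  rewrite D0_perm -rmorphM /= -mul_mpolyC rmorphXn /= rmorphN1.
  by rewrite mulrA -expr2 -exprM mulnC exprM sqrrN expr1n expr1n mul1r.
have nz : ((-1) ^+ w : {mpoly R[n]})%:F != 0.
  by rewrite tofrac_eq0 signr_eq0.
rewrite sgnD -mul_mpolyC rmorphXn rmorphN1 /= rmorphM /= -mulf_div divff // mul1r.
rewrite /HL_summand /num rmorphM /= rmorphM /= -mulrA; congr (_ * _).
  rewrite !rmorph_prod /=; apply: eq_bigr => i _.
  by rewrite !rmorphXn /= msymXU.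
rewrite /D0 !rmorph_prod /= -prodf_div; apply: eq_bigr => i _.
rewrite !rmorph_prod /= -prodf_div; apply: eq_bigr => j _.
rewrite !rmorphB /= linearZ /= !msymXU -mul_mpolyC rmorphM /=; congr (_ / _).
Qed.

Lemma HL_polynomial lam :
  exists p : sympoly n R, (p : {mpoly R[n]})%:F == HL_frac lam.
Proof.
have [q eq] := quotient_ex lam.
have sq : ((HL_v lam)^-1 *: q) \is symmetric.
  apply: rpredZ; apply/issymP => s; apply: (mulfI D0_neq0).
  have := alt_perm lam s; rewrite eq msymM D0_perm -scalerAl => /(congr1 ( *:%R ((-1) ^+ s))).
  by rewrite !scalerA -signr_addb addbb !scale1r.
exists (Sympoly sq); apply/eqP => /=.
have -> : HL_frac lam = (constF (HL_v lam))^-1 * ((alt lam)%:F / D0%:F).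
  rewrite /HL_frac; congr (_ * _).
  rewrite (eq_bigr _ (fun w _ => HL_summand_perm lam w)) -mulr_suml.
  by rewrite /alt rmorph_sum.
rewrite eq rmorphM /= mulrAC divff ?tofrac_eq0 // mul1r.
rewrite -mul_mpolyC rmorphM /=; congr (_ * _).
have [->|nv] := eqVneq (HL_v lam) 0; first by rewrite /constF !(invr0, rmorph0, mpolyC0).
apply: (@mulfI _ (constF (HL_v lam))).
  by rewrite /constF tofrac_eq0 mpolyC_eq0.
rewrite divff; last by rewrite /constF tofrac_eq0 mpolyC_eq0.
by rewrite /constF -rmorphM /= -mpolyCM divff // rmorph1.
Qed.

Definition HL lam : sympoly n R := xchoose (HL_polynomial lam).

Lemma HLE lam : (HL lam : {mpoly R[n]})%:F = HL_frac lam.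
Proof. exact/eqP/(xchooseP (HL_polynomial lam)). Qed.

Definition HL_g (k : nat) : sympoly n R :=
  (1 - t) *: HL [tuple if (i : nat) == 0%N then k else 0%N | i < n].

End HallLittlewood.

Section PowerSeriesExpansion.

Local Notation repr := generic_quotient.repr.

Variable F : fieldType.
Implicit Types (p q : {poly F}) (f : {fraction {poly F}}).

(* Write [f] in lowest terms as [p / q]. When [q`_0 != 0], 1 / q is the sum of
   the geometric series of ratio [1 - q / q`_0], divided by [q`_0]; only its
   first [k.+1] terms contribute to the coefficient of degree [k]. *)
Definition series_coef f (k : nat) : F :=
  let x := repr f in
  let d := gcdp x.1 x.2 in
  let p := x.1 %/ d in
  let q := x.2 %/ d in
  let c := (q`_0)^-1 in
  (p * \sum_(j < k.+1) c *: (1 - c *: q) ^+ j)`_k.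

Let numdenE f : f * (repr f).2%:F = (repr f).1%:F.
Proof.
rewrite -[f in f * _]generic_quotient.reprK.
move: (repr f) (denom_ratioP (repr f)) => x d0.
unlock tofrac; rewrite -[LHS]FracField.pi_mul; apply/generic_quotient.eqmodP.
rewrite /= FracField.equivfE /FracField.mulf.
by rewrite !numden_Ratio ?mulf_neq0 ?oner_eq0 //= !mulr1 mulrC.
Qed.

Let coef_dvdX (p q : {poly F}) k m :
  (m < k)%N -> p`_0 = 0 -> (p ^+ k * q)`_m = 0.
Proof.
move=> mk p0; have /dvdpP [r ->] : 'X %| p.
  by have := dvdp_XsubCl p 0; rewrite subr0 rootE horner_coef0 p0 eqxx => ->.
by rewrite exprMn mulrAC coefMXn mk.
Qed.

Lemma series_coefP p q k : q`_0 != 0 ->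
  \sum_(i < k.+1) q`_i * series_coef (p%:F / q%:F) (k - i) = p`_k.
Proof.
move=> q0; set f := _ / _.
have qn0 : q != 0 by apply: contraNneq q0 => ->; rewrite coef0.
rewrite /series_coef; set x := repr f.
have d0 : x.2 != 0 := denom_ratioP x.
have ef : x.1 * q = p * x.2.
  apply/eqP; rewrite -tofrac_eq !tofracM -numdenE -/x /f mulrAC.
  by rewrite divfK ?tofrac_eq0.
set d := gcdp _ _; set p' := _ %/ d; set q' := _ %/ d; set c := (q'`_0)^-1.
have dn0 : d != 0 by rewrite gcdp_eq0 negb_and d0 orbT.
have ep : x.1 = p' * d by rewrite divpK // dvdp_gcdl.
have eq : x.2 = q' * d by rewrite divpK // dvdp_gcdr.
have q'0 : q' != 0 by apply: contraNneq d0 => z; rewrite eq z mul0r.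
have e' : p' * q = p * q'.
  by apply: (mulIf dn0); rewrite mulrAC -ep ef eq mulrA.
have cop : coprimep q' p'.
  by rewrite coprimep_sym coprimep_div_gcd // d0 orbT.
have /dvdpP [r er] : q' %| q by rewrite -(Gauss_dvdpr _ cop) e' dvdp_mull.
have epr : p = p' * r.
  by apply: (mulIf q'0); rewrite -e' er mulrA.
have nz : q'`_0 != 0.
  by apply: contraNneq q0 => z; rewrite er coef0M z mulr0.
set u := 1 - c *: q'; have u0 : u`_0 = 0.
  by rewrite coefB coef1 coefZ mulVf // subrr.
pose S m := \sum_(j < m.+1) c *: u ^+ j.
have qS m : q' * S m = 1 - u ^+ m.+1.
  rewrite /S -scaler_sumr -scalerAr scalerAl.
  have -> : c *: q' = 1 - u by rewrite opprB addrC subrK.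
  by rewrite -(opprB u 1) mulNr -subrX1 opprB.
have stab m : (m <= k)%N -> (p' * S m)`_m = (p' * S k)`_m.
  move=> mk; rewrite /S -(big_mkord xpredT (fun j => c *: u ^+ j)).
  rewrite -(big_mkord xpredT (fun j => c *: u ^+ j)) (@big_cat_nat _ _ _ m.+1 _ k.+1) //=.
  rewrite mulrDr coefD [X in _ = _ + X](_ : _ = 0) ?addr0 //.
  rewrite mulr_sumr coef_sum big_nat big1 // => j /andP [mj _].
  by rewrite -scalerAr coefZ mulrC (mulrC p') coef_dvdX // mul0r.
rewrite (eq_bigr (fun i : 'I_k.+1 => q`_i * (p' * S k)`_(k - i))); last first.
  by move=> i _; rewrite -stab ?leq_subr.
rewrite -coefM er mulrA (mulrC _ p') mulrA -epr -mulrA qS mulrBr mulr1.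
by rewrite coefB (mulrC p) coef_dvdX // subr0.
Qed.

End PowerSeriesExpansion.

Section SixVertex.

Local Notation one := false (only parsing).
Local Notation two := true (only parsing).

(* [b], [l], [u], [r]: bottom, left, top and right edges of the vertex. *)
Definition R_weight (K : fieldType) (a t : K) (b l u r : bool) : K :=
  match b, l, u, r with
  | two, two, two, two => 1
  | one, one, one, one => 1
  | two, one, two, one => (1 - a) / (1 - t * a)
  | two, one, one, two => (1 - t) * a / (1 - t * a)
  | one, two, two, one => (1 - t) / (1 - t * a)
  | one, two, one, two => t * (1 - a) / (1 - t * a)
  | _, _, _, _ => 0
  end.

Variables (R : realType) (n : nat) (t : R) (a : 'I_n -> R).

Local Notation K := {fraction {poly R}}.

Definition word := {ffun 'I_n -> bool}.

Definition alpha : K := 'X%:F.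
Definition const_alpha (c : R) : K := (c%:P)%:F.

(* [h ord0], ..., [h ord_max] are the horizontal edges from left to right;
   [widen_ord _ i] and [lift ord0 i] are [i] and [i + 1] in ['I_n.+1]. *)
Definition transfer_coef (e e' : word) : K :=
  \sum_(h : {ffun 'I_n.+1 -> bool} | h ord0 == one)
    \prod_(i < n) R_weight (alpha * const_alpha (a i)) (const_alpha t)
      (e i) (h (widen_ord (leqnSn n) i)) (e' i) (h (lift ord0 i)).

(* Operators on the n-th tensor power of V are matrices indexed by words;
   column [j] holds the image of the basis vector [enum_val j]. *)
Definition transfer : 'M[K]_#|word| :=
  \matrix_(i, j) transfer_coef (enum_val j) (enum_val i).

Definition transfer_tilde : 'M[K]_#|word| :=
  (\prod_(i < n) ((1 - const_alpha t * alpha * const_alpha (a i)) /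
                  (1 - alpha * const_alpha (a i)))) *: transfer.

Definition transfer_series (k : nat) : 'M[R]_#|word| :=
  map_mx (fun f => series_coef f k) transfer_tilde.

Definition stochastic N (M : 'M[R]_N) : Prop :=
  (forall i j, 0 <= M i j) /\ (forall j, \sum_i M i j = 1).

End SixVertex.

(* Main.v *)
(** Suppose first 0 < t < 1 and fix the number k of letters 2.  Add k auxiliary sites with parameter
    0 and let the affine Hecke algebra act on the permutations of all sites (one colour per site,
    each generator T_i and the rotation omega being a nonnegative matrix); reading the colours
    0, ..., n-1 as 1, the others as 2, and forgetting the auxiliary sites defines a nonnegative map
    rho onto words with rho T_i = rho for i < n.  The resolvent of the Jucys-Murphy type element X_0
    is computed by the six-vertex row, so that T_r rho = rho g_r(X_0, ..., X_(n-1)) for the commuting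
    elements X_i; hence Theta(f) rho = rho f(X) for every symmetric f.  By the Bernstein relations,
    rho x^lambda Q = rho (v_lambda P_lambda)(X), where Q is a sum of products of the T_i, i < n, with
    nonnegative coefficients.  Since X_0 ... X_(r-1) is, up to a power of t, the r-th power of a
    product of omega and T_i's, the dominant monomial X^lambda is a nonnegative matrix, so
    Theta(v_lambda P_lambda) rho is nonnegative, and rho sees every column of Theta(v_lambda P_lambda).
    The column sums of T_r are g_r(a), hence those of Theta(f) are f(a).  Evaluated on the module
    with k = 0, (v_lambda P_lambda)(a) is bounded below by the weight of one path, which does not
    depend on t.  All matrix entries are rational in t without pole on [0, 1), which gives t = 0. *)
Require Import Defs.
Set Warnings "-all".
From HB Require Import structures.
From mathcomp Require Import all_boot all_order all_fingroup all_algebra.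
From mathcomp Require boolp.
From mathcomp Require Import reals.
From mathcomp.multinomials Require Import mpoly ssrcomplements.
From mathcomp Require Import zify ring lra.

Set Implicit Arguments.
Unset Strict Implicit.
Unset Printing Implicit Defensive.
Import Order.TTheory GRing.Theory Num.Theory.
Local Open Scope ring_scope.

(** * Affine Hecke algebra *)

Section AffineHecke.
Variables (A : pzRingType) (N : nat) (T Ti : nat -> A) (om : A).
Hypothesis TTi : forall i, (0 < i <= N)%N -> T i * Ti i = 1.
Hypothesis TiT : forall i, (0 < i <= N)%N -> Ti i * T i = 1.
Hypothesis T_braid : forall i, (0 < i < N)%N -> T i * T i.+1 * T i = T i.+1 * T i * T i.+1.
Hypothesis T_far : forall i j, (0 < i)%N -> (i.+1 < j <= N)%N -> T i * T j = T j * T i.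
Hypothesis omT : forall i, (0 < i < N)%N -> om * T i = T i.+1 * om.
Hypothesis omomT : (0 < N)%N -> om * om * T N = T 1%N * (om * om).

Fixpoint dprod m d : A := if d is d'.+1 then T (m + d) * dprod m d' else 1.
Fixpoint Yop i : A :=
  if i is i'.+1 then Ti i * Yop i' * Ti i else om * dprod 0 N.
Definition Wop r : A := om * dprod r (N - r).

Lemma dprodSr m d : dprod m d.+1 = dprod m.+1 d * T m.+1.
Proof.
elim: d => [|d IH]; first by rewrite /= mulr1 mul1r addn1.
by rewrite [LHS]/= -/(dprod m d.+1) IH mulrA -addSnnS.
Qed.

Lemma dprod_shift m d j : (m.+1 < j <= m + d)%N -> (m + d <= N)%N ->
  dprod m d * T j = T j.-1 * dprod m d.
Proof.
elim: d j => [|d IH] j; first by lia.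
move=> hj hN /=; have [ej|nj] := eqVneq j (m + d.+1)%N; last first.
  by rewrite -mulrA IH ?mulrA; [rewrite (T_far (i := j.-1)); [|lia..] |lia..].
case: d IH hj hN ej => [|d] _ hj hN ej; first by lia.
rewrite ej /= mulrA.
have -> : (m + d.+2)%N = (m + d.+1).+1 by lia.
rewrite [_.+1.-1]/= -mulrA -mulrA.
have -> : dprod m d * T (m + d.+1).+1 = T (m + d.+1).+1 * dprod m d.
  elim: d hj hN ej => [|d IH] hj hN ej /=; first by rewrite mulr1 mul1r.
  have E : forall k, (k <= d.+1)%N ->
      dprod m k * T (m + d.+2).+1 = T (m + d.+2).+1 * dprod m k.
    elim=> [|k IHk] hk /=; first by rewrite mulr1 mul1r.
    by rewrite -mulrA IHk ?mulrA; [rewrite (T_far (i := (m + k.+1)%N)); [|lia..]|lia].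
  exact: (E d.+1).
by rewrite !mulrA -T_braid //; lia.
Qed.

Lemma comm_dprod x m d :
  (forall j, (m < j <= m + d)%N -> GRing.comm x (T j)) -> GRing.comm x (dprod m d).
Proof.
elim: d => [|d IH] h /=; first exact: commr1.
by apply: commrM; [apply: h; lia | apply: IH => j hj; apply: h; lia].
Qed.

Lemma comm_Ti x i : (0 < i <= N)%N -> GRing.comm x (T i) -> GRing.comm x (Ti i).
Proof.
move=> hi c; rewrite /GRing.comm -[x * Ti i]mul1r -(TiT hi) -[Ti i * T i * _]mulrA.
by rewrite [T i * (x * _)]mulrA -c -[x * T i * _]mulrA TTi // mulr1.
Qed.

Lemma Yop0_comm j : (1 < j <= N)%N -> GRing.comm (Yop 0) (T j).
Proof.
move=> hj; rewrite /GRing.comm /= -mulrA dprod_shift //.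
by rewrite mulrA omT; [rewrite prednK ?mulrA //; lia | lia].
Qed.

Lemma T_comm i j : (0 < i <= N)%N -> (0 < j <= N)%N -> (i.+1 < j)%N || (j.+1 < i)%N ->
  GRing.comm (T i) (T j).
Proof.
move=> hi hj /orP [h|h]; first by apply: (@T_far i j); lia.
by apply: commr_sym; apply: (@T_far j i); lia.
Qed.

Lemma Yop_comm_gt i j : (i <= N)%N -> (i.+1 < j <= N)%N -> GRing.comm (Yop i) (T j).
Proof.
elim: i j => [|i IH] j hi hj; first exact: Yop0_comm.
have c : GRing.comm (T j) (Ti i.+1) by apply: comm_Ti; [lia|apply: T_comm; lia].
have c' : GRing.comm (T j) (Yop i) by apply/commr_sym/IH; lia.
by apply: commr_sym => /=; apply: commrM => //; apply: commrM.
Qed.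

Lemma Yop_comm_lt i j : (i <= N)%N -> (0 < j < i)%N -> GRing.comm (Yop i) (T j).
Proof.
elim: i => [|i IH] hi hj; first by lia.
have [ij|nij] := eqVneq j i; last first.
  have c : GRing.comm (T j) (Ti i.+1) by apply: comm_Ti; [lia|apply: T_comm; lia].
  have c' : GRing.comm (T j) (Yop i) by apply/commr_sym/IH; lia.
  by apply: commr_sym => /=; apply: commrM => //; apply: commrM.
case: i IH ij hi hj => [|i] IH ij hi hj; first by lia.
rewrite ij => {IH ij hj}.
have h1 : (0 < i.+1 <= N)%N by lia.
have h2 : (0 < i.+2 <= N)%N by lia.
have cY : Yop i * T i.+2 = T i.+2 * Yop i by apply: Yop_comm_gt; lia.
have brl : T i.+1 * Ti i.+2 * Ti i.+1 = Ti i.+2 * Ti i.+1 * T i.+2.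
  have L x y : T i.+1 * T i.+2 * x = T i.+1 * T i.+2 * y -> x = y.
    move/(congr1 (fun z => Ti i.+2 * (Ti i.+1 * z))).
    by rewrite -!mulrA !(mulrA (Ti i.+1) (T i.+1)) TiT // !mul1r !(mulrA (Ti i.+2)) TiT // !mul1r.
  apply: L; rewrite !mulrA -[_ * T i.+2 * T i.+1]/(_) T_braid; last by lia.
  rewrite -[_ * T i.+2 * Ti i.+2]mulrA TTi // mulr1 -[_ * T i.+1 * Ti i.+1]mulrA TTi // mulr1.
  by rewrite -[_ * T i.+2 * Ti i.+2]mulrA TTi // mulr1 TTi // mul1r.
have brr : T i.+2 * Ti i.+1 * Ti i.+2 = Ti i.+1 * Ti i.+2 * T i.+1.
  have L x y : x * (T i.+2 * T i.+1) = y * (T i.+2 * T i.+1) -> x = y.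
    move/(congr1 (fun z => z * Ti i.+1 * Ti i.+2)).
    by rewrite !mulrA -!(mulrA _ (T i.+1) (Ti i.+1)) TTi // !mulr1 -!(mulrA _ (T i.+2) (Ti i.+2)) TTi // !mulr1.
  apply: L; rewrite -!mulrA (mulrA (Ti i.+2) (T i.+2)) TiT // mul1r TiT // mulr1.
  by rewrite (mulrA (T i.+1) (T i.+2)) T_braid; [rewrite !mulrA -(mulrA (Ti i.+1) (Ti i.+2)) TiT // mulr1 TiT // mul1r|lia].
have -> : Yop i.+2 = Ti i.+2 * Ti i.+1 * Yop i * (Ti i.+1 * Ti i.+2) by rewrite /= !mulrA.
rewrite /GRing.comm; transitivity (Ti i.+2 * Ti i.+1 * (Yop i * T i.+2) * (Ti i.+1 * Ti i.+2)).
  by rewrite -mulrA -brr !mulrA.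
by rewrite cY !mulrA -brl.
Qed.

Lemma omdprod m d : (m + d < N)%N -> om * dprod m d = dprod m.+1 d * om.
Proof.
elim: d => [|d IH] h /=; first by rewrite mulr1 mul1r.
by rewrite mulrA omT; [rewrite -mulrA IH ?mulrA //; lia|lia].
Qed.

Lemma dprod_dprod d : (d.+1 <= N)%N -> dprod 0 d.+1 * dprod 1 d = dprod 0 d * dprod 0 d.+1.
Proof.
move=> hd; suff E : forall e, (e <= d)%N -> dprod 0 d.+1 * dprod 1 e = dprod 0 e * dprod 0 d.+1.
  exact: E.
elim=> [|e IH] he; first by rewrite mulr1 mul1r.
by rewrite [dprod 1 _]/= mulrA dprod_shift; [rewrite -mulrA IH ?mulrA //; lia|lia..].
Qed.

Lemma Yop01_comm : (0 < N)%N -> GRing.comm (Yop 0) (Yop 1).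
Proof.
move=> N0; set B := om * dprod 1 N.-1.
have h1 : (0 < 1 <= N)%N by lia.
have e0 : Yop 0 = B * T 1.
  by rewrite /B -mulrA -dprodSr prednK.
have e1 : Yop 1 = Ti 1 * B by rewrite [Yop 1]/= -/(Yop 0) e0 -!mulrA TTi // mulr1.
have eBB : B * B = om * om * (dprod 0 N.-1 * dprod 1 N.-1).
  by rewrite /B -!mulrA (mulrA (dprod 1 N.-1) om) -omdprod; [rewrite !mulrA|lia].
have c : B * B * T 1 = T 1 * (B * B).
  have -> : T 1 * (B * B) = om * om * (T N * dprod 0 N.-1 * dprod 1 N.-1).
    by rewrite eBB mulrA -omomT // !mulrA.
  have -> : T N * dprod 0 N.-1 = dprod 0 N by case: (N) N0.
  rewrite eBB -!mulrA -dprodSr prednK //.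
  by have := @dprod_dprod N.-1; rewrite prednK // => ->.
rewrite /GRing.comm e0 e1 mulrA -[B * T 1 * Ti 1]mulrA TTi // mulr1.
by rewrite mulrA -[Ti 1 * B * B]mulrA -mulrA c mulrA TiT // mul1r.
Qed.

Lemma Yop_comm i j : (i <= N)%N -> (j <= N)%N -> GRing.comm (Yop i) (Yop j).
Proof.
wlog ij : i j / (i < j)%N => [h|] hi hj.
  case: (ltngtP i j) => [ij|ij|->]; [exact: h|exact/commr_sym/h|exact: commr_refl].
elim: i j ij hi hj => [|i IH] j ij hi hj.
  elim: j ij hj {hi} => [|[|j] IHj] // _ hj; first exact: Yop01_comm.
  have c : GRing.comm (Yop 0) (Ti j.+2) by apply: comm_Ti; [lia|apply: Yop_comm_gt; lia].
  by rewrite [Yop j.+2]/=; apply: commrM => //; apply: commrM => //; apply: IHj; lia.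
have c : GRing.comm (Yop j) (Ti i.+1) by apply: comm_Ti; [lia|apply: Yop_comm_lt; lia].
apply: commr_sym; rewrite [Yop i.+1]/=; apply: commrM => //; apply: commrM => //.
by apply/commr_sym/IH; lia.
Qed.

Lemma Wop_shift r j : (0 < j < r)%N -> (r <= N)%N -> Wop r * T j = T j.+1 * Wop r.
Proof.
move=> hj hr; rewrite /Wop -mulrA.
have c : GRing.comm (T j) (dprod r (N - r)).
  by apply: comm_dprod => i hi; apply: T_comm; lia.
by rewrite -c mulrA omT ?mulrA //; lia.
Qed.

Lemma Wop_rec r : (r < N)%N -> Wop r = Wop r.+1 * T r.+1.
Proof. by move=> h; rewrite /Wop -mulrA -dprodSr; congr (_ * dprod _ _); lia. Qed.

Fixpoint aprod m d : A := if d is d'.+1 then T m.+1 * aprod m.+1 d' else 1.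

Lemma aprodSr m d : aprod m d.+1 = aprod m d * T (m + d).+1.
Proof.
elim: d m => [|d IH] m; first by rewrite /= mulr1 mul1r addn0.
by rewrite [LHS]/= -/(aprod m.+1 d.+1) IH mulrA addSnnS.
Qed.

Lemma Wop_pow r s : (s <= r.+1)%N -> (r < N)%N ->
  Wop r ^+ s = Wop r.+1 ^+ s * aprod (r.+1 - s) s.
Proof.
move=> hs hr; elim: s hs => [|s IH] hs; first by rewrite !expr0 mulr1.
have sh : T r.+1 * Wop r.+1 ^+ s = Wop r.+1 ^+ s * T (r.+1 - s).
  elim: s {IH} hs => [|s IH] hs; first by rewrite expr0 mulr1 mul1r subn0.
  rewrite exprSr mulrA IH; last by lia.
  have -> : (r.+1 - s = (r.+1 - s.+1).+1)%N by lia.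
  rewrite -[LHS]mulrA -Wop_shift //; last by lia.
  by rewrite mulrA -exprSr.
rewrite exprS IH; last by lia.
have e : (r.+1 - s.+1).+1 = (r.+1 - s)%N by lia.
rewrite (Wop_rec hr) [aprod _ s.+1]/= e; move: (Wop r.+1) sh => w sh.
by rewrite mulrA -(mulrA w) sh mulrA -exprS mulrA.
Qed.

Lemma YopE r : (r <= N)%N -> aprod 0 r * Yop r = Wop r.
Proof.
elim: r => [|r IH] hr; first by rewrite mul1r /Wop subn0.
rewrite aprodSr add0n /= !mulrA -[_ * T r.+1 * Ti _]mulrA TTi ?mulr1; last by lia.
by rewrite IH ?(Wop_rec hr); [move: (Wop _) => w; rewrite -mulrA TTi ?mulr1 //; lia|lia].
Qed.

Lemma prod_Yop r : (r <= N)%N -> \prod_(0 <= i < r.+1) Yop i = Wop r ^+ r.+1.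
Proof.
elim: r => [|r IH] hr; first by rewrite big_nat1 expr1 /Wop subn0.
rewrite big_nat_recr //= -/(Yop r.+1) IH; last by lia.
rewrite Wop_pow // subnn -[LHS]mulrA (YopE hr).
by move: (Wop _) => w; rewrite -exprSr.
Qed.

End AffineHecke.

Lemma mxZl (R : comPzRingType) p c (M P : 'M[R]_p) : (c *: M) * P = c *: (M * P).
Proof. exact/esym/scalemxAl. Qed.

Lemma mxZr (R : comPzRingType) p c (M P : 'M[R]_p) : M * (c *: P) = c *: (M * P).
Proof. exact/esym/scalemxAr. Qed.

Section CommutingEvaluation.
Variables (R : fieldType) (n p : nat) (X : 'I_n -> 'M[R]_p).
Hypothesis XC : forall i j, GRing.comm (X i) (X j).

Definition mon_ev (m : 'X_{1..n}) : 'M[R]_p := \prod_(i < n) X i ^+ m i.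
Definition ev (f : {mpoly R[n]}) : 'M[R]_p := \sum_(m <- msupp f) f@_m *: mon_ev m.

Lemma evE f i : (msize f <= i)%N ->
  ev f = \sum_(m : 'X_{1..n < i}) f@_m *: mon_ev m.
Proof.
move=> hi; rewrite /ev (big_mksub 'X_{1..n < i}) ?msupp_uniq //=; last first.
  by move=> x /msize_mdeg_lt /leq_trans; apply.
rewrite big_rmcond //= => j /memN_msupp_eq0 ->.
by rewrite scale0r.
Qed.

Lemma ev_is_linear : linear ev.
Proof.
move=> c f g; set i := maxn (msize (c *: f + g)) (maxn (msize f) (msize g)).
rewrite !(@evE _ i) ?leq_max ?leqnn ?orbT //.
rewrite scaler_sumr -big_split /=; apply: eq_bigr => m _.
by rewrite mcoeffD mcoeffZ scalerDl scalerA.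
Qed.
HB.instance Definition _ := GRing.isLinear.Build R {mpoly R[n]} 'M[R]_p _ ev ev_is_linear.

Lemma evD f g : ev (f + g) = ev f + ev g. Proof. exact: linearD. Qed.
Lemma evZ c f : ev (c *: f) = c *: ev f. Proof. exact: linearZ. Qed.

Lemma evX m : ev 'X_[m] = mon_ev m.
Proof. by rewrite /ev msuppX big_seq1 mcoeffX eqxx scale1r. Qed.

Lemma mon_evD m1 m2 : mon_ev (m1 + m2) = mon_ev m1 * mon_ev m2.
Proof.
rewrite /mon_ev.
have comm (r : seq 'I_n) i k (m : 'X_{1..n}) :
    GRing.comm (X i ^+ k) (\prod_(j <- r) X j ^+ m j).
  elim: r => [|j r IH]; first by rewrite big_nil; apply: commr1.
  rewrite big_cons; apply: commrM => //.
  by apply: commrX; apply/commr_sym/commrX/XC.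
elim: (index_enum _) => [|i r IH]; first by rewrite !big_nil mulr1.
rewrite !big_cons IH mnmDE exprD -!mulrA; congr (_ * _).
by rewrite mulrA comm -mulrA.
Qed.

Lemma evM f g : ev (f * g) = ev f * ev g.
Proof.
elim/mpolyind: f => [|c m f _ _ IH]; first by rewrite mul0r linear0 mul0r.
rewrite mulrDl !linearD /= IH mulrDl; congr (_ + _).
rewrite -scalerAl !linearZ /= mxZl; congr (_ *: _).
elim/mpolyind: g {IH} => [|d k g _ _ IHg]; first by rewrite mulr0 linear0 mulr0.
rewrite mulrDr !linearD /= IHg mulrDr; congr (_ + _).
rewrite -scalerAr !linearZ /= mxZr; congr (_ *: _).
by rewrite -mpolyXD !evX mon_evD.
Qed.

Lemma ev1 : ev 1 = 1.
Proof. by rewrite -mpolyX0 evX /mon_ev big1 // => i _; rewrite mnm0E expr0. Qed.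

Lemma evXn f k : ev (f ^+ k) = ev f ^+ k.
Proof. by elim: k => [|k IH]; rewrite ?expr0 ?ev1 // !exprS evM IH. Qed.

Lemma evXi i : ev 'X_i = X i.
Proof.
rewrite evX /mon_ev (eq_bigr (fun k => if k == i then X i else 1)).
  by rewrite -big_mkcond big_pred1_eq.
by move=> k _; rewrite mnm1E eq_sym; case: eqP => [->|]; rewrite ?expr1 ?expr0.
Qed.

End CommutingEvaluation.

(** * Divided differences and Hall-Littlewood symmetrization *)

Section DividedDifference.
Variables (R : fieldType) (n : nat).
Implicit Types (f g : {mpoly R[n]}) (i j : 'I_n).

Lemma msymXi (s : 'S_n) i : msym s 'X_i = 'X_(s i) :> {mpoly R[n]}.
Proof.
rewrite msymX; congr mpolyX; apply/mnmP => j.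
by rewrite mnmE !mnm1E -(inj_eq (@perm_inj _ s)) permKV.
Qed.

Lemma mpolyX_inj i j : 'X_i = 'X_j :> {mpoly R[n]} -> i = j.
Proof.
move/(congr1 (mcoeff U_(i)%MM)); rewrite !mcoeffX eqxx.
case: eqP => [e _|_ /eqP]; last by rewrite oner_eq0.
have := congr1 (fun m : 'X_{1..n} => m i) e; rewrite !mnm1E eqxx.
by case: eqP.
Qed.

Lemma mpoly_alg_ind (P : {mpoly R[n]} -> Prop) :
  P 0 -> P 1 -> (forall i, P 'X_i) -> (forall f g, P f -> P g -> P (f * g)) ->
  (forall c f g, P f -> P g -> P (c *: f + g)) -> forall f, P f.
Proof.
move=> P0 P1 PX PM PD; have PXm k m : P ('X_k ^+ m).
  by elim: m => [|m IH]; [rewrite expr0 | rewrite exprS; apply: PM].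
elim/mpolyind => [//|c m f _ _ IH]; apply: PD => //.
by rewrite mpolyXE_id; apply: big_ind => // k _; apply: PXm.
Qed.

Lemma dd_ex i j f : exists d, ('X_i - 'X_j) * d == f - msym (tperm i j) f.
Proof.
pose P f := exists d, ('X_i - 'X_j) * d = f - msym (tperm i j) f.
have PM a b : P a -> P b -> P (a * b).
  move=> [d hd] [e he]; exists (d * b + msym (tperm i j) a * e).
  by rewrite mulrDr mulrA hd mulrCA he msymM; ring.
have P1 : P 1 by exists 0; rewrite rmorph1 subrr mulr0.
have PX k : P 'X_k.
  rewrite /P msymXi; case: tpermP => [->|->|_ _].
  - by exists 1; rewrite mulr1.
  - by exists (-1); rewrite mulrN1 opprB.
  - by exists 0; rewrite mulr0 subrr.
suff : P f by move=> [d hd]; exists d; rewrite hd.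
have P0 : P 0 by exists 0; rewrite rmorph0 mulr0 subrr.
have PL c g h : P g -> P h -> P (c *: g + h).
  move=> [e he] [d hd]; exists (c *: e + d).
  by rewrite mulrDr -scalerAr he hd msymD msymZ scalerBr opprD addrACA.
exact: (@mpoly_alg_ind P P0 P1 PX PM PL f).
Qed.

Fact dd_key : {d : 'I_n -> 'I_n -> {mpoly R[n]} -> {mpoly R[n]} |
  forall i j f, ('X_i - 'X_j) * d i j f = f - msym (tperm i j) f}.
Proof. by exists (fun i j f => xchoose (dd_ex i j f)) => i j f; apply/eqP/(xchooseP (dd_ex i j f)). Qed.

Definition dd := sval dd_key.

Lemma ddE i j f : ('X_i - 'X_j) * dd i j f = f - msym (tperm i j) f.
Proof. exact: (svalP dd_key). Qed.

Lemma subX_neq0 i j : i != j -> 'X_i - 'X_j != 0 :> {mpoly R[n]}.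
Proof. by move=> ij; rewrite subr_eq0; apply/eqP => /mpolyX_inj /eqP; rewrite (negbTE ij). Qed.

Lemma dd_uniq i j f d : i != j -> ('X_i - 'X_j) * d = f - msym (tperm i j) f -> dd i j f = d.
Proof. by move=> ij h; apply: (mulfI (subX_neq0 ij)); rewrite ddE h. Qed.

Lemma dd_linear i j c f g : i != j -> dd i j (c *: f + g) = c *: dd i j f + dd i j g.
Proof.
move=> ij; apply: (dd_uniq ij).
rewrite mulrDr.
rewrite -scalerAr.
rewrite (ddE i j f) (ddE i j g).
rewrite msymD.
rewrite msymZ.
by rewrite scalerBr opprD addrACA.
Qed.

Lemma ddM i j f g : i != j -> dd i j (f * g) = dd i j f * msym (tperm i j) g + f * dd i j g.
Proof.
move=> ij; apply: (dd_uniq ij).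
by rewrite mulrDr mulrA ddE mulrCA ddE msymM; ring.
Qed.

Definition demazure t i j f := msym (tperm i j) f + (1 - t) *: ('X_i * dd i j f).

Lemma demazure_inv t i j f : i != j -> msym (tperm i j) f = f -> demazure t i j f = f.
Proof.
move=> ij h; rewrite /demazure (dd_uniq (d := 0) ij); last by rewrite mulr0 h subrr.
by rewrite h mulr0 scaler0 addr0.
Qed.

Lemma demazure_linear t i j c f g : i != j ->
  demazure t i j (c *: f + g) = c *: demazure t i j f + demazure t i j g.
Proof.
move=> ij; rewrite /demazure dd_linear // msymD msymZ mulrDr -scalerAr.
rewrite !scalerDr !scalerA addrACA; congr (_ + _ + (_ + _)).
by rewrite mulrC.
Qed.

Section Bernstein.
Variables (p : nat) (X : 'I_n -> 'M[R]_p) (T : 'M[R]_p) (t : R) (i j : 'I_n).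
Hypothesis XC : forall i j, GRing.comm (X i) (X j).
Hypothesis ij : i != j.
Hypothesis XiT : X i * T = T * X j + (1 - t) *: X i.
Hypothesis XjT : X j * T = T * X i - (1 - t) *: X i.
Hypothesis XkT : forall k, k != i -> k != j -> X k * T = T * X k.

Lemma bernstein f :
  ev X f * T = T * ev X (msym (tperm i j) f) + (1 - t) *: ev X ('X_i * dd i j f).
Proof.
pose B f := ev X f * T = T * ev X (msym (tperm i j) f) + (1 - t) *: ev X ('X_i * dd i j f).
have BM a b : B a -> B b -> B (a * b).
  move=> ha hb; rewrite /B evM // -mulrA hb mulrDr mulrA ha mulrDl -addrA msymM.
  rewrite (evM XC (msym _ a)) !mulrA; congr (_ + _).
  rewrite ddM // mulrDr linearD /= scalerDr; congr (_ + _).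
    by rewrite mxZl -(evM XC) mulrA.
  by rewrite mxZr -(evM XC) mulrCA.
have B1 : B 1.
  rewrite /B (dd_uniq (d := 0) ij); last by rewrite mulr0 rmorph1 subrr.
  by rewrite mulr0 linear0 scaler0 addr0 rmorph1 !ev1 mul1r mulr1.
have BX k : B 'X_k.
  rewrite /B msymXi !evXi; case: tpermP => [->|->|/eqP ki /eqP kj].
  - rewrite (dd_uniq (d := 1) ij); first by rewrite mulr1 ?evXi XiT.
    by rewrite mulr1 msymXi tpermL.
  - rewrite (dd_uniq (d := -1) ij); first by rewrite mulrN1 linearN /= ?evXi XjT scalerN.
    by rewrite mulrN1 opprB msymXi tpermR.
  - rewrite (dd_uniq (d := 0) ij); first by rewrite mulr0 linear0 scaler0 addr0 ?evXi XkT.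
    by rewrite mulr0 msymXi tpermD 1?eq_sym // subrr.
have B0 : B 0.
  rewrite /B (dd_uniq (d := 0) ij); last by rewrite mulr0 rmorph0 subrr.
  by rewrite rmorph0 mulr0 linear0 mul0r mulr0 scaler0 addr0.
have BL c g h : B g -> B h -> B (c *: g + h).
  move=> hg hh; rewrite /B dd_linear // msymD msymZ !(evD, evZ) mulrDl mulrDr hh mxZl hg mxZr.
  rewrite (mulrDr 'X_i) -scalerAr evD evZ !scalerDr !scalerA (mulrC c (1 - t)).
  by rewrite addrACA.
exact: (@mpoly_alg_ind B B0 B1 BX BM BL f).
Qed.

Lemma ev_demazure (q : nat) (rho : 'M[R]_(q, p)) f : rho *m T = rho ->
  rho *m ev X f *m T = rho *m ev X (demazure t i j f).
Proof.
move=> rT; have b : ev X f *m T = T *m _ + _ := bernstein f.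
by rewrite -mulmxA b mulmxDr mulmxA rT /demazure evD evZ mulmxDr.
Qed.
End Bernstein.
End DividedDifference.

Section Interpolation.
Variables (K : fieldType) (I : finType) (P : pred I) (v : I -> K) (t : K).
Hypothesis v_inj : {in P &, injective v}.
Hypothesis v_neq0 : forall i, P i -> v i != 0.

Local Notation hE := (hornerD, hornerN, hornerZ, hornerM, hornerX, hornerC).

Definition hl_weight j := \prod_(i | P i && (i != j)) ((v j - t * v i) / (v j - v i)).

Lemma horner_prodXsubC (Q : pred I) (w : I -> K) u :
  (\prod_(i | Q i) ('X - (w i)%:P)).[u] = \prod_(i | Q i) (u - w i).
Proof. by rewrite horner_prod; apply: eq_bigr => i _; rewrite hornerXsubC. Qed.

Lemma horner_prod1subX (Q : pred I) (w : I -> K) u :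
  (\prod_(i | Q i) (1 - w i *: 'X)).[u] = \prod_(i | Q i) (1 - w i * u).
Proof. by rewrite horner_prod; apply: eq_bigr => i _; rewrite !hE. Qed.

Lemma size_prod_le2 (Q : pred I) (F : I -> {poly K}) :
  (forall i, Q i -> size (F i) <= 2)%N -> (size (\prod_(i | Q i) F i)%R <= #|Q|.+1)%N.
Proof.
move=> h; apply: leq_trans (size_prod_leq _ _) _.
have : (\sum_(i | Q i) size (F i) <= \sum_(i | Q i) 2)%N by apply: leq_sum.
by rewrite sum_nat_const; lia.
Qed.

Lemma poly0_on_nodes (w : I -> K) (p : {poly K}) :
  {in P &, injective w} -> (forall i, P i -> w i != 0) ->
  p.[0] = 0 -> (forall j, P j -> p.[w j] = 0) -> (size p <= #|P|.+1)%N -> p = 0.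
Proof.
move=> wi wn p0 pw sp; apply: (@roots_geq_poly_eq0 _ p (0 :: [seq w j | j <- enum P])).
- rewrite /= rootE p0 eqxx; apply/allP => x /mapP [j]; rewrite mem_enum => Pj ->.
  by rewrite rootE pw.
- rewrite /= map_inj_in_uniq ?enum_uniq ?andbT; last first.
    by move=> i j; rewrite !mem_enum => Pi Pj; apply: wi.
  apply/mapP => -[j]; rewrite mem_enum => Pj e.
  by have := wn j Pj; rewrite -e eqxx.
- by rewrite /= size_map -cardE.
Qed.

Lemma card_predD1 j : P j -> #|P| = #|[pred i | P i && (i != j)]|.+1.
Proof.
move=> Pj; rewrite (cardD1 j) [j \in P]Pj add1n; congr _.+1.
by apply: eq_card => i; rewrite !inE andbC.
Qed.

Lemma hl_weightM j : P j ->
  hl_weight j * \prod_(i | P i && (i != j)) (v j - v i) =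
  \prod_(i | P i && (i != j)) (v j - t * v i).
Proof.
move=> Pj; rewrite /hl_weight -big_split /=; apply: eq_bigr => i /andP [Pi ij].
by rewrite divfK // subr_eq0; apply: contraNneq ij => /v_inj ->.
Qed.

Lemma hl_interpolation :
  \prod_(i | P i) ('X - (t * v i)%:P) =
  t ^+ #|P| *: \prod_(i | P i) ('X - (v i)%:P) +
  (1 - t) *: ('X * \sum_(j | P j) hl_weight j *: \prod_(i | P i && (i != j)) ('X - (v i)%:P)).
Proof.
apply/eqP; rewrite -subr_eq0; apply/eqP; apply: (poly0_on_nodes v_inj v_neq0).
- rewrite !hE !horner_prodXsubC mul0r mulr0 addr0.
  under eq_bigr => i _ do rewrite sub0r -mulrN.
  rewrite [X in _ * X](eq_bigr (fun i => - v i)) => [|i _]; last by rewrite sub0r.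
  by rewrite big_split /= prodr_const subrr.
- move=> j Pj; rewrite !hE !horner_prodXsubC horner_sum.
  rewrite [X in t ^+ _ * X](bigD1 j) //= subrr mul0r mulr0 add0r.
  rewrite [X in v j * X](bigD1 j) //= hornerZ horner_prodXsubC.
  rewrite [X in v j * (_ + X)]big1 => [|k /andP [Pk kj]]; last first.
    by rewrite hornerZ horner_prodXsubC (bigD1 j) /= ?Pj 1?eq_sym // subrr mul0r mulr0.
  by rewrite addr0 (bigD1 j) //= hl_weightM //; ring.
- apply: leq_trans (size_polyD _ _) _; rewrite size_polyN geq_max.
  rewrite size_prod_le2 => [|i _]; last by rewrite size_XsubC.
  apply: leq_trans (size_polyD _ _) _; rewrite geq_max; apply/andP; split.
    apply: leq_trans (size_scale_leq _ _) _.
    by apply: size_prod_le2 => i _; rewrite size_XsubC.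
  apply: leq_trans (size_scale_leq _ _) _.
  apply: leq_trans (size_polyMleq _ _) _; rewrite size_polyX ltnS; apply: leq_trans (size_sum _ _ _) _; apply/bigmax_leqP => j Pj.
  apply: leq_trans (size_scale_leq _ _) _; rewrite (card_predD1 Pj).
  by apply: size_prod_le2 => i _; rewrite size_XsubC.
Qed.

Lemma hl_partial_fractions u : u != 0 -> (forall i, P i -> u != v i) ->
  t ^+ #|P| + \sum_(j | P j) (1 - t) * u / (u - v j) * hl_weight j =
  \prod_(i | P i) ((u - t * v i) / (u - v i)).
Proof.
move=> u0 uv; have nz i : P i -> u - v i != 0 by move=> Pi; rewrite subr_eq0 uv.
have D0 : \prod_(i | P i) (u - v i) != 0 by apply/prodf_neq0.
rewrite prodf_div; apply: (mulIf D0); rewrite divfK //.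
have := congr1 (fun p => p.[u]) hl_interpolation.
rewrite !hE !horner_prodXsubC horner_sum => ->.
rewrite mulrDl; congr (_ + _); rewrite mulr_suml !mulr_sumr; apply: eq_bigr => j Pj.
rewrite hornerZ horner_prodXsubC.
rewrite (bigD1 j) //=; move: (\prod_(i | _ ) _) => x; have := nz j Pj => nzj.
by field.
Qed.

Lemma hl_generating :
  \prod_(i | P i) (1 - (t * v i) *: 'X) =
  \prod_(i | P i) (1 - v i *: 'X) +
  (1 - t) *: (\sum_(j | P j) (hl_weight j * v j) *:
              ('X * \prod_(i | P i && (i != j)) (1 - v i *: 'X))).
Proof.
apply/eqP; rewrite -subr_eq0; apply/eqP; apply: (@poly0_on_nodes (fun i => (v i)^-1)).
- by move=> i j Pi Pj /invr_inj; apply: v_inj.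
- by move=> i Pi; rewrite invr_eq0 v_neq0.
- rewrite !hE !horner_prod1subX horner_sum.
  rewrite big1 => [|i _]; last by rewrite mulr0 subr0.
  rewrite big1 => [|i _]; last by rewrite mulr0 subr0.
  by rewrite big1 ?mulr0 ?addr0 ?subrr // => i _; rewrite !hE mul0r mulr0.
- move=> j Pj; rewrite !hE !horner_prod1subX horner_sum.
  rewrite [X in _ - (X + _)](bigD1 j) //= mulfV ?v_neq0 // subrr mul0r add0r.
  rewrite [X in (1 - t) * X](bigD1 j) //= !hE horner_prod1subX.
  rewrite [X in (1 - t) * (_ + X)]big1 => [|k /andP [Pk kj]]; last first.
    rewrite !hE horner_prod1subX (bigD1 j) /= ?Pj 1?eq_sym //.
    by rewrite mulfV ?v_neq0 // subrr mul0r !mulr0.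
  rewrite addr0 (bigD1 j) //=.
  have fE (w : I -> K) : \prod_(i | P i && (i != j)) (1 - w i * (v j)^-1) =
     (\prod_(i | P i && (i != j)) (v j - w i)) * \prod_(i | P i && (i != j)) (v j)^-1.
    rewrite -big_split /=; apply: eq_bigr => i _.
    by rewrite mulrBl mulfV ?v_neq0.
  rewrite !fE -hl_weightM //.
  have vj := v_neq0 Pj; set x := \prod_(i | _ && _) (v j - v i); set y := \prod_(i | _ && _) _^-1.
  by field.
- apply: leq_trans (size_polyD _ _) _; rewrite size_polyN geq_max.
  have s2 (x : K) : (size (1 - x *: 'X : {poly K})%R <= 2)%N.
    apply: leq_trans (size_polyD _ _) _; rewrite size_polyN geq_max size_poly1 /=.
    by apply: leq_trans (size_scale_leq _ _) _; rewrite size_polyX.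
  rewrite size_prod_le2 //=.
  apply: leq_trans (size_polyD _ _) _; rewrite geq_max size_prod_le2 //=.
  apply: leq_trans (size_scale_leq _ _) _.
  apply: leq_trans (size_sum _ _ _) _; apply/bigmax_leqP => j Pj.
  apply: leq_trans (size_scale_leq _ _) _.
  apply: leq_trans (size_polyMleq _ _) _; rewrite size_polyX ltnS (card_predD1 Pj).
  exact: size_prod_le2.
Qed.

End Interpolation.

Section Symmetrizer.
Variables (R : fieldType) (n' : nat).
Local Notation n := n'.+1.
Implicit Types (f h : {mpoly R[n]}) (m d : nat).

Definition fixes_below m (w : 'S_n) := [forall i : 'I_n, (i < m)%N ==> (w i == i)].

Lemma fixes_belowP m (w : 'S_n) : reflect (forall i : 'I_n, (i < m)%N -> w i = i) (fixes_below m w).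
Proof.
apply: (iffP forallP) => [h i im|h i]; first by apply/eqP/(implyP (h i)).
by apply/implyP => im; apply/eqP/h.
Qed.

Definition sym_above m f := forall w : 'S_n, fixes_below m w -> msym w f = f.

Definition demazure_nat (t : R) m h := demazure t (inord m) (inord m.+1) h.

Fixpoint symC (t : R) d m h : {mpoly R[n]} :=
  if d is d'.+1 then t ^+ d *: h + symC t d' m.+1 (demazure_nat t m h) else h.

Fixpoint symQ (t : R) d m f : {mpoly R[n]} :=
  if d is d'.+1 then symC t d m (symQ t d' m.+1 f) else f.

Lemma fixes_below_tperm m (i j : 'I_n) : (m <= i)%N -> (m <= j)%N -> fixes_below m (tperm i j).
Proof.
move=> mi mj; apply/fixes_belowP => k km; rewrite tpermD //.
  by apply: contraTneq km => <-; rewrite -leqNgt.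
by apply: contraTneq km => <-; rewrite -leqNgt.
Qed.

Lemma fixes_belowW m m' (w : 'S_n) : (m <= m')%N -> fixes_below m' w -> fixes_below m w.
Proof.
by move=> mm /fixes_belowP h; apply/fixes_belowP => i im; apply: h; apply: leq_trans im mm.
Qed.

Lemma fixes_belowM m (w w' : 'S_n) :
  fixes_below m w -> fixes_below m w' -> fixes_below m (w * w')%g.
Proof.
move=> /fixes_belowP h /fixes_belowP h'; apply/fixes_belowP => i im.
by rewrite permM h ?h'.
Qed.

Lemma fixes_belowV m (w : 'S_n) : fixes_below m w -> fixes_below m (w^-1)%g.
Proof.
move=> /fixes_belowP h; apply/fixes_belowP => i im.
by apply: (@perm_inj _ w); rewrite permKV h.
Qed.

Lemma fixes_below_ge m (w : 'S_n) (i : 'I_n) : fixes_below m w -> (m <= w i)%N = (m <= i)%N.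
Proof.
move=> /fixes_belowP h; apply/idP/idP; apply: contraTT; rewrite -!ltnNge => hi.
  by rewrite h.
by have := h _ hi => /perm_inj e; rewrite -e.
Qed.

Lemma msymMP (w : 'S_n) (c : R) : msym w c%:MP = c%:MP.
Proof. by rewrite /msym mmapC. Qed.

Lemma sym_above_demazure t m h : (m < n')%N -> sym_above m.+1 h ->
  sym_above m.+2 (demazure_nat t m h).
Proof.
move=> mn hs w hw; rewrite /demazure_nat /demazure.
set a : 'I_n := inord m; set b : 'I_n := inord m.+1.
have am : a = m :> nat by rewrite inordK //; lia.
have bm : b = m.+1 :> nat by rewrite inordK //; lia.
have ab : a != b by rewrite -val_eqE /= am bm; lia.
have wa : w a = a by move/fixes_belowP: hw => -> //; rewrite ?am ?bm; lia.
have wb : w b = b by move/fixes_belowP: hw => -> //; rewrite ?am ?bm; lia.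
have wh : msym w h = h by apply: hs; apply: fixes_belowW hw.
have wsh : msym w (msym (tperm a b) h) = msym (tperm a b) h.
  rewrite -{2}wh -!msymMm; congr (msym _ h).
  by rewrite conjgC tpermJ wa wb.
have wd : msym w (dd a b h) = dd a b h.
  apply/esym/(dd_uniq ab).
  have -> : 'X_a - 'X_b = msym w ('X_a - 'X_b) :> {mpoly R[n]}.
    by rewrite msymB !msymXi wa wb.
  by rewrite -msymM ddE msymB wh wsh.
by rewrite msymD msymZ msymM msymXi wa wd wsh.
Qed.

Section Points.
Variable K : fieldType.
Implicit Type y : {rmorphism {mpoly R[n]} -> K}.

Definition hl_factor y t (i j : 'I_n) : K :=
  (y 'X_i - y t%:MP_[n] * y 'X_j) / (y 'X_i - y 'X_j).

Lemma hl_factor_msym y w t i j :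
  hl_factor (y \o msym w) t i j = hl_factor y t (w i) (w j).
Proof. by rewrite /hl_factor /= !msymXi msymMP. Qed.

Lemma demazure_point y t i j h : injective y -> i != j ->
  y (demazure t i j h) =
    y (msym (tperm i j) h) * hl_factor y t j i +
    y h * ((1 - y t%:MP_[n]) * y 'X_i / (y 'X_i - y 'X_j)).
Proof.
move=> yi ij; rewrite /demazure rmorphD /= -mul_mpolyC !rmorphM /= mpolyCB rmorphB /= mpolyC1 rmorph1.
have nz : y 'X_i - y 'X_j != 0.
  by rewrite subr_eq0; apply: contraNneq ij => /yi /mpolyX_inj ->.
have -> : y (dd i j h) = (y h - y (msym (tperm i j) h)) / (y 'X_i - y 'X_j).
  by apply: (mulIf nz); rewrite divfK // -!rmorphB -rmorphM /= mulrC ddE.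
rewrite /hl_factor.
have nz' : y 'X_j - y 'X_i != 0 by rewrite -opprB oppr_eq0.
by field; rewrite nz nz'.
Qed.

Lemma symC_point t d m h y : (m + d = n')%N -> sym_above m.+1 h -> injective y ->
  y (symC t d m h) =
  \sum_(j : 'I_n | (m <= j)%N) y (msym (tperm (inord m) j) h) *
     \prod_(i : 'I_n | (m <= i)%N && (i != j)) hl_factor y t j i.
Proof.
elim: d m h y => [|d IH] m h y md hs yi.
  rewrite addn0 in md; have mE : inord m = ord_max :> 'I_n by apply: val_inj; rewrite /= inordK md.
  rewrite (big_pred1 ord_max) => [|j]; last first.
    by rewrite /= -val_eqE /=; have := leq_ord j; lia.
  rewrite mE tperm1 msym1m big1 ?mulr1 // => i /andP [im].
  by rewrite -val_eqE /=; have := leq_ord i; lia.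
set a : 'I_n := inord m; set b : 'I_n := inord m.+1.
have am : a = m :> nat by rewrite inordK //; lia.
have bm : b = m.+1 :> nat by rewrite inordK //; lia.
have ab : a != b by rewrite -val_eqE /= am bm; lia.
have gs : sym_above m.+2 (demazure_nat t m h) by apply: sym_above_demazure => //; lia.
rewrite [symC _ _ _ _]/= rmorphD /= IH //; last by lia.
have ma (j : 'I_n) : (m <= j)%N = (j == a) || (m < j)%N.
  by rewrite leq_eqVlt -val_eqE /= am eq_sym.
have X_inj i j : y 'X_i = y 'X_j -> i = j by move/yi/mpolyX_inj.
pose P (i : 'I_n) := (m < i)%N; pose v (i : 'I_n) := y 'X_i.
pose tK := y t%:MP_[n].
have W (j : 'I_n) : P j ->
    \prod_(i : 'I_n | (m < i)%N && (i != j)) hl_factor y t j i = hl_weight P v tK j.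
  by move=> Pj.
have Ejm (j : 'I_n) : P j ->
    y (msym (tperm b j) (demazure_nat t m h)) =
    y (msym (tperm a j) h) * hl_factor y t j a +
    y h * ((1 - tK) * v a / (v a - v j)).
  move=> Pj; have ja : j != a by rewrite -val_eqE /= am; move: Pj; rewrite /P; lia.
  have := @demazure_point (y \o msym (tperm b j)) t a b h.
  have ba : b != a by rewrite eq_sym.
  rewrite /= hl_factor_msym !msymXi msymMP tpermL [tperm b j a]tpermD // => -> //.
    have -> : msym (tperm b j) h = h.
      by apply: hs; apply: fixes_below_tperm => //; rewrite bm.
    have -> // : msym (tperm b j) (msym (tperm a b) h) = msym (tperm a j) h.
    have e : (tperm b j * tperm a b * tperm b j)%g = tperm a j.
      by rewrite -{1}[tperm b j]tpermV -mulgA -conjgE tpermJ tpermL tpermD.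
    rewrite -e !msymMm; congr (msym _ (msym _ _)); apply/esym.
    by apply: hs; apply: fixes_below_tperm => //; rewrite bm.
  by move=> f g /= /yi /inj_msym.
rewrite (eq_bigr _ (fun j Pj => congr1 (fun z => z * _) (Ejm j Pj))).
under eq_bigr => j Pj do rewrite mulrDl.
rewrite big_split /= [RHS](bigD1 a) /=; last by rewrite am.
rewrite tperm1 msym1m addrCA [LHS]addrC; congr (_ + _); last first.
  apply: eq_big => [j|j Pj].
    by rewrite ma /P; case: eqP => [->|_]; rewrite ?am ?ltnn ?andbF ?andbT ?orbF /=.
  have ja : j != a by rewrite -val_eqE /= am; move: Pj; rewrite /P; lia.
  rewrite -mulrA; congr (_ * _); rewrite [RHS](bigD1 a) /=; last by rewrite am leqnn eq_sym.
  congr (_ * _); apply: eq_bigl => i; rewrite ma.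
  by have [->|_] := eqVneq i a; rewrite ?am ?ltnn ?andbF ?andbT ?orbF /=.
have v_inj : {in P &, injective v} by move=> i j _ _; apply: X_inj.
have vn0 i : v i != 0.
  apply/eqP => e; have /(congr1 (mcoeff U_(i)%MM)) : 'X_i = 0 :> {mpoly R[n]}.
    by apply: (yi); rewrite rmorph0.
  by rewrite mcoeffX eqxx mcoeff0 => /eqP; rewrite oner_eq0.
have uv i : P i -> v a != v i.
  by move=> Pi; apply/eqP => /X_inj e; move: Pi; rewrite /P -e am ltnn.
have cP : #|P| = d.+1.
  rewrite -sum1_card; transitivity (\sum_(m.+1 <= i < n) 1)%N.
    by rewrite big_geq_mkord; apply: eq_bigl.
  by rewrite sum_nat_const_nat; lia.
have -> : \prod_(i : 'I_n | (m <= i)%N && (i != a)) hl_factor y t a i =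
          \prod_(i | P i) ((v a - tK * v i) / (v a - v i)).
  by apply: eq_bigl => i; rewrite ma /P; case: eqP => [->|_]; rewrite ?am ?ltnn ?andbF ?andbT ?orbF /=.
rewrite -(hl_partial_fractions tK v_inj (fun i _ => vn0 i)) // cP mulrDr; congr (_ + _).
  by rewrite -mul_mpolyC rmorphM /= mulrC !rmorphXn.
rewrite mulr_sumr; apply: eq_bigr => j Pj; rewrite -mulrA; congr (_ * (_ * _)).
Qed.

Lemma fixes_below_sum m (F : 'S_n -> K) : (m < n)%N ->
  \sum_(w | fixes_below m w) F w =
  \sum_(j : 'I_n | (m <= j)%N) \sum_(w | fixes_below m.+1 w) F (w * tperm (inord m) j)%g.
Proof.
move=> mn; set a : 'I_n := inord m.
have am : a = m :> nat by rewrite inordK.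
rewrite (partition_big (fun w : 'S_n => w a) (fun j : 'I_n => (m <= j)%N)) /=; last first.
  by move=> w hw; rewrite (fixes_below_ge _ hw) am.
apply: eq_bigr => j mj; rewrite (reindex_inj (mulIg (tperm a j))) /=.
apply: eq_bigl => w; apply/andP/idP => [[hw /eqP e]|hw].
  have ht : fixes_below m (tperm a j) by apply: fixes_below_tperm; rewrite ?am.
  have hw' : fixes_below m w by rewrite -(mulgK (tperm a j) w) tpermV; apply: fixes_belowM.
  apply/fixes_belowP => i; rewrite ltnS leq_eqVlt => /orP [/eqP im|im]; last first.
    by move/fixes_belowP: hw' => ->.
  have -> : i = a by apply: val_inj; rewrite /= im am.
  by apply: (@perm_inj _ (tperm a j)); rewrite -permM e tpermL.
split; first by apply: fixes_belowM; [apply: fixes_belowW hw | apply: fixes_below_tperm; rewrite ?am].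
by rewrite permM; move/fixes_belowP: hw => ->; rewrite ?am ?tpermL.
Qed.

Definition symQ_sum t m f y : K :=
  \sum_(w | fixes_below m w) y (msym w f) *
     \prod_(i : 'I_n | (m <= i)%N) \prod_(j : 'I_n | (i < j)%N) hl_factor y t (w i) (w j).

Lemma symQ_sum_msym t m f y (v : 'S_n) : fixes_below m v ->
  symQ_sum t m f (y \o msym v) = symQ_sum t m f y.
Proof.
move=> hv; rewrite /symQ_sum [RHS](reindex_inj (mulIg v)) /=.
apply: eq_big => [w|w hw].
  apply/idP/idP => hw; first exact: fixes_belowM.
  by rewrite -(mulgK v w); apply: fixes_belowM => //; apply: fixes_belowV.
rewrite msymMm; congr (_ * _); apply: eq_bigr => i _; apply: eq_bigr => j _.
by rewrite hl_factor_msym !permM.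
Qed.

Lemma symQ_point t d m f y : (m + d = n')%N -> injective y ->
  y (symQ t d m f) = symQ_sum t m f y.
Proof.
elim: d m y => [|d IH] m y md yi.
  rewrite addn0 in md; rewrite /= /symQ_sum (big_pred1 1%g) => [|w]; last first.
    apply/idP/eqP => [/fixes_belowP hw|->]; last by apply/fixes_belowP => i; rewrite perm1.
    apply/permP => i; rewrite perm1; have [im|mi] := ltnP i m; first exact: hw.
    have iE (j : 'I_n) : (m <= j)%N -> j = ord_max by move=> mj; apply: val_inj; rewrite /=; have := leq_ord j; lia.
    rewrite (iE i mi); apply: iE; rewrite leqNgt; apply/negP => wm.
    by have := hw _ wm => /perm_inj e; move: wm; rewrite e /= md ltnn.
  rewrite msym1m big1 ?mulr1 // => i mi; rewrite big1 // => j ij.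
  by have := leq_ord j; lia.
have md' : (m.+1 + d = n')%N by lia.
have hs : sym_above m.+1 (symQ t d m.+1 f).
  move=> w hw; apply: (yi); rewrite -[LHS]/((y \o msym w) _) !IH //; first exact: symQ_sum_msym.
  by move=> g h /= /yi /inj_msym.
rewrite -[symQ t d.+1 m f]/(symC t d.+1 m (symQ t d m.+1 f)) symC_point // /symQ_sum fixes_below_sum; last by lia.
set a : 'I_n := inord m; have am : a = m :> nat by rewrite inordK //; lia.
apply: eq_bigr => j mj.
rewrite -[y (msym _ _)]/((y \o msym (tperm a j)) _) IH //; last by move=> g h /= /yi /inj_msym.
rewrite mulr_suml; apply: eq_bigr => w hw; rewrite msymMm -mulrA; congr (_ * _).
rewrite [RHS](bigD1 a) /=; last by rewrite am.
rewrite mulrC; congr (_ * _); last first.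
  apply: eq_big => [i|i _].
    by rewrite -val_eqE /= am; lia.
  by apply: eq_bigr => k _; rewrite hl_factor_msym !permM.
have wa : w a = a by move/fixes_belowP: hw => ->; rewrite ?am.
rewrite [RHS](reindex_inj (@perm_inj _ (w * tperm a j)^-1)%g) /=.
apply: eq_big => [i|i _]; last by rewrite permKV permM wa tpermL.
set k := ((w * tperm a j)^-1 i)%g.
have ki : i = tperm a j (w k) by rewrite -permM permKV.
have -> : (a < k)%N = (m < w k)%N by rewrite am (fixes_below_ge k hw).
rewrite ki; case: tpermP => [->|->|/eqP ka /eqP kj]; rewrite ?am ?eqxx ?andbF ?ltnn //=.
  rewrite leqnn /= eq_sym ltn_neqAle mj andbT -am; congr (~~ _).
  by rewrite -val_eqE.
have : nat_of_ord (w k) != m by rewrite -am val_eqE.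
by rewrite kj andbT; lia.
Qed.

Lemma symQ_sym t f (tof : {rmorphism {mpoly R[n]} -> K}) : injective tof ->
  symQ t n' 0 f \is symmetric.
Proof.
move=> yi; apply/issymP => w; apply: (yi).
rewrite -[LHS]/((tof \o msym w) _) !symQ_point //; first exact/symQ_sum_msym/fixes_belowP.
by move=> g h /= /yi /inj_msym.
Qed.

End Points.
End Symmetrizer.

Section ElementaryRelation.
Variables (K : comNzRingType) (I : finType).
Implicit Type v : I -> K.

Definition esum v r : K := \sum_(J : {set I} | #|J| == r) \prod_(i in J) v i.

Lemma coef_prod1subX v c r :
  (\prod_i (1 - (c * v i) *: 'X))`_r = (- c) ^+ r * esum v r.
Proof.
rewrite (eq_bigr (fun i => (- c * v i) *: 'X + 1)) => [|i _]; last first.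
  by rewrite addrC mulNr scaleNr.
rewrite bigA_distr coef_sum /esum mulr_sumr [RHS]big_mkcond; apply: eq_bigr => J _.
rewrite -big_mkcond /=.
have -> : \prod_(i in J) ((- c * v i) *: 'X) =
          ((- c) ^+ #|J| * \prod_(i in J) v i) *: 'X^#|J| :> {poly K}.
  rewrite -prodr_const -big_split /= -prodr_const -scaler_prod.
  by apply: eq_bigr.
by rewrite coefZ coefXn eq_sym; case: eqP => [->|]; rewrite ?mulr1 ?mulr0.
Qed.

Lemma coef_div1subX (p q : {poly K}) c r : p = q * (1 - c *: 'X) ->
  q`_r = \sum_(s < r.+1) p`_(r - s) * c ^+ s.
Proof.
move=> ->; elim: r => [|r IH].
  by rewrite big_ord1 /= subn0 mulrBr mulr1 coefB -scalerAr coefZ coefMX mulr0 subr0 mulr1.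
rewrite big_ord_recl /= subn0 mulr1 [in X in _ = X + _]mulrBr mulr1 coefB -scalerAr coefZ coefMX /=.
rewrite (eq_bigr (fun s : 'I_r.+1 => c * ((q * (1 - c *: 'X))`_(r - s) * c ^+ s))) => [|s _].
  by rewrite -mulr_sumr -IH subrK.
by rewrite /bump /= add1n subSS exprS mulrBr mulr1 -scalerAr; ring.
Qed.
End ElementaryRelation.

Lemma esum_hl_relation (K : fieldType) (I : finType) (v : I -> K) (t : K) r :
  injective v -> (forall i, v i != 0) ->
  (- t) ^+ r * esum v r = (-1) ^+ r * esum v r +
   \sum_(1 <= s < r.+1) (-1) ^+ (r - s) * esum v (r - s)%N *
     ((1 - t) * \sum_j v j ^+ s * hl_weight xpredT v t j).
Proof.
move=> v_inj vn0; have vi : {in xpredT &, injective v} by move=> i j _ _; apply: v_inj.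
have := congr1 (fun p : {poly K} => p`_r) (@hl_generating _ _ xpredT v t vi (fun i _ => vn0 i)).
rewrite coef_prod1subX => ->.
have E k : (\prod_i (1 - v i *: 'X))`_k = (-1) ^+ k * esum v k.
  by rewrite -coef_prod1subX; under [in RHS]eq_bigr do rewrite mul1r.
rewrite coefD E coefZ coef_sum; congr (_ + _).
rewrite [RHS](eq_bigr (fun s => (1 - t) *
   \sum_j (-1) ^+ (r - s) * esum v (r - s)%N * (v j ^+ s * hl_weight xpredT v t j))); last first.
  by move=> s _; rewrite -!mulr_sumr; ring.
rewrite -mulr_sumr exchange_big /=; congr (_ * _); apply: eq_bigr => j _.
rewrite coefZ mulrC; case: r => [|r].
  by rewrite coefXM mul0r big_geq.
rewrite coefXM /= big_add1 big_mkord.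
have D : \prod_i (1 - v i *: 'X) = \prod_(i | true && (i != j)) (1 - v i *: 'X) * (1 - v j *: 'X).
  by rewrite (bigD1 j) //= mulrC.
rewrite (coef_div1subX r D).
rewrite mulr_suml; apply: eq_bigr => s _.
by rewrite E subSS exprS; ring.
Qed.

Lemma esum_mesym (R : fieldType) n (K : fieldType) (y : {rmorphism {mpoly R[n]} -> K}) r :
  y (mesym n R r) = esum (fun i : 'I_n => y 'X_i) r.
Proof. by rewrite rmorph_sum /=; apply: eq_bigr => J _; rewrite rmorph_prod. Qed.

Section HallLittlewoodQ.
Variables (R : fieldType) (n' : nat).
Local Notation n := n'.+1.
Local Notation tof := (@tofrac {mpoly R[n]} : {rmorphism {mpoly R[n]} -> {fraction {mpoly R[n]}}}).
Local Notation cst := (tof \o @mpolyC n R : {rmorphism R -> {fraction {mpoly R[n]}}}).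

Lemma tofracZ c (f : {mpoly R[n]}) : tof (c *: f) = cst c * tof f.
Proof. by rewrite -mul_mpolyC rmorphM. Qed.

Lemma tofrac_inj : injective (@tofrac {mpoly R[n]}).
Proof. by move=> p q /eqP; rewrite tofrac_eq => /eqP. Qed.

Lemma mesym_hl_relation t r :
  (- t) ^+ r *: mesym n R r = (-1) ^+ r *: mesym n R r +
   \sum_(1 <= s < r.+1) ((-1) ^+ (r - s) *: mesym n R (r - s)%N) *
     ((1 - t) *: symC t n' 0 ('X_ord0 ^+ s)).
Proof.
apply: tofrac_inj.
have vn0 (i : 'I_n) : tof 'X_i != 0.
  rewrite tofrac_eq0; apply/eqP => /(congr1 (mcoeff U_(i)%MM)).
  by rewrite mcoeffX eqxx mcoeff0 => /eqP; rewrite oner_eq0.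
have vi : injective (fun i : 'I_n => tof 'X_i) by move=> i j /tofrac_inj /mpolyX_inj.
rewrite -[LHS]/(tof _) -[RHS]/(tof _) rmorphD rmorph_sum !tofracZ !esum_mesym !rmorphXn !rmorphN rmorph1.
rewrite esum_hl_relation //; congr (_ + _); apply: eq_big_nat => s _.
rewrite rmorphM !tofracZ esum_mesym rmorphXn rmorphN rmorphB rmorph1; congr (_ * (_ * _)).
rewrite symC_point ?add0n //; last first.
- exact: tofrac_inj.
- move=> w /fixes_belowP hw; rewrite rmorphXn /= msymXi hw //.
apply: eq_bigr => j _; congr (_ * _).
  have -> : inord 0 = ord0 :> 'I_n by apply: val_inj; rewrite /= inordK.
  by rewrite !rmorphXn /= msymXi tpermL.
Qed.

Fixpoint qfact (t : R) d : R :=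
  if d is d'.+1 then qfact t d' * \sum_(i < d.+1) t ^+ i else 1.

Lemma sym_aboveW m m' (h : {mpoly R[n]}) : (m <= m')%N -> sym_above m h -> sym_above m' h.
Proof. by move=> mm hs w hw; apply: hs; apply: fixes_belowW hw. Qed.

Lemma symC_sym t d m (h : {mpoly R[n]}) : (m + d = n')%N -> sym_above m h ->
  symC t d m h = (\sum_(i < d.+1) t ^+ i) *: h.
Proof.
elim: d m => [|d IH] m md hs; first by rewrite big_ord1 expr0 scale1r.
have am : (inord m : 'I_n) = m :> nat by rewrite inordK //; lia.
have bm : (inord m.+1 : 'I_n) = m.+1 :> nat by rewrite inordK //; lia.
rewrite [symC _ _ _ _]/= /demazure_nat demazure_inv; last first.
- by apply: hs; apply: fixes_below_tperm; rewrite ?am ?bm.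
- by rewrite -val_eqE /= am bm; lia.
rewrite IH; [|lia|exact: sym_aboveW hs].
by rewrite -scalerDl [in RHS]big_ord_recr addrC.
Qed.

Lemma symQ_sym_above t d m (h : {mpoly R[n]}) : (m + d = n')%N -> sym_above m h ->
  symQ t d m h = qfact t d *: h.
Proof.
elim: d m => [|d IH] m md hs; first by rewrite scale1r.
rewrite -[symQ _ _ _ _]/(symC t d.+1 m (symQ t d m.+1 h)).
rewrite IH; [|lia|exact: sym_aboveW hs].
rewrite symC_sym // ?scalerA; first by rewrite mulrC.
by move=> w hw; rewrite msymZ hs.
Qed.

Lemma inord_neq m : (m < n')%N -> (inord m : 'I_n) != inord m.+1.
Proof. by move=> h; rewrite -val_eqE /= !inordK; lia. Qed.

Lemma symCZ t d m c (h : {mpoly R[n]}) : (m + d = n')%N ->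
  symC t d m (c *: h) = c *: symC t d m h.
Proof.
elim: d m h => [|d IH] m h md //=; rewrite /demazure_nat.
have := @demazure_linear _ _ t (inord m) (inord m.+1) c h 0 (inord_neq _).
rewrite (_ : demazure t _ _ 0 = 0) ?addr0 => [->|]; last first.
  by rewrite demazure_inv ?msym0 ?inord_neq //; lia.
  by lia.
by rewrite IH ?scalerDr ?scalerA 1?mulrC //; lia.
Qed.

Lemma symQ_sym_aboveS t d m (h : {mpoly R[n]}) : (m + d = n')%N -> sym_above m.+1 h ->
  symQ t d m h = qfact t d.-1 *: symC t d m h.
Proof.
case: d => [|d] md hs; first by rewrite scale1r.
rewrite -[symQ _ _ _ _]/(symC t d.+1 m (symQ t d m.+1 h)).
by rewrite symQ_sym_above ?symCZ //; lia.
Qed.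

End HallLittlewoodQ.

Section HallLittlewoodLink.
Variables (R : realType) (n' : nat) (t : R).
Local Notation n := n'.+1.
Hypothesis t01 : 0 <= t < 1.

Lemma geom_gt0 d : 0 < \sum_(i < d.+1) t ^+ i.
Proof.
case/andP: t01 => t0 t1; rewrite big_ord_recl expr0 ltr_pwDl //.
by apply: sumr_ge0 => i _; apply: exprn_ge0.
Qed.

Lemma geomE d : (1 - t ^+ d) / (1 - t) = \sum_(i < d) t ^+ i.
Proof.
have nz : 1 - t != 0 by rewrite subr_eq0; case/andP: t01 => _ /gt_eqF ->.
by apply: (mulIf nz); rewrite divfK // -[1 - _]opprB subrX1 -mulNr opprB mulrC.
Qed.

Lemma HL_v_gt0 (lam : n.-tuple nat) : 0 < HL_v t lam.
Proof.
apply: prodr_gt0 => k _; rewrite big_add1 /=; apply: prodr_gt0 => i _.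
by rewrite geomE geom_gt0.
Qed.

Lemma symQ_HL (lam : n.-tuple nat) :
  symQ t n' 0 (\prod_(i < n) 'X_i ^+ tnth lam i) = HL_v t lam *: (HL t lam : {mpoly R[n]}).
Proof.
apply: tofrac_inj; rewrite tofracZ; set z := (X in _ = _ * X).
have -> : z = HL_frac t lam := HLE t lam; rewrite /HL_frac.
rewrite [LHS](@symQ_point _ _ _ _ _ _ _ (@tofrac {mpoly R[n]})) //; last exact: tofrac_inj.
rewrite /= mulrA mulfV ?mul1r; last by rewrite tofrac_eq0 mpolyC_eq0 gt_eqF ?HL_v_gt0.
apply: eq_big => [w|w _]; first exact/fixes_belowP.
rewrite /HL_summand rmorph_prod /= rmorph_prod /=; congr (_ * _).
by apply: eq_bigr => i _; rewrite !rmorphXn /= msymXi.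
Qed.

Lemma prod_geom d : \prod_(1 <= i < d.+1) ((1 - t ^+ i) / (1 - t)) = qfact t d.-1.
Proof.
case: d => [|d]; first by rewrite big_nil.
elim: d => [|d IH]; first by rewrite big_nat1 geomE big_ord1 expr0.
by rewrite big_nat_recr //= IH geomE.
Qed.

Lemma HL_gE s : (0 < s)%N ->
  (HL_g n t s : {mpoly R[n]}) = (1 - t) *: symC t n' 0 ('X_ord0 ^+ s).
Proof.
case: s => // s0 _; set s := s0.+1; set lam : n.-tuple nat := [tuple if (i : nat) == 0%N then s else 0%N | i < n].
have lamE : lam = s :: nseq n' 0%N :> seq nat.
  apply: (@eq_from_nth _ 0%N) => [|i]; first by rewrite size_tuple /= size_nseq.
  rewrite size_tuple => hi; rewrite -[i]/(val (Ordinal hi)) -tnth_nth tnth_mktuple /=.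
  by case: i hi => [|i] hi //=; rewrite nth_nseq if_same.
have hmax : \max_(i < n) tnth lam i = s.
  by rewrite big_ord_recl big1 ?maxn0 => [|i _]; rewrite tnth_mktuple.
have hv : HL_v t lam = qfact t n'.-1.
  rewrite /HL_v hmax lamE big_ord_recl /= [X in _ * X]big1 ?mulr1 => [|k _].
    by rewrite count_nseq /= mul1n add0n prod_geom.
  rewrite count_nseq /= mul0n addn0; case: eqP => _; last by rewrite big_nil.
  by rewrite prod_geom.
have := symQ_HL lam; rewrite big_ord_recl big1 ?mulr1; last first.
  by move=> i _; rewrite tnth_mktuple expr0.
rewrite tnth_mktuple /= symQ_sym_aboveS ?add0n ?hv //; last first.
  by move=> w /fixes_belowP hw; rewrite rmorphXn /= msymXi hw.
have q0 : qfact t n'.-1 != 0 by rewrite -hv gt_eqF ?HL_v_gt0.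
by move=> /(scalerI q0) ->.
Qed.

End HallLittlewoodLink.

Section OperatorSymmetrizer.
Variables (R : fieldType) (n' p q : nat) (t : R).
Local Notation n := n'.+1.
Variables (X : 'I_n -> 'M[R]_p) (T : nat -> 'M[R]_p) (rho : 'M[R]_(q, p)).
Hypothesis XC : forall i j, GRing.comm (X i) (X j).
Hypothesis XiT : forall m, (m < n')%N ->
  X (inord m) * T m.+1 = T m.+1 * X (inord m.+1) + (1 - t) *: X (inord m).
Hypothesis XjT : forall m, (m < n')%N ->
  X (inord m.+1) * T m.+1 = T m.+1 * X (inord m) - (1 - t) *: X (inord m).
Hypothesis XkT : forall m k, (m < n')%N -> k != inord m -> k != inord m.+1 ->
  X k * T m.+1 = T m.+1 * X k.
Hypothesis rhoT : forall m, (m < n')%N -> rho *m T m.+1 = rho.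

Fixpoint matC d m : 'M[R]_p :=
  if d is d'.+1 then t ^+ d *: 1%:M + T m.+1 *m matC d' m.+1 else 1%:M.
Fixpoint matQ d m : 'M[R]_p :=
  if d is d'.+1 then matQ d' m.+1 *m matC d m else 1%:M.

Lemma ev_matC d m f : (m + d = n')%N ->
  rho *m ev X f *m matC d m = rho *m ev X (symC t d m f).
Proof.
elim: d m f => [|d IH] m f md /=; first by rewrite mulmx1.
have mn : (m < n')%N by lia.
rewrite mulmxDr -scalemxAr mulmx1 mulmxA.
have -> : rho *m ev X f *m T m.+1 = rho *m ev X (demazure_nat t m f).
  apply: (ev_demazure XC (inord_neq mn) (XiT mn) (XjT mn)); last exact: rhoT.
  by move=> k; apply: XkT.
by rewrite IH; [rewrite evD evZ mulmxDr -scalemxAr|lia].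
Qed.

Lemma ev_matQ d m f : (m + d = n')%N ->
  rho *m ev X f *m matQ d m = rho *m ev X (symQ t d m f).
Proof.
elim: d m f => [|d IH] m f md; first by rewrite /= mulmx1.
by rewrite [matQ _ _]/= mulmxA IH; [rewrite -/(matC d.+1 m) ev_matC|lia].
Qed.
End OperatorSymmetrizer.

Section PolynomialFamilies.
Variables (R : fieldType) (n' : nat).
Local Notation n := n'.+1.

Definition poly_family (F : R -> {mpoly R[n]}) :=
  exists P : {poly {mpoly R[n]}}, forall t, F t = P.[t%:MP].

Lemma family_const f : poly_family (fun=> f).
Proof. by exists f%:P => t; rewrite hornerC. Qed.

Lemma family_add F G : poly_family F -> poly_family G -> poly_family (fun t => F t + G t).
Proof. by move=> [P hP] [Q hQ]; exists (P + Q) => t; rewrite hornerD hP hQ. Qed.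

Lemma family_opp F : poly_family F -> poly_family (fun t => - F t).
Proof. by move=> [P hP]; exists (- P) => t; rewrite hornerN hP. Qed.

Lemma family_exp k F : poly_family F -> poly_family (fun t => t ^+ k *: F t).
Proof.
move=> [P hP]; exists ('X^k * P) => t.
by rewrite hornerM hornerXn hP -mul_mpolyC rmorphXn.
Qed.

Lemma family_lin (L : {mpoly R[n]} -> {mpoly R[n]}) F :
  (forall c f g, L (c *: f + g) = c *: L f + L g) -> poly_family F -> poly_family (fun t => L (F t)).
Proof.
move=> hL [P hP]; exists (\poly_(i < size P) L P`_i) => t.
have L0 : L 0 = 0.
  by have := hL (-1) 0 0; rewrite scaler0 addr0 scaleN1r addNr.
have LD f g : L (f + g) = L f + L g by rewrite -{1}[f]scale1r hL scale1r.
rewrite hP horner_poly horner_coef (big_morph L LD L0); apply: eq_bigr => i _.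
rewrite -rmorphXn /= ![_ * _%:MP]mulrC !mul_mpolyC.
by rewrite -[_ *: P`_i]addr0 hL L0 addr0.
Qed.

Lemma family_ext F G : (forall t, F t = G t) -> poly_family G -> poly_family F.
Proof. by move=> h [P hP]; exists P => t; rewrite h. Qed.

Lemma family_demazure i j F : i != j -> poly_family F ->
  poly_family (fun t => demazure t i j (F t)).
Proof.
move=> ij hF; have hs : poly_family (fun t => msym (tperm i j) (F t)).
  by apply: family_lin hF => c f g; rewrite msymD msymZ.
have hd : poly_family (fun t => 'X_i * dd i j (F t)).
  apply: (@family_lin (fun f => 'X_i * dd i j f)) hF => c f g.
  by rewrite dd_linear // mulrDr scalerAr.
apply: (@family_ext _ (fun t => msym (tperm i j) (F t) +
  ('X_i * dd i j (F t) + - (t ^+ 1 *: ('X_i * dd i j (F t)))))).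
  by move=> t; rewrite /demazure scalerBl scale1r expr1.
by apply: family_add => //; apply: family_add => //; apply: family_opp; apply: family_exp.
Qed.

Lemma family_symC d m F : (m + d = n')%N -> poly_family F ->
  poly_family (fun t => symC t d m (F t)).
Proof.
elim: d m F => [|d IH] m F md hF //=; apply: family_add; first exact: family_exp.
apply: (IH m.+1 (fun t => demazure_nat t m (F t))); first by lia.
by apply: family_demazure => //; apply: inord_neq; lia.
Qed.

Lemma family_symQ d m f : (m + d = n')%N -> poly_family (fun t => symQ t d m f).
Proof.
elim: d m => [|d IH] m md; first exact: family_const.
by apply: (@family_symC d.+1 m (fun t => symQ t d m.+1 f)) => //; apply: IH; lia.
Qed.
End PolynomialFamilies.

Lemma family_coef_sym (R : numFieldType) n' (P : {poly {mpoly R[n'.+1]}}) :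
  (forall t : R, P.[t%:MP] \is symmetric) -> forall j, P`_j \is symmetric.
Proof.
move=> hP j; apply/issymP => w; set D := map_poly (msym w) P - P.
suff D0 : D = 0.
  by apply/eqP; rewrite -subr_eq0 -coef_map -coefB -/D D0 coef0.
apply: (@roots_geq_poly_eq0 _ _ [seq (k%:R)%:MP | k <- iota 0 (size D)]).
- apply/allP => x /mapP [k _ ->]; rewrite rootE hornerD hornerN.
  have -> : (map_poly (msym w) P).[(k%:R)%:MP] = msym w P.[(k%:R)%:MP].
    by rewrite -[in LHS](msymMP w k%:R) horner_map.
  by have /issymP -> := hP k%:R; rewrite subrr.
- rewrite map_inj_in_uniq ?iota_uniq // => k l _ _ /(congr1 (mcoeff 0%MM)).
  by rewrite !mcoeffC eqxx !mulr1 => /eqP; rewrite eqr_nat => /eqP.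
- by rewrite size_map size_iota.
Qed.

(** * The multicolour representation *)

Section ListOperators.
Variables (R : fieldType) (t : R) (wt : nat -> R).
Implicit Types (phi psi : seq nat -> R) (s u : seq nat) (K : (seq nat -> R) -> seq nat -> R).

(* A state is a list [s] whose [c]-th item is the site occupied by the colour [c].  Operators act
   on functionals of states: [Td i phi] is the functional [phi] composed with the Hecke generator
   exchanging the colours [i] and [i.+1], so composition order is reversed. *)
Fixpoint Td i phi s : R :=
  match i, s with
  | 0, x :: y :: r =>
    if (x < y)%N then phi (y :: x :: r)
    else (1 - t) * phi (x :: y :: r) + t * phi (y :: x :: r)
  | i'.+1, x :: r => Td i' (fun u => phi (x :: u)) r
  | _, _ => phi s
  end.

Definition Om phi s : R :=
  if s is x :: r then wt (last x r) * phi (last x r :: belast x r) else phi s.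

Definition local_op K := forall s, exists ts : seq (R * seq nat),
  all (fun x => perm_eq x.2 s) ts /\ forall phi, K phi s = \sum_(x <- ts) x.1 * phi x.2.

Lemma local_ext K phi psi s : local_op K -> (forall u, perm_eq u s -> phi u = psi u) ->
  K phi s = K psi s.
Proof.
move=> /(_ s) [ts [/allP hts hK]] h; rewrite !hK; apply: eq_big_seq => x /hts hx.
by rewrite h.
Qed.

Lemma local_lin K phi psi c s : local_op K ->
  K (fun u => c * phi u + psi u) s = c * K phi s + K psi s.
Proof.
move=> /(_ s) [ts [_ hK]]; rewrite !hK mulr_sumr -big_split /=.
by apply: eq_bigr => x _; rewrite mulrDr mulrCA.
Qed.

Lemma local_scale K phi c s : local_op K -> K (fun u => c * phi u) s = c * K phi s.
Proof.
move=> /(_ s) [ts [_ hK]]; rewrite !hK mulr_sumr.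
by apply: eq_bigr => x _; rewrite mulrCA.
Qed.

Lemma local_Td i : local_op (Td i).
Proof.
elim: i => [|i IH] s.
  have triv s' : exists ts : seq (R * seq nat), all (fun x => perm_eq x.2 s') ts /\
      forall phi, phi s' = \sum_(x <- ts) x.1 * phi x.2.
    by exists [:: (1, s')]; split=> [|phi]; rewrite /= ?perm_refl // big_seq1 mul1r.
  case: s => [|x [|y r]]; [exact: triv | exact: triv |] => /=.
  have pm : perm_eq (y :: x :: r) (x :: y :: r) by rewrite (perm_catCA [:: y] [:: x] r).
  case: (x < y)%N; first by exists [:: (1, y :: x :: r)]; split=> [|phi]; rewrite /= ?pm // big_seq1 mul1r.
  exists [:: (1 - t, x :: y :: r); (t, y :: x :: r)]; split=> [|phi]; first by rewrite /= pm perm_refl.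
  by rewrite !big_cons big_nil addr0.
case: s => [|x r].
  by exists [:: (1, [::])]; split=> [|phi] //=; rewrite big_seq1 mul1r.
have [ts [hts hK]] := IH r; exists [seq (y.1, x :: y.2) | y <- ts]; split.
  by rewrite all_map; apply: sub_all hts => y /=; rewrite perm_cons.
by move=> phi; rewrite /= hK big_map.
Qed.

Lemma local_Om : local_op Om.
Proof.
case=> [|x r]; first by exists [:: (1, [::])]; split=> [|phi] //=; rewrite big_seq1 mul1r.
exists [:: (wt (last x r), last x r :: belast x r)]; split=> [|phi] /=; last by rewrite big_seq1.
by rewrite andbT [X in perm_eq _ X]lastI perm_sym perm_rcons.
Qed.

Lemma Td_quad i phi s : (i.+1 < size s)%N ->
  Td i (Td i phi) s = (1 - t) * Td i phi s + t * phi s.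
Proof.
elim: i phi s => [|i IH] phi [|x s] //= => [|h]; last exact: IH.
case: s => [|y r] //= _.
by case: ltngtP => [||->] //=; ring.
Qed.

Lemma Td_braid i phi s : (i.+2 < size s)%N ->
  Td i (Td i.+1 (Td i phi)) s = Td i.+1 (Td i (Td i.+1 phi)) s.
Proof.
elim: i phi s => [|i IH] phi [|x s] //= => [|h]; last exact: IH.
case: s => [|y [|z r]] //= _.
case: (ltngtP x y) => xy; case: (ltngtP y z) => yz; case: (ltngtP x z) => xz /=;
  try (by exfalso; lia); subst=> //=; by ring.
Qed.

Lemma Td_far i j phi s : (i.+1 < j)%N -> (j.+1 < size s)%N ->
  Td i (Td j phi) s = Td j (Td i phi) s.
Proof.
elim: i j phi s => [|i IH] [|j] phi [|x s] // hj; last by move=> h /=; apply: IH.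
case: j hj s => [//|j] _ [|y r] //= h.
case: ifP => _ //.
by rewrite (local_lin (fun u => phi (x :: y :: u)) (fun u => t * phi (y :: x :: u)))
  ?local_scale //; apply: local_Td.
Qed.

Lemma Td_rcons i phi s z : (i.+1 < size s)%N ->
  Td i phi (rcons s z) = Td i (fun v => phi (rcons v z)) s.
Proof.
elim: i phi s => [|i IH] phi [|x s] //=; last by move=> h; apply: IH.
by case: s.
Qed.

Lemma Td_cat i phi s r : Td (size s + i) phi (s ++ r) = Td i (fun v => phi (s ++ v)) r.
Proof. by elim: s phi => [|x s IH] phi //=; rewrite IH. Qed.

Lemma Om_rcons phi s z : Om phi (rcons s z) = wt z * phi (z :: s).
Proof. by case: s => [|x s] //=; rewrite last_rcons belast_rcons. Qed.

Lemma Om_Td i phi s : (i.+2 < size s)%N -> Td i (Om phi) s = Om (Td i.+1 phi) s.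
Proof.
case/lastP: s => [//|s z]; rewrite size_rcons => h.
rewrite Td_rcons // Om_rcons /= -(local_scale _ _ _ (local_Td i)).
by apply: local_ext => [|u _]; [exact: local_Td | rewrite Om_rcons].
Qed.

Lemma Om2_Td phi s : (1 < size s)%N ->
  Td (size s).-2 (Om (Om phi)) s = Om (Om (Td 0 phi)) s.
Proof.
case/lastP: s => [//|s z]; case/lastP: s => [//|s y] _.
rewrite !size_rcons Om_rcons -rcons_cons Om_rcons -!cats1 -catA /=.
rewrite -{1}[size s]addn0 Td_cat /=.
have E (u v : nat) : Om (Om phi) (s ++ [:: u; v]) = wt v * (wt u * phi (u :: v :: s)).
  by rewrite -(cat1s u [:: v]) catA !cats1 Om_rcons -rcons_cons Om_rcons.
by rewrite !E; case: ifP => _; ring.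
Qed.

End ListOperators.

Section StateMatrices.
Variables (R : fieldType) (N : nat).
Definition state : finType := seq_sub (permutations (iota 0 N)).
Implicit Types (phi psi : seq nat -> R) (K : (seq nat -> R) -> seq nat -> R).

Definition rowf phi : 'rV[R]_#|state| := \row_j phi (ssval (enum_val j)).
Definition opM K : 'M[R]_#|state| :=
  \matrix_(i, j) K (fun s => (s == ssval (enum_val i))%:R) (ssval (enum_val j)).

Lemma state_perm (x : state) : perm_eq (ssval x) (iota 0 N).
Proof. by rewrite -mem_permutations ssvalP. Qed.

Lemma perm_state s : perm_eq s (iota 0 N) -> exists x : state, ssval x = s.
Proof. by rewrite -mem_permutations => h; exists (SeqSub h). Qed.

Lemma size_state (x : state) : size (ssval x) = N.
Proof. by rewrite (perm_size (state_perm x)) size_iota. Qed.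

Lemma rowf_opM K phi : local_op K -> rowf phi *m opM K = rowf (K phi).
Proof.
move=> hK; apply/rowP => j; rewrite !mxE; set s := ssval (enum_val j).
have [ts [/allP hts hs]] := hK s.
under eq_bigr => i _ do rewrite !mxE hs mulr_sumr.
rewrite exchange_big hs /=; apply: eq_big_seq => x hx.
have [y hy] : exists y : state, ssval y = x.2.
  by apply: perm_state; apply: perm_trans (hts _ hx) (state_perm _).
rewrite (bigD1 (enum_rank y)) //= enum_rankK hy eqxx mulr1 mulrC.
rewrite big1 ?addr0 // => i /eqP hi; case: eqP => [e|_]; last by rewrite !mulr0.
by case: hi; apply: enum_val_inj; rewrite enum_rankK; apply: val_inj; rewrite /= hy e.
Qed.

Lemma mx_rowf_ext q (A B : 'M[R]_(#|state|, q)) :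
  (forall phi, rowf phi *m A = rowf phi *m B) -> A = B.
Proof.
move=> h; apply/row_matrixP => i; rewrite !rowE.
have -> : delta_mx 0 i = rowf (fun s => (s == ssval (enum_val i))%:R).
  apply/rowP => j; rewrite !mxE /= (inj_eq val_inj) (inj_eq enum_val_inj).
  by [].
exact: h.
Qed.

Lemma rowf_ext phi psi : (forall s, perm_eq s (iota 0 N) -> phi s = psi s) -> rowf phi = rowf psi.
Proof. by move=> h; apply/rowP => j; rewrite !mxE h // state_perm. Qed.

End StateMatrices.

Section HeckeModule.
Variables (R : fieldType) (N : nat) (t : R) (wt : nat -> R).
Hypothesis t_neq0 : t != 0.
Local Notation mx := 'M[R]_#|state N.+1|.

Definition Tmx i : mx := opM N.+1 (Td t i.-1).
Definition ommx : mx := opM N.+1 (Om wt).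
Definition Timx i : mx := t^-1 *: (Tmx i - (1 - t) *: (1 : mx)).

Lemma rowf_Tmx phi i : rowf N.+1 phi *m Tmx i = rowf N.+1 (Td t i.-1 phi).
Proof. exact/rowf_opM/local_Td. Qed.

Lemma rowf_ommx phi : rowf N.+1 phi *m ommx = rowf N.+1 (Om wt phi).
Proof. exact/rowf_opM/local_Om. Qed.

Lemma rowfM (a : 'rV[R]_#|state N.+1|) (A B : mx) : a *m (A * B) = a *m A *m B.
Proof. exact: mulmxA. Qed.

Lemma size_perm_iota s : perm_eq s (iota 0 N.+1) -> size s = N.+1.
Proof. by move/perm_size; rewrite size_iota. Qed.

Lemma Tmx_quad i : (0 < i <= N)%N -> Tmx i * Tmx i = (1 - t) *: Tmx i + t *: (1 : mx).
Proof.
move=> hi; apply: mx_rowf_ext => phi; rewrite rowfM !rowf_Tmx mulmxDr -!scalemxAr rowf_Tmx.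
rewrite [_ *m 1]mulmx1; apply/rowP => j; rewrite !mxE Td_quad // size_state; lia.
Qed.

Lemma Tmx_Ti i : (0 < i <= N)%N -> Tmx i * Timx i = 1.
Proof.
move=> hi; rewrite /Timx mxZr mulrBr mxZr mulr1 Tmx_quad // addrAC subrr add0r.
by rewrite scalerA mulVf // scale1r.
Qed.

Lemma Tmx_iT i : (0 < i <= N)%N -> Timx i * Tmx i = 1.
Proof.
move=> hi; rewrite /Timx mxZl mulrBl mxZl mul1r Tmx_quad // addrAC subrr add0r.
by rewrite scalerA mulVf // scale1r.
Qed.

Lemma Tmx_braid i : (0 < i < N)%N ->
  Tmx i * Tmx i.+1 * Tmx i = Tmx i.+1 * Tmx i * Tmx i.+1.
Proof.
case: i => // i hi; apply: mx_rowf_ext => phi; rewrite !rowfM !rowf_Tmx.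
by apply: rowf_ext => s /size_perm_iota hs; rewrite Td_braid // hs; lia.
Qed.

Lemma Tmx_far i j : (0 < i)%N -> (i.+1 < j <= N)%N -> Tmx i * Tmx j = Tmx j * Tmx i.
Proof.
case: i => // i _; case: j => // j hj; apply: mx_rowf_ext => phi; rewrite !rowfM !rowf_Tmx.
apply: rowf_ext => s /size_perm_iota hs; rewrite /= -(@Td_far _ _ i j) // ?hs; lia.
Qed.

Lemma ommx_T i : (0 < i < N)%N -> ommx * Tmx i = Tmx i.+1 * ommx.
Proof.
case: i => // i hi; apply: mx_rowf_ext => phi.
rewrite !rowfM !(rowf_Tmx, rowf_ommx).
by apply: rowf_ext => s /size_perm_iota hs; rewrite /= Om_Td // hs; lia.
Qed.

Lemma ommx2_T : (0 < N)%N -> ommx * ommx * Tmx N = Tmx 1 * (ommx * ommx).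
Proof.
move=> N0; apply: mx_rowf_ext => phi.
rewrite !rowfM !(rowf_Tmx, rowf_ommx).
apply: rowf_ext => s /size_perm_iota hs.
by have := Om2_Td t wt phi (s := s); rewrite hs /=; apply; lia.
Qed.

(* Rescaled by [t ^+ i] so that the product of the first [r.+1] of them is a nonnegative matrix,
   although each single one is not; see [prod_Xmx]. *)
Definition Xmx i : mx := t ^+ i *: Yop N Tmx Timx ommx i.

Lemma Xmx_comm i j : (i <= N)%N -> (j <= N)%N -> GRing.comm (Xmx i) (Xmx j).
Proof.
move=> hi hj; rewrite /GRing.comm /Xmx !(mxZl, mxZr) !scalerA mulrC; congr (_ *: _).
exact: (Yop_comm Tmx_Ti Tmx_iT Tmx_braid Tmx_far ommx_T ommx2_T).
Qed.

Lemma Xmx_comm_T i j : (i <= N)%N -> (0 < j <= N)%N -> j != i -> j != i.+1 ->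
  Xmx i * Tmx j = Tmx j * Xmx i.
Proof.
move=> hi hj ji ji1; rewrite /Xmx mxZl mxZr; congr (_ *: _).
case: (ltngtP i j) => [ij|ij|ij]; last by rewrite ij eqxx in ji.
  by apply: (Yop_comm_gt Tmx_Ti Tmx_iT Tmx_braid Tmx_far ommx_T ommx2_T) => //; lia.
by apply: (Yop_comm_lt Tmx_Ti Tmx_iT Tmx_braid Tmx_far ommx_T ommx2_T) => //; lia.
Qed.

Lemma Xmx_S i : Xmx i.+1 = t *: (Timx i.+1 * Xmx i * Timx i.+1).
Proof.
rewrite /Xmx; set Y := Yop _ _ _ _ i.
by rewrite (mxZr _ (Timx i.+1) Y) (mxZl _ (Timx i.+1 * Y)) scalerA exprS.
Qed.

Lemma Timx_t i : t *: Timx i = Tmx i - (1 - t) *: (1 : mx).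
Proof. by rewrite /Timx scalerA mulfV // scale1r. Qed.

Lemma Xmx_T i : (i < N)%N ->
  Xmx i * Tmx i.+1 = Tmx i.+1 * Xmx i.+1 + (1 - t) *: Xmx i.
Proof.
move=> hi; rewrite Xmx_S mxZr !mulrA Tmx_Ti ?mul1r; last by lia.
by rewrite -mxZr Timx_t mulrBr mxZr mulr1 subrK.
Qed.

Lemma Xmx_ST i : (i < N)%N ->
  Xmx i.+1 * Tmx i.+1 = Tmx i.+1 * Xmx i - (1 - t) *: Xmx i.
Proof.
move=> hi; rewrite Xmx_S mxZl -!mulrA Tmx_iT ?mulr1; last by lia.
by rewrite -mxZl Timx_t mulrBl mxZl mul1r.
Qed.

Lemma prod_Xmx r : (r <= N)%N ->
  \prod_(0 <= i < r.+1) Xmx i =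
  t ^+ (\sum_(i < r.+1) i) *: Wop N Tmx ommx r ^+ r.+1.
Proof.
move=> hr; rewrite -(prod_Yop Tmx_Ti Tmx_far ommx_T ommx2_T hr).
elim: r {hr} => [|r IH]; first by rewrite !big_nat1 big_ord1.
rewrite big_nat_recr // IH [in RHS]big_nat_recr // /Xmx big_ord_recr /=.
set Y := _ * Timx _; rewrite mxZl (mxZr _ _ Y) scalerA -exprD.
by rewrite !big_ord_recr.
Qed.

End HeckeModule.

(** * The six-vertex row with a marked site *)

Section MarkedVertexModel.
Variables (P : comNzRingType) (t z : P).
Implicit Types (s : seq (P * bool)) (phi psi : seq (option bool) -> P) (u : seq (option bool)).

(* A row of the six-vertex model on sites [(a, bottom edge)], with the denominators [1 - t a z]
   cleared, in continuation-passing style: [phi] is applied to the word of top edges, [h] is the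
   current horizontal edge, and [B] evaluates the right boundary.  In words, [None] is the site
   of the distinguished colour [0]. *)
Fixpoint Phi (B : bool -> (seq (option bool) -> P) -> P) (h : bool) s phi : P :=
  if s is (a, e) :: s' then
    match e, h with
    | false, false => (1 - t * a * z) * Phi B false s' (fun u => phi (Some false :: u))
    | true, true => (1 - t * a * z) * Phi B true s' (fun u => phi (Some true :: u))
    | true, false => (1 - a * z) * Phi B false s' (fun u => phi (Some true :: u)) +
                     (1 - t) * (a * z) * Phi B true s' (fun u => phi (Some false :: u))
    | false, true => (1 - t) * Phi B false s' (fun u => phi (Some true :: u)) +
                     t * (1 - a * z) * Phi B true s' (fun u => phi (Some false :: u))
    end
  else B h phi.

Definition B0 (h : bool) phi : P := if h then 0 else phi [::].

Definition Qp s : P := \prod_(x <- s) (1 - x.1 * z).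

Fixpoint Kap s phi : P :=
  if s is (a, e) :: s' then
    (if e then 1 else t) * Kap s' (fun u => phi (Some e :: u)) else phi [::].

Fixpoint Cf s phi : P :=
  if s is (a, e) :: s' then
    Cf s' (fun u => phi (Some e :: u)) + (if e then 0 else Kap s' (fun u => phi (None :: u)))
  else 0.

Fixpoint Yf s phi : P :=
  if s is (a, e) :: s' then
    (1 - a * z) * Yf s' (fun u => phi (Some e :: u)) +
    a * z * Phi B0 e s' (fun u => phi (None :: u))
  else 0.

Definition word_of s : seq (option bool) := [seq Some x.2 | x <- s].

Fixpoint Carry (c : bool) u phi : P :=
  match u with
  | [::] => 0
  | None :: u' => phi (Some c :: u')
  | Some e :: u' =>
    match c, e with
    | true, false => t * Carry true u' (fun v => phi (Some false :: v)) +
                     (1 - t) * Carry false u' (fun v => phi (Some true :: v))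
    | _, _ => Carry c u' (fun v => phi (Some e :: v))
    end
  end.

Fixpoint Xb (al : seq P) u phi : P :=
  match al, u with
  | a :: _, None :: u' => a * phi (None :: u')
  | a :: al', Some e :: u' =>
    a * (1 - t) * Carry e u' (fun v => phi (None :: v)) +
    1 * Xb al' u' (fun v => phi (Some e :: v))
  | _, _ => 0
  end.

Lemma Qp_cons a e s : Qp ((a, e) :: s) = (1 - a * z) * Qp s.
Proof. exact: big_cons. Qed.

Lemma Phi_lin h s phi psi x y :
  Phi B0 h s (fun u => x * phi u + y * psi u) = x * Phi B0 h s phi + y * Phi B0 h s psi.
Proof.
elim: s h phi psi => [|[a e] s IH] h phi psi /=.
  by case: h => //=; rewrite !mulr0 addr0.
by case: e; case: h; rewrite !IH; ring.
Qed.

Lemma Kap_lin s phi psi x y :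
  Kap s (fun u => x * phi u + y * psi u) = x * Kap s phi + y * Kap s psi.
Proof. by elim: s phi psi => [|[a e] s IH] phi psi //=; rewrite IH; ring. Qed.

Lemma Cf_lin s phi psi x y :
  Cf s (fun u => x * phi u + y * psi u) = x * Cf s phi + y * Cf s psi.
Proof.
elim: s phi psi => [|[a e] s IH] phi psi /=; first by ring.
by rewrite IH; case: e; rewrite ?Kap_lin; ring.
Qed.

Lemma Yf_lin s phi psi x y :
  Yf s (fun u => x * phi u + y * psi u) = x * Yf s phi + y * Yf s psi.
Proof.
elim: s phi psi => [|[a e] s IH] phi psi /=; first by ring.
by rewrite IH Phi_lin; ring.
Qed.

Lemma Phi_scale h s phi x : Phi B0 h s (fun u => x * phi u) = x * Phi B0 h s phi.
Proof.
elim: s h phi => [|[a e] s IH] h phi /=; first by case: h => //=; rewrite mulr0.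
by case: e; case: h; rewrite !IH; ring.
Qed.

Lemma Kap_scale s phi x : Kap s (fun u => x * phi u) = x * Kap s phi.
Proof. by elim: s phi => [|[a e] s IH] phi //=; rewrite IH; ring. Qed.

Lemma Yf_carry1 s phi :
  (1 - t) * Yf s (fun u => Carry false u phi) = Phi B0 false s phi - Qp s * phi (word_of s).
Proof.
elim: s phi => [|[a e] s IH] phi /=; first by rewrite /Qp big_nil; ring.
rewrite Qp_cons; have := IH (fun u => phi (Some e :: u)).
by case: e => /= {}IH; rewrite mulrDr mulrCA IH; ring.
Qed.

Lemma Cf_carry1 s phi :
  (1 - t) * Cf s (fun u => Carry false u phi) = phi (word_of s) - Kap s phi.
Proof.
elim: s phi => [|[a e] s IH] phi /=; first by ring.
have := IH (fun u => phi (Some e :: u)).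
by case: e => /= {}IH; rewrite mulrDr IH; ring.
Qed.

Lemma YCf_carry2 s phi :
  (1 - t) * (Yf s (fun u => Carry true u phi) + Qp s * Cf s (fun u => Carry true u phi)) =
  Phi B0 true s phi.
Proof.
elim: s phi => [|[a e] s IH] phi /=; first by ring.
rewrite Qp_cons; have := IH (fun u => phi (Some e :: u)).
case: e => /= {}IH; first by rewrite -IH; ring.
rewrite Yf_lin Cf_lin -IH.
have hY := Yf_carry1 s (fun u => phi (Some true :: u)).
have hC := Cf_carry1 s (fun u => phi (Some true :: u)).
have hP : Phi B0 false s (fun u => phi (Some true :: u)) =
  (1 - t) * Yf s (fun u => Carry false u (fun v => phi (Some true :: v))) +
  Qp s * ((1 - t) * Cf s (fun u => Carry false u (fun v => phi (Some true :: v))) +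
          Kap s (fun u => phi (Some true :: u))) by rewrite hY hC; ring.
by rewrite hP; ring.
Qed.

(* The resolvent identity [Y = z X (Y + C)], cleared of the denominators [Qp s]. *)
Lemma Yf_rec s phi :
  Yf s phi = z * (Yf s (fun u => Xb [seq x.1 | x <- s] u phi) +
                  Qp s * Cf s (fun u => Xb [seq x.1 | x <- s] u phi)).
Proof.
elim: s phi => [|[a e] s IH] phi /=; first by ring.
rewrite Qp_cons Yf_lin Cf_lin Phi_scale (IH (fun u => phi (Some e :: u))).
set F := Phi B0 e s _.
have key : (1 - t) * (Yf s (fun u => Carry e u (fun v => phi (None :: v))) +
                      Qp s * Cf s (fun u => Carry e u (fun v => phi (None :: v)))) +
           Qp s * (if e then 0 else Kap s (fun u => phi (None :: u))) = F.
  rewrite /F; case: e {IH F}; first by rewrite mulr0 addr0 YCf_carry2.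
  rewrite mulrDr mulrCA Yf_carry1 Cf_carry1; ring.
have -> : (if e then 0 else Kap s (fun u => a * phi (None :: u))) =
          a * (if e then 0 else Kap s (fun u => phi (None :: u))).
  by case: (e); rewrite ?mulr0 ?Kap_scale.
by rewrite -key; ring.
Qed.

End MarkedVertexModel.

Section WordPasses.
Variables (R : fieldType) (t : R).
Hypothesis t_neq0 : t != 0.
Implicit Types (u : seq (option bool)) (phi psi : seq (option bool) -> R).

Fixpoint Fill (e : bool) u phi : R :=
  match u with
  | [::] => 0
  | None :: u' => phi (Some e :: u')
  | Some b :: u' => Fill e u' (fun v => phi (Some b :: v))
  end.

Fixpoint PassW (e : bool) u phi : R :=
  match u with
  | [::] => 0
  | None :: u' => phi (None :: u')
  | Some b :: u' =>
    if b == e then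
      (1 - t) * Fill e u' (fun v => phi (None :: v)) +
      t * PassW e u' (fun v => phi (Some b :: v))
    else PassW e u' (fun v => phi (Some b :: v))
  end.

Fixpoint Wt (al : seq R) u phi : R :=
  match al, u with
  | a :: _, None :: u' => a * phi (None :: u')
  | a :: al', Some b :: u' => t^-1 * Wt al' u' (fun v => phi (Some b :: v))
  | _, _ => 0
  end.

Lemma Fill_lin e u phi psi x y :
  Fill e u (fun v => x * phi v + y * psi v) = x * Fill e u phi + y * Fill e u psi.
Proof.
by elim: u phi psi => [|[b|] u IH] phi psi //=; rewrite !mulr0 addr0.
Qed.

Lemma PassW_lin e u phi psi x y :
  PassW e u (fun v => x * phi v + y * psi v) = x * PassW e u phi + y * PassW e u psi.
Proof.
elim: u phi psi => [|[b|] u IH] phi psi //=; first by rewrite !mulr0 addr0.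
by case: ifP => _ //; rewrite Fill_lin IH; ring.
Qed.

Lemma Fill_scale e u phi x : Fill e u (fun v => x * phi v) = x * Fill e u phi.
Proof. by elim: u phi => [|[b|] u IH] phi //=; rewrite mulr0. Qed.

Lemma PassW_scale e u phi x : PassW e u (fun v => x * phi v) = x * PassW e u phi.
Proof.
elim: u phi => [|[b|] u IH] phi //=; first by rewrite mulr0.
by case: ifP => _ //; rewrite Fill_scale IH; ring.
Qed.

Lemma Fill_ext e u phi psi : phi =1 psi -> Fill e u phi = Fill e u psi.
Proof.
by elim: u phi psi => [|[b|] u IH] phi psi h //=; apply: IH.
Qed.

Lemma PassW_ext e u phi psi : phi =1 psi -> PassW e u phi = PassW e u psi.
Proof.
elim: u phi psi => [|[b|] u IH] phi psi h //=.
rewrite (IH _ (fun v => psi (Some b :: v))) // (@Fill_ext e u _ (fun v => psi (None :: v))) //.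
Qed.

Lemma Fill_carry u phi : Fill false u phi = Carry t false u phi.
Proof. by elim: u phi => [|[b|] u IH] phi //=; rewrite IH. Qed.

Lemma PassW_fill u phi : PassW false u (fun v => Fill true v phi) = Carry t true u phi.
Proof.
elim: u phi => [|[[]|] u IH] phi //=.
by rewrite (IH (fun v => phi (Some false :: v))) Fill_carry addrC.
Qed.

Lemma PassW_Xb al u phi : size al = size u ->
  PassW false u (fun v => PassW true v (fun w => Wt al w phi)) = Xb t al u phi.
Proof.
elim: u al phi => [|[b|] u IH] [|a al] phi //= [sz].
have IH' := IH al (fun v => phi (Some b :: v)) sz.
have tt x : t * (t^-1 * x) = 1 * x by rewrite mulrA mulfV.
case: b IH' => /= IH'; last first.
  rewrite Fill_scale Fill_carry -IH' (@PassW_ext _ _ _ (fun v => t^-1 *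
    PassW true v (fun w => Wt al w (fun w' => phi (Some false :: w'))))) => [|v].
    by rewrite PassW_scale tt; ring.
  by rewrite PassW_scale.
rewrite (@PassW_ext _ _ _ (fun v => ((1 - t) * a) * Fill true v (fun w => phi (None :: w)) +
   1 * PassW true v (fun w => Wt al w (fun w' => phi (Some true :: w'))))) => [|v].
  by rewrite PassW_lin PassW_fill IH'; ring.
by rewrite Fill_scale PassW_scale tt; ring.
Qed.
End WordPasses.

Section ListPasses.
Variables (R : fieldType) (t : R).
Implicit Types (F : seq nat -> R) (G : seq nat -> nat -> R) (s r ys zs : seq nat).

Fixpoint chain i d F : seq nat -> R :=
  if d is d'.+1 then Td t i (chain i.+1 d' F) else F.

Fixpoint pass x ys G : R :=
  if ys is y :: r then
    if (x < y)%N then pass x r (fun zs f => G (y :: zs) f)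
    else (1 - t) * pass y r (fun zs f => G (x :: zs) f) +
         t * pass x r (fun zs f => G (y :: zs) f)
  else G [::] x.

Lemma chain_cons i d F x s : chain i.+1 d F (x :: s) = chain i d (fun u => F (x :: u)) s.
Proof.
elim: d i s => [|d IH] i s //=.
by apply: local_ext => [|u _]; [exact: local_Td | exact: IH].
Qed.

Lemma chain_cat d F s r : chain (size s) d F (s ++ r) = chain 0 d (fun u => F (s ++ u)) r.
Proof. by elim: s F => [|x s IH] F //=; rewrite chain_cons IH. Qed.

Lemma chainD i d1 d2 F s : chain i (d1 + d2) F s = chain i d1 (chain (i + d1) d2 F) s.
Proof.
elim: d1 i s => [|d1 IH] i s /=; first by rewrite addn0.
apply: local_ext => [|u _]; first exact: local_Td.
by rewrite IH addSnnS.
Qed.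

Lemma chain_pass F x ys r : chain 0 (size ys) F (x :: ys ++ r) = pass x ys (fun zs f => F (zs ++ f :: r)).
Proof.
elim: ys x F => [|y ys IH] x F //=.
by case: ifP => _; rewrite !chain_cons !IH.
Qed.

Lemma pass_ext x ys G G' : (forall zs f, perm_eq (f :: zs) (x :: ys) -> G zs f = G' zs f) ->
  pass x ys G = pass x ys G'.
Proof.
elim: ys x G G' => [|y ys IH] x G G' h /=; first by apply: h.
have h1 : pass x ys (fun zs f => G (y :: zs) f) = pass x ys (fun zs f => G' (y :: zs) f).
  apply: IH => zs f hz; apply: h.
  by apply/seq.permP => a /=; move/seq.permP: hz => /(_ a) /=; lia.
have h2 : pass y ys (fun zs f => G (x :: zs) f) = pass y ys (fun zs f => G' (x :: zs) f).
  apply: IH => zs f hz; apply: h.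
  by apply/seq.permP => a /=; move/seq.permP: hz => /(_ a) /=; lia.
by rewrite h1 h2.
Qed.

Lemma pass_explicit x ys G :
  (forall zs zs' f, perm_eq zs zs' -> G zs f = G zs' f) -> uniq (x :: ys) ->
  pass x ys G = t ^+ count (fun y => y < x)%N ys * G ys x +
    (1 - t) * \sum_(f <- ys | (f < x)%N) t ^+ count (fun y => y < f)%N ys * G (x :: rem f ys) f.
Proof.
elim: ys x G => [|y ys IH] x G hG /=; first by rewrite big_nil mulr0 addr0 mul1r.
rewrite inE negb_or -andbA => /and4P [xy xys yys uys].
have hG' z : forall zs zs' f, perm_eq zs zs' -> G (z :: zs) f = G (z :: zs') f.
  by move=> zs zs' f h; apply: hG; rewrite perm_cons.
have gC z z' zs f : G (z :: z' :: zs) f = G (z' :: z :: zs) f.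
  by apply: hG; apply/seq.permP => a /=; lia.
have uxy : uniq (x :: ys) by rewrite /= xys.
have uyy : uniq (y :: ys) by rewrite /= yys.
have fy f : f \in ys -> (y == f) = false by move=> hf; apply: contraNF yys => /eqP ->.
rewrite (IH x _ (hG' y) uxy) (IH y _ (hG' x) uyy) big_cons; case: (ltngtP x y) xy => // hxy _.
  rewrite add0n; congr (_ + _ * _).
  rewrite big_seq_cond [RHS]big_seq_cond; apply: eq_bigr => f /andP [hf fx].
  rewrite fy // gC; congr (_ ^+ _ * _).
  by rewrite [(y < f)%N]ltnNge (leq_trans (ltnW fx)) // ltnW.
rewrite eqxx add1n exprS [(y < y)%N]ltnn add0n.
set S1 := \sum_(f <- ys | (f < y)%N) _; set S2 := \sum_(f <- ys | (f < x)%N) _.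
set S3 := \sum_(f <- ys | (f < x)%N) _.
suff -> : S3 = (1 - t) * S1 + t * S2 by ring.
rewrite /S1 /S2 /S3 !mulr_sumr (big_mkcond (fun f => f < y)%N) (big_mkcond (fun f => f < x)%N).
rewrite [X in _ = _ + X](big_mkcond (fun f => f < x)%N) -big_split /=.
apply: eq_big_seq => f hf; rewrite fy // gC.
case: (ltngtP f y) => [fy'|fy'|e]; last by rewrite -e hf in yys.
  by rewrite (ltn_trans fy' hxy) add0n; ring.
by case: ifP => _; rewrite ?add1n ?exprS; ring.
Qed.

Lemma sum_lt_iota (H : nat -> R) ys x : uniq ys ->
  \sum_(f <- ys | (f < x)%N) H f = \sum_(f <- iota 0 x | f \in ys) H f.
Proof.
move=> uys; rewrite -big_filter -[RHS]big_filter; apply: perm_big.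
apply: uniq_perm; rewrite ?filter_uniq ?iota_uniq // => p.
by rewrite !mem_filter mem_iota add0n andbC.
Qed.

Lemma count_lt_iota ys x : uniq ys ->
  count (fun y => y < x)%N ys = count (fun p => p \in ys) (iota 0 x).
Proof.
move=> uys; rewrite -!size_filter; apply: perm_size.
apply: uniq_perm; rewrite ?filter_uniq ?iota_uniq // => p.
by rewrite !mem_filter mem_iota add0n andbC.
Qed.

Lemma telescope_count ys x : uniq ys ->
  \sum_(f <- ys | (f < x)%N) (1 - t) * t ^+ count (fun y => f < y)%N ys =
  t ^+ count (fun y => x <= y)%N ys - t ^+ size ys.
Proof.
move=> uys; rewrite sum_lt_iota //; elim: x => [|x IH].
  by rewrite big_nil (eq_count (a2 := predT)) ?count_predT ?subrr.
rewrite -addn1 iotaD big_cat /= IH big_cons big_nil add0n.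
have -> : count (fun y => x <= y)%N ys = ((x \in ys) + count (fun y => x < y)%N ys)%N.
  rewrite -(count_uniq_mem _ uys) -count_predUI [X in (_ = _ + X)%N](eq_count (a2 := pred0)).
    rewrite count_pred0 addn0; apply: eq_count => y /=.
    by rewrite leq_eqVlt eq_sym.
  by move=> y /=; case: eqP => [->|] //=; rewrite ltnn.
case: ifP => _; rewrite ?addr0 ?add0n ?addn1 // add1n exprS.
by ring.
Qed.

Fixpoint Cd d m F : seq nat -> R :=
  if d is d'.+1 then fun s => t ^+ d * F s + Cd d' m.+1 (Td t m F) s else F.

Lemma Cd_cons d m F x s : Cd d m.+1 F (x :: s) = Cd d m (fun u => F (x :: u)) s.
Proof. by elim: d m F => [|d IH] m F //=; rewrite IH. Qed.

Lemma Cd_explicit F G x ys r :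
  (forall zs f, size zs = size ys -> F (f :: zs ++ r) = G zs f) ->
  (forall zs zs' f, perm_eq zs zs' -> G zs f = G zs' f) -> uniq (x :: ys) ->
  Cd (size ys) 0 F (x :: ys ++ r) =
  \sum_(f <- x :: ys) t ^+ count (fun y => f < y)%N (x :: ys) * G (rem f (x :: ys)) f.
Proof.
elim: ys x F G => [|y ys IH] x F G hF hG.
  by rewrite /= big_cons big_nil /= eqxx ltnn addr0 mul1r => _; apply: (hF [::]).
move=> /andP [xys uys].
pose G' zs f := if (x < f)%N then G (x :: zs) f else (1 - t) * G (f :: zs) x + t * G (x :: zs) f.
have hG' zs zs' f : perm_eq zs zs' -> G' zs f = G' zs' f.
  move=> h; have e z g : G (z :: zs) g = G (z :: zs') g by apply: hG; rewrite perm_cons.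
  by rewrite /G' !e.
rewrite [LHS]/= Cd_cons (hF (y :: ys)) //.
rewrite (IH y _ G') //; last first.
  by move=> zs f sz /=; rewrite (hF (f :: zs)) ?(hF (x :: zs)) //= sz.
rewrite [RHS]big_cons /= eqxx ltnn add0n.
have px f : f \in y :: ys -> (x == f) = false by move=> hf; apply: contraNF xys => /eqP ->.
rewrite [X in _ + X](eq_big_seq (fun f => t ^+ ((f < x) + count (fun z => f < z)%N (y :: ys)) *
     G (x :: rem f (y :: ys)) f +
   (if (f < x)%N then (1 - t) * t ^+ count (fun z => f < z)%N (y :: ys) else 0) * G (y :: ys) x)).
  rewrite big_split /= -mulr_suml -big_mkcond telescope_count // addrCA addrC; congr (_ + _); last first.
    rewrite big_seq [RHS]big_seq; apply: eq_bigr => f hf.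
    by rewrite px //= .
  rewrite -mulrDl; congr (_ * _); rewrite addrC subrK /=.
  rewrite leq_eqVlt px ?mem_head //=; congr (_ ^+ (_ + _)).
  by apply: eq_in_count => z hz; rewrite leq_eqVlt px // inE hz orbT.
move=> f hf; rewrite /G'; case: (ltngtP x f) => [xf|xf|e]; last by rewrite e hf in xys.
  by rewrite add0n mul0r addr0.
rewrite add1n exprS (hG (f :: rem f (y :: ys)) (y :: ys)); first by ring.
by rewrite perm_sym; apply: perm_to_rem.
Qed.
End ListPasses.

Definition mark_site (x : nat) (b : nat -> bool) (p : nat) : option bool :=
  if p == x then None else Some (b p).

Section Marks.
Variables (R : fieldType) (t : R).
Implicit Types (phi : seq (option bool) -> R) (b : nat -> bool).

Lemma eq_map_iota (T : Type) (f g : nat -> T) p m :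
  (forall q, (p <= q < p + m)%N -> f q = g q) -> map f (iota p m) = map g (iota p m).
Proof. by move=> h; apply/eq_in_map => q; rewrite mem_iota; apply: h. Qed.

Lemma Fill_mark e p m x b phi : (p <= x < p + m)%N ->
  Fill e (map (mark_site x b) (iota p m)) phi =
  phi (map (fun q => Some (if q == x then e else b q)) (iota p m)).
Proof.
elim: m p phi => [|m IH] p phi hx /=; first by lia.
rewrite {1}/mark_site; have [px|px] := eqVneq p x.
  rewrite px; congr (phi (_ :: _)); apply: eq_map_iota => q hq; rewrite /mark_site.
  by have -> : (q == x) = false by apply/eqP; lia.
by rewrite IH //; have := px; lia.
Qed.

Lemma PassW_mark e p m x b phi : (p <= x < p + m)%N ->
  PassW t e (map (mark_site x b) (iota p m)) phi =
  t ^+ count (fun q => b q == e) (iota p (x - p)) * phi (map (mark_site x b) (iota p m)) +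
  (1 - t) * \sum_(f <- iota p (x - p) | b f == e)
     t ^+ count (fun q => b q == e) (iota p (f - p)) *
     phi (map (mark_site f (fun q => if q == x then e else b q)) (iota p m)).
Proof.
elim: m p phi => [|m IH] p phi hx /=; first by lia.
rewrite {1}/mark_site; have [px|px] := eqVneq p x.
  by rewrite -px subnn big_nil mulr0 addr0 mul1r /= /mark_site eqxx.
have hx' : (p.+1 <= x < p.+1 + m)%N by move: px hx; lia.
have -> : (x - p)%N = (x - p.+1).+1 by lia.
rewrite (IH p.+1 _ hx') (Fill_mark _ _ _ hx') /= big_cons subnn /= mul1r.
have Ep : mark_site p (fun q => if q == x then e else b q) p = None by rewrite /mark_site eqxx.
have Em : map (mark_site p (fun q => if q == x then e else b q)) (iota p.+1 m) =
          map (fun q => Some (if q == x then e else b q)) (iota p.+1 m).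
  apply: eq_map_iota => q hq; rewrite /mark_site.
  by have -> : (q == p) = false by apply/eqP; lia.
have Es (c : bool) : b p = c ->
  \sum_(f <- iota p.+1 (x - p.+1) | b f == e)
     t ^+ count (fun q => b q == e) (iota p (f - p)) *
     phi (mark_site f (fun q => if q == x then e else b q) p ::
          map (mark_site f (fun q => if q == x then e else b q)) (iota p.+1 m)) =
  t ^+ (c == e) * \sum_(f <- iota p.+1 (x - p.+1) | b f == e)
     t ^+ count (fun q => b q == e) (iota p.+1 (f - p.+1)) *
     phi (Some c :: map (mark_site f (fun q => if q == x then e else b q)) (iota p.+1 m)).
  move=> bp; rewrite mulr_sumr big_seq_cond [RHS]big_seq_cond; apply: eq_bigr => f /andP [].
  rewrite mem_iota => hf _; have -> : (f - p)%N = (f - p.+1).+1 by lia.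
  rewrite /= bp exprD -mulrA; congr (_ * (_ * phi (_ :: _))).
  rewrite /mark_site bp (negbTE px).
  by have -> : (p == f) = false by apply/eqP; lia.
have Ex : mark_site x b p = Some (b p) by rewrite /mark_site (negbTE px).
rewrite (Es _ erefl) Ep Em Ex.
by case: (b p == e); rewrite ?expr1 ?expr0 ?mul1r ?add1n ?exprS ?add0n //; ring.
Qed.

Lemma Wt_mark (a : nat -> R) p m x b phi : (p <= x < p + m)%N ->
  Wt t (map a (iota p m)) (map (mark_site x b) (iota p m)) phi =
  t^-1 ^+ (x - p) * (a x * phi (map (mark_site x b) (iota p m))).
Proof.
elim: m p phi => [|m IH] p phi hx /=; first by lia.
have [px|px] := eqVneq p x.
  have E : mark_site x b p = None by rewrite /mark_site px eqxx.
  by rewrite E px subnn mul1r.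
have E : mark_site x b p = Some (b p) by rewrite /mark_site (negbTE px).
rewrite E IH; last by move: px hx; lia.
have -> : (x - p)%N = (x - p.+1).+1 by move: px hx; lia.
by rewrite exprS mulrA.
Qed.

Lemma Kap_mark (s : nat -> R * bool) p m phi :
  Kap t (map s (iota p m)) phi =
  t ^+ count (fun q => ~~ (s q).2) (iota p m) * phi (map (fun q => Some (s q).2) (iota p m)).
Proof.
elim: m p phi => [|m IH] p phi /=; first by rewrite mul1r.
by case: (s p) => a e /=; rewrite IH; case: e; rewrite ?mul1r ?add0n // add1n exprS mulrA.
Qed.

Lemma Cf_mark (s : nat -> R * bool) p m phi :
  Cf t (map s (iota p m)) phi =
  \sum_(f <- iota p m | ~~ (s f).2)
    t ^+ count (fun q => (f < q)%N && ~~ (s q).2) (iota p m) *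
    phi (map (mark_site f (fun q => (s q).2)) (iota p m)).
Proof.
elim: m p phi => [|m IH] p phi /=; first by rewrite big_nil.
rewrite big_cons; case E: (s p) => [a e] /=.
have -> : \sum_(f <- iota p.+1 m | ~~ (s f).2)
    t ^+ ((f < p)%N && ~~ e + count (fun q => (f < q)%N && ~~ (s q).2) (iota p.+1 m)) *
    phi (mark_site f (fun q => (s q).2) p :: map (mark_site f (fun q => (s q).2)) (iota p.+1 m)) =
    Cf t (map s (iota p.+1 m)) (fun u => phi (Some e :: u)).
  rewrite IH big_seq_cond [RHS]big_seq_cond; apply: eq_bigr => f /andP [].
  rewrite mem_iota => hf _; rewrite ltnNge (ltnW (_ : p < f)%N) /=; last by lia.
  rewrite {1}/mark_site E add0n.
  by have -> : (p == f) = false by apply/eqP; lia.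
case: e E => E /=; first by rewrite addr0.
rewrite addrC ltnn add0n Kap_mark {1}/mark_site eqxx; congr (_ ^+ _ * phi (_ :: _) + _).
  apply: eq_in_count => q; rewrite mem_iota => hq.
  by have -> : (p < q)%N by lia.
apply: eq_map_iota => q hq; rewrite /mark_site.
by have -> : (q == p) = false by apply/eqP; lia.
Qed.

End Marks.

Section StateMarks.
Variables (R : fieldType) (t : R) (n' k : nat) (a : nat -> R).
Local Notation n := n'.+1.
Local Notation N := (n' + k)%N.
Implicit Types (phi : seq (option bool) -> R) (s ys zs : seq nat).

Definition mark s := map (mark_site (head 0%N s) (fun p => p \in drop n s)) (iota 0 N.+1).
Definition site_of s p : R * bool := (a p, p \in drop n s).
Definition sites s := map (site_of s) (iota 0 N.+1).
Definition weights := map a (iota 0 N.+1).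
(* The powers of [t^-1] compensate the factors [t] collected by a colour moving over smaller ones. *)
Definition awt p := a p * t^-1 ^+ p.

Lemma state_split s : perm_eq s (iota 0 N.+1) ->
  exists x ys zs, [/\ s = x :: ys ++ zs, size ys = n', size zs = k & uniq (x :: ys ++ zs)].
Proof.
move=> hs; have us : uniq s by rewrite (perm_uniq hs) iota_uniq.
have ss := size_perm_iota hs; case: s us hs ss => // x s us _ [ss].
exists x, (take n' s), (drop n' s); rewrite cat_take_drop size_takel ?size_drop ?ss ?leq_addr //.
by split=> //; lia.
Qed.

Lemma state_lt s p : perm_eq s (iota 0 N.+1) -> (p \in s) = (p < N.+1)%N.
Proof. by move/perm_mem => ->; rewrite mem_iota. Qed.

Hypothesis t_neq0 : t != 0.

Lemma chain_mark phi s : perm_eq s (iota 0 N.+1) ->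
  chain t 0 N (Om awt (fun u => phi (mark u))) s = Xb t weights (mark s) phi.
Proof.
move=> hs; have [x [ys [zs [es sys szs us]]]] := state_split hs.
have memE p : (p < N.+1)%N = [|| p == x, p \in ys | p \in zs].
  by rewrite -(state_lt p hs) es inE mem_cat.
have xN : (x < N.+1)%N by rewrite memE eqxx.
pose b p := p \in zs.
have markE g us' vs : size us' = n' ->
    mark (g :: us' ++ vs) = map (mark_site g (fun p => p \in vs)) (iota 0 N.+1).
  by move=> hu; rewrite /mark /= drop_cat hu ltnn subnn drop0.
rewrite -(PassW_Xb t_neq0); last by rewrite !size_map.
have cp F : chain t 0 n' F (x :: ys ++ zs) = pass t x ys (fun us' f => F (us' ++ f :: zs)).
  by rewrite -chain_pass sys.
rewrite chainD add0n [X in chain _ _ _ _ X = _]es cp.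
pose G2 (vs : seq nat) g := awt g * phi (map (mark_site g (fun p => p \in vs)) (iota 0 N.+1)).
pose H f := pass t f zs G2.
have -> : pass t x ys (fun us' f => chain t n' k (Om awt (fun u => phi (mark u))) (us' ++ f :: zs)) =
          pass t x ys (fun=> H).
  apply: pass_ext => us' f /perm_size /= [su]; rewrite sys in su.
  have cz F : chain t n' k F (us' ++ f :: zs) = pass t f zs (fun vs g => F (us' ++ vs ++ [:: g])).
    by rewrite -su chain_cat -{1}[zs]cats0 -szs chain_pass.
  rewrite cz /H; apply: pass_ext => vs g _; rewrite catA cats1 Om_rcons.
  by rewrite /G2 markE.
have /and4P [xys uys yzs uzs] : [&& x \notin ys ++ zs, uniq ys, ~~ has (mem ys) zs & uniq zs].
  by move: us; rewrite /= cat_uniq.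
have [xny xnz] : x \notin ys /\ x \notin zs by move: xys; rewrite mem_cat negb_or => /andP.
have inner f : f \notin zs -> (f < N.+1)%N ->
    H f = PassW t true (map (mark_site f b) (iota 0 N.+1)) (fun w => Wt t weights w phi).
  move=> fz fN; rewrite /H pass_explicit; last 2 first.
  - move=> vs vs' g hv; rewrite /G2; congr (_ * phi _); apply: eq_map_iota => q _.
    by rewrite /mark_site (perm_mem hv).
  - by rewrite /= fz.
  rewrite PassW_mark ?add0n // subn0 sum_lt_iota // count_lt_iota //.
  rewrite Wt_mark ?add0n // subn0 /G2 /awt; congr (_ * _ + _ * _).
  - by apply: congr2 => //; apply: eq_count => q; rewrite eqb_id.
  - by rewrite /b mulrAC mulrC mulrA [t^-1 ^+ _ * _]mulrC.
  rewrite (eq_bigl (fun g => b g == true)) => [|g]; last by rewrite eqb_id.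
  rewrite big_seq_cond [RHS]big_seq_cond; apply: eq_bigr => g /andP [].
  rewrite mem_iota add0n => gf; rewrite eqb_id => bg.
  have gN : (0 <= g < 0 + N.+1)%N by rewrite add0n (ltn_trans gf fN).
  rewrite (@Wt_mark _ _ _ _ _ _ _ _ gN).
  rewrite !subn0 count_lt_iota // (eq_count (a2 := fun q => b q == true)) => [|q]; last by rewrite eqb_id.
  congr (_ * _); rewrite [RHS]mulrCA mulrA; congr (_ * phi _).
  apply: eq_map_iota => q _; rewrite /mark_site; case: ifP => // qg.
  by rewrite inE mem_rem_uniq // inE qg /=; case: (q == f).
rewrite pass_explicit; last 2 first.
- by [].
- by rewrite /= xny.
rewrite es markE // PassW_mark ?add0n // subn0.
rewrite sum_lt_iota // count_lt_iota // inner //.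
have cy q : (q < x)%N -> (q \in ys) = (b q == false).
  move=> qx; have := memE q; rewrite (ltn_trans qx xN) ltn_eqF //= /b => /esym.
  case qz: (q \in zs); case qy: (q \in ys) => //= _.
  by move/hasPn: yzs => /(_ q qz) /=; rewrite qy.
congr (_ ^+ _ * _ + _ * _).
  by apply: eq_in_count => q; rewrite mem_iota => /cy.
rewrite big_seq_cond [RHS]big_seq_cond.
apply: eq_big => [q|q /andP [hq yq]].
  by case hq: (q \in iota 0 x) => //=; apply: cy; rewrite mem_iota in hq.
rewrite mem_iota add0n leq0n /= in hq.
rewrite count_lt_iota // subn0; congr (_ ^+ _ * _).
  by apply: eq_in_count => z; rewrite mem_iota add0n leq0n /= => hz; apply/cy/(ltn_trans hz).
rewrite inner; last 2 first.
- by move: (cy q hq); rewrite yq => /esym /eqP; rewrite /b => ->.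
- exact: ltn_trans hq xN.
congr PassW; apply: eq_map_iota => p _; rewrite /mark_site; case: ifP => // _.
by case: eqP => [->|//]; rewrite /b (negbTE xnz).
Qed.

Lemma Cd_mark phi s : perm_eq s (iota 0 N.+1) ->
  Cd t n' 0 (fun u => phi (mark u)) s = Cf t (sites s) phi.
Proof.
move=> hs; have [x [ys [zs [es sys szs us]]]] := state_split hs.
have memE p : (p < N.+1)%N = (p \in x :: ys) || (p \in zs).
  by rewrite -(state_lt p hs) es inE mem_cat orbA -in_cons.
have uxy : uniq (x :: ys) by move: us; rewrite -cat_cons cat_uniq => /andP [].
have disj p : p \in x :: ys -> p \notin zs.
  by move: us; rewrite -cat_cons cat_uniq => /and3P [_ /hasPn h _] hp; apply: contraTN hp => /h.
pose G (us' : seq nat) f := phi (map (mark_site f (fun p => p \in zs)) (iota 0 N.+1)).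
rewrite {1}es -{1}sys (@Cd_explicit _ _ _ G) //; last first.
  by move=> us' f su; rewrite /mark /= drop_cat su sys ltnn subnn drop0.
have dz : drop n s = zs by rewrite es /= drop_cat sys ltnn subnn drop0.
rewrite Cf_mark [RHS](eq_bigl (fun f => f \notin zs)) => [|f]; last by rewrite /= dz.
have pm : perm_eq (x :: ys) [seq f <- iota 0 N.+1 | f \notin zs].
  apply: uniq_perm; rewrite ?filter_uniq ?iota_uniq // => f.
  rewrite mem_filter mem_iota add0n memE.
  by case hf: (f \in x :: ys) => /=; [rewrite disj | rewrite andbC; case: (f \in zs)].
rewrite (perm_big _ pm) big_filter; apply: eq_bigr => f hf; congr (_ ^+ _ * phi _).
  rewrite (seq.permP pm) count_filter; apply: eq_count => q /=.
  by rewrite dz.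
by apply: eq_map_iota => q _; rewrite /mark_site /= dz.
Qed.
End StateMarks.

Section PhiBases.
Variables (P : comNzRingType) (t z : P).
Implicit Types (s : seq (P * bool)) (phi psi : seq (option bool) -> P).

Lemma Phi_cat B h s1 s2 phi :
  Phi t z B h (s1 ++ s2) phi = Phi t z (fun h' psi => Phi t z B h' s2 psi) h s1 phi.
Proof.
elim: s1 h phi => [|[a e] s1 IH] h phi //=.
by case: e; case: h; rewrite !IH.
Qed.

Lemma Phi_base B B' x h s phi psi :
  (forall h u, size u = size s -> B h (fun v => phi (u ++ v)) = x * B' h (fun v => psi (u ++ v))) ->
  Phi t z B h s phi = x * Phi t z B' h s psi.
Proof.
elim: s h phi psi => [|[a e] s IH] h phi psi hB /=; first exact: (hB h [::]).
have IH' h' o : Phi t z B h' s (fun u => phi (o :: u)) = x * Phi t z B' h' s (fun u => psi (o :: u)).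
  by apply: IH => h'' u su; apply: (hB h'' (o :: u)); rewrite /= su.
by case: e {hB}; case: h; rewrite !IH'; ring.
Qed.

Lemma Phi_base_ones B B' x s phi psi : all (fun y => ~~ y.2) s ->
  (forall u, size u = size s -> B false (fun v => phi (u ++ v)) = x * B' false (fun v => psi (u ++ v))) ->
  Phi t z B false s phi = x * Phi t z B' false s psi.
Proof.
elim: s phi psi => [|[a e] s IH] phi psi /= hs hB; first exact: (hB [::]).
case/andP: hs => /negbTE -> hs; rewrite (IH _ (fun u => psi (Some false :: u))) //; first by ring.
by move=> u su; apply: (hB (Some false :: u)); rewrite /= su.
Qed.

Lemma Phi_tail_one s phi : all (fun y => y.1 == 0) s -> Phi t z (@B0 P) false s phi = phi (word_of s).
Proof.
elim: s phi => [|[a e] s IH] phi //= /andP [/eqP -> hs].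
by case: e; rewrite !IH //; ring.
Qed.

Lemma Phi_tail_two s (g : nat -> P) : all (fun y => y.1 == 0) s ->
  Phi t z (@B0 P) true s (fun v => g (count_mem (Some true) v)) =
  (1 - t ^+ count (fun y => ~~ y.2) s) * g (count (fun y => y.2) s).+1.
Proof.
elim: s g => [|[a e] s IH] g /=; first by rewrite subrr mul0r.
move=> /andP [/eqP -> hs].
have wE : count_mem (Some true) (word_of s) = count (fun y => y.2) s.
  by rewrite count_map; apply: eq_count => y /=; case: (y.2).
case: e => /=; first by rewrite (IH (fun j => g j.+1)) // add0n !add1n; ring.
by rewrite Phi_tail_one // (IH g) // wE !add0n !add1n exprS; ring.
Qed.

Lemma Yf_ext s phi psi : phi =1 psi -> Yf t z s phi = Yf t z s psi.
Proof.
have h B h' s' (f g : seq (option bool) -> P) : f =1 g ->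
    (forall h'' f' g', f' =1 g' -> B h'' f' = B h'' g') -> Phi t z B h' s' f = Phi t z B h' s' g.
  move=> fg hB; rewrite -[RHS]mul1r; apply: Phi_base => h'' u _.
  by rewrite mul1r; apply: hB => v; apply: fg.
elim: s phi psi => [|[a e] s IH] phi psi hp //=.
rewrite (IH _ (fun u => psi (Some e :: u))) // (h _ _ _ _ (fun u => psi (None :: u))) //.
by move=> h'' f' g' fg; rewrite /B0; case: h''.
Qed.

Lemma Cf_ext s phi psi : phi =1 psi -> Cf t s phi = Cf t s psi.
Proof.
have hK s' (f g : seq (option bool) -> P) : f =1 g -> Kap t s' f = Kap t s' g.
  by elim: s' f g => [|[a e] s' IH] f g fg /=; rewrite ?fg // (IH _ (fun u => g (Some e :: u))).
elim: s phi psi => [|[a e] s IH] phi psi hp //=.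
by rewrite (IH _ (fun u => psi (Some e :: u))) // (hK _ _ (fun u => psi (None :: u))).
Qed.

End PhiBases.

Section PolynomialLift.
Variables (R : fieldType) (t : R).
Implicit Types (phi : seq (option bool) -> R).

Definition lift_sites (s : seq (R * bool)) : seq ({poly R} * bool) := [seq (x.1%:P, x.2) | x <- s].

Lemma Kap_lift s phi : Kap t%:P (lift_sites s) (fun u => (phi u)%:P) = (Kap t s phi)%:P.
Proof.
by elim: s phi => [|[a e] s IH] phi //=; rewrite IH polyCM; case: e.
Qed.

Lemma Cf_lift s phi : Cf t%:P (lift_sites s) (fun u => (phi u)%:P) = (Cf t s phi)%:P.
Proof.
elim: s phi => [|[a e] s IH] phi //=; rewrite IH polyCD.
by case: e; rewrite // Kap_lift.
Qed.

Lemma Carry_lift c u phi : Carry t%:P c u (fun u => (phi u)%:P) = (Carry t c u phi)%:P.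
Proof.
elim: u c phi => [|[e|] u IH] c phi //=.
by case: c; case: e; rewrite !IH // polyCD !polyCM polyCB polyC1.
Qed.

Lemma Xb_lift al u phi :
  Xb t%:P [seq a%:P | a <- al] u (fun u => (phi u)%:P) = (Xb t al u phi)%:P.
Proof.
elim: u al phi => [|[e|] u IH] [|a al] phi //=.
  by rewrite IH Carry_lift polyCD !polyCM polyCB polyC1.
by rewrite polyCM.
Qed.
End PolynomialLift.

Section Resolvent.
Variables (R : fieldType) (t : R) (n' k : nat) (a : nat -> R).
Hypothesis t_neq0 : t != 0.
Local Notation n := n'.+1.
Local Notation N := (n' + k)%N.
Local Notation mx := 'M[R]_#|state N.+1|.
Local Notation T := (@Tmx R N t).
Implicit Types (phi chi : seq (option bool) -> R) (F : seq nat -> R).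

Definition X0 : mx := Xmx N t (awt t a) 0.
Definition Csym : mx := matC t T n' 0.
Definition Qser : {poly R} := \prod_(p <- iota 0 N.+1) (1 - (a p)%:P * 'X).

Lemma rowf_dprod F m d : rowf N.+1 F *m dprod T m d = rowf N.+1 (chain t m d F).
Proof.
elim: d F => [|d IH] F; first by rewrite /= mulmx1.
rewrite rowfM rowf_Tmx IH; apply: rowf_ext => s _.
by have := chainD t m d 1 F s; rewrite addn1 addnS => ->.
Qed.

Lemma rowf_matC F d m : rowf N.+1 F *m matC t T d m = rowf N.+1 (Cd t d m F).
Proof.
elim: d m F => [|d IH] m F; first by rewrite /= mulmx1.
rewrite [matC _ _ _ _]/= mulmxDr -scalemxAr mulmx1 mulmxA rowf_Tmx IH.
by apply/rowP => j; rewrite !mxE.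
Qed.

Lemma rowf_X0 phi :
  rowf N.+1 (fun s => phi (mark n' k s)) *m X0 =
  rowf N.+1 (fun s => Xb t (weights n' k a) (mark n' k s) phi).
Proof.
rewrite /X0 /Xmx expr0 scale1r [Yop _ _ _ _ _]/= rowfM rowf_ommx rowf_dprod.
by apply: rowf_ext => s hs; rewrite chain_mark.
Qed.

Lemma rowf_Csym phi :
  rowf N.+1 (fun s => phi (mark n' k s)) *m Csym = rowf N.+1 (fun s => Cf t (sites n' k a s) phi).
Proof. by rewrite rowf_matC; apply: rowf_ext => s hs; rewrite (Cd_mark t a). Qed.

Fixpoint Mres r : mx := if r is r'.+1 then X0 *m (Mres r' + Qser`_r' *: Csym) else 0.

Definition site_polys s := lift_sites (sites n' k a s).

Lemma rowf_Mres phi r :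
  rowf N.+1 (fun s => phi (mark n' k s)) *m Mres r =
  rowf N.+1 (fun s => (Yf t%:P 'X (site_polys s) (fun u => (phi u)%:P))`_r).
Proof.
have wE s : [seq x.1 | x <- site_polys s] = [seq b%:P | b <- weights n' k a].
  by rewrite /site_polys /lift_sites /sites /weights -!map_comp.
have QE s : Qp 'X (site_polys s) = Qser.
  by rewrite /Qp /Qser /site_polys /lift_sites /sites !big_map.
elim: r phi => [|r IH] phi.
  rewrite mulmx0; apply/rowP => j; rewrite !mxE Yf_rec coefXM.
  by [].
rewrite [Mres _]/= mulmxA rowf_X0 mulmxDr (IH (fun u => Xb t (weights n' k a) u phi)).
rewrite -scalemxAr (rowf_Csym (fun u => Xb t (weights n' k a) u phi)).
apply/rowP => j; rewrite !mxE; set s := ssval _.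
have XS (p : {poly R}) : ('X * p)`_r.+1 = p`_r by rewrite coefXM.
rewrite [in RHS]Yf_rec XS [RHS]coefD QE wE.
have eX u : Xb t%:P [seq b%:P | b <- weights n' k a] u (fun u => (phi u)%:P) =
    (Xb t (weights n' k a) u phi)%:P by exact: Xb_lift.
by rewrite (Yf_ext _ _ _ eX) (Cf_ext _ _ eX) Cf_lift coefMC.
Qed.

Definition word_list s : seq (option bool) := word_of (sites n' k a s).

Lemma rowf_Mres_word chi r :
  (1 - t) *: (rowf N.+1 (fun s => chi (word_list s)) *m Mres r) =
  rowf N.+1 (fun s => (Phi t%:P 'X (@B0 _) false (site_polys s) (fun u => (chi u)%:P))`_r -
                      Qser`_r * chi (word_list s)).
Proof.
have -> : rowf N.+1 (fun s => chi (word_list s)) =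
          rowf N.+1 (fun s => Carry t false (mark n' k s) chi).
  apply: rowf_ext => s hs.
  have [x [ys [zs [es sys szs us]]]] := state_split hs.
  rewrite -Fill_carry /mark Fill_mark; last first.
    by rewrite /= add0n -(state_lt _ hs) es inE eqxx.
  rewrite /word_list /word_of /sites -map_comp; congr chi.
  apply: eq_map_iota => q _ /=; congr Some; case: eqP => // ->.
  rewrite es /= drop_cat sys ltnn subnn drop0.
  by move: us; rewrite /= mem_cat negb_or => /andP [/andP [_ /negbTE]].
rewrite (rowf_Mres (fun u => Carry t false u chi)).
apply/rowP => j; rewrite !mxE; set s := ssval _.
rewrite (@Yf_ext _ _ _ _ _ (fun u => Carry t%:P false u (fun u => (chi u)%:P))); last first.
  by move=> u; rewrite Carry_lift.
rewrite -coefCM polyCB polyC1 Yf_carry1 coefB; congr (_ - _).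
have -> : Qp 'X (site_polys s) = Qser.
  by rewrite /Qp /Qser /site_polys /lift_sites /sites !big_map.
by rewrite coefMC; congr (_ * chi _); rewrite /word_list /site_polys /word_of /lift_sites -map_comp.
Qed.

Lemma MresE r : Mres r = \sum_(1 <= j < r.+1) Qser`_(r - j) *: (X0 ^+ j *m Csym).
Proof.
elim: r => [|r IH]; first by rewrite big_geq.
rewrite [LHS]/= IH mulmxDr mulmx_sumr [RHS]big_add1 /= [RHS]big_nat_recl // addrC big_add1 /=.
rewrite -scalemxAr subn1 /= expr1; congr (_ + _); apply: eq_big_nat => j _.
by rewrite subSS -scalemxAr mulmxA [in RHS]exprS.
Qed.
End Resolvent.

(** * The transfer operator *)

Section PathSums.
Variable K : fieldType.
Implicit Types (W : nat -> bool -> bool -> K).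

Fixpoint path_sum W d h : K :=
  if d is d'.+1 then \sum_(h' : bool) W 0%N h h' * path_sum (fun i => W i.+1) d' h' else 1.

Lemma path_sumE W d h0 :
  \sum_(h : {ffun 'I_d.+1 -> bool} | h ord0 == h0)
    \prod_(i < d) W i (h (widen_ord (leqnSn d) i)) (h (lift ord0 i)) = path_sum W d h0.
Proof.
elim: d W h0 => [|d IH] W h0.
  rewrite (big_pred1 [ffun=> h0]) ?big_ord0 // => h; apply/eqP/eqP => [<-|->]; last by rewrite ffunE.
  by apply/ffunP => i; rewrite ffunE ord1.
pose ext (h : {ffun 'I_d.+1 -> bool}) : {ffun 'I_d.+2 -> bool} :=
  [ffun i => if unlift ord0 i is Some j then h j else h0].
pose res (h : {ffun 'I_d.+2 -> bool}) : {ffun 'I_d.+1 -> bool} := [ffun i => h (lift ord0 i)].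
have ext0 h : ext h ord0 = h0 by rewrite ffunE unlift_none.
have extS h i : ext h (lift ord0 i) = h i by rewrite ffunE liftK.
rewrite (reindex_onto ext res) /=; last first.
  move=> h /eqP hh; apply/ffunP => i; rewrite ffunE; case: unliftP => [j ->|->]; last by rewrite hh.
  by rewrite ffunE.
rewrite (eq_bigl predT); last first.
  move=> h; rewrite ext0 eqxx; apply/eqP/ffunP => i; by rewrite ffunE extS.
rewrite (partition_big (fun h : {ffun 'I_d.+1 -> bool} => h ord0) predT) //=.
apply: eq_bigr => h1 _; rewrite -IH mulr_sumr; apply: eq_bigr => h /eqP hh.
rewrite big_ord_recl /= extS hh; congr (W _ _ _ * _).
  by rewrite -[RHS](ext0 h); congr (ext h _); apply: val_inj.
apply: eq_bigr => i _; rewrite !extS; congr (W _ _ _).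
by rewrite -extS; congr (ext h _); apply: val_inj.
Qed.
End PathSums.

Section FreeBoundary.
Definition Bf (P : comNzRingType) (h : bool) (phi : seq (option bool) -> P) : P := phi [::].

Definition word_seq (e : nat -> bool) m d : seq (option bool) := [seq Some (e p) | p <- iota m d].
Definition site_seq (P : Type) (a : nat -> P) (e : nat -> bool) m d : seq (P * bool) :=
  [seq (a p, e p) | p <- iota m d].
Definition is_word (P : nzRingType) (w u : seq (option bool)) : P := (u == w)%:R.

Lemma Phi_morph (P P' : comNzRingType) (f : {rmorphism P -> P'}) t z h s phi :
  Phi (f t) (f z) (@Bf P') h [seq (f x.1, x.2) | x <- s] (fun u => f (phi u)) =
  f (Phi t z (@Bf P) h s phi).
Proof.
elim: s h phi => [|[a e] s IH] h phi //=.
by case: e; case: h; rewrite !IH !(rmorphD, rmorphM, rmorphN, rmorph1).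
Qed.

Lemma Phi_scalar (P : comNzRingType) (t z x : P) h s phi :
  Phi t z (@Bf P) h s (fun u => x * phi u) = x * Phi t z (@Bf P) h s phi.
Proof. by apply: Phi_base. Qed.

Lemma Phi_ext (P : comNzRingType) (t z : P) h s phi psi : phi =1 psi ->
  Phi t z (@Bf P) h s phi = Phi t z (@Bf P) h s psi.
Proof. by move=> e; rewrite -[RHS]mul1r; apply: Phi_base => h' u _; rewrite mul1r /Bf e. Qed.

Lemma Phi_path_sum (K : fieldType) (t z : K) a e e' m d h :
  (forall p, 1 - t * a p * z != 0) ->
  Phi t z (@Bf K) h (site_seq a e m d) (is_word K (word_seq e' m d)) =
  (\prod_(p <- iota m d) (1 - t * a p * z)) *
  path_sum (fun i b c => R_weight (z * a (m + i)%N) t (e (m + i)%N) b (e' (m + i)%N) c) d h.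
Proof.
move=> nz; elim: d m h => [|d IH] m h; first by rewrite big_nil mulr1 /= /Bf /is_word eqxx.
have cons b h' : Phi t z (@Bf K) h' (site_seq a e m.+1 d)
      (fun u => is_word K (word_seq e' m d.+1) (Some b :: u)) =
    (b == e' m)%:R * Phi t z (@Bf K) h' (site_seq a e m.+1 d) (is_word K (word_seq e' m.+1 d)).
  rewrite -Phi_scalar; apply: Phi_ext => u; rewrite /is_word /= eqseq_cons /= .
  rewrite (_ : (Some b == Some (e' m)) = (b == e' m)) //.
  by case: (b == e' m); rewrite ?mul1r ?mul0r.
have E h' : path_sum (fun i b c => R_weight (z * a (m + i.+1)%N) t (e (m + i.+1)%N) b (e' (m + i.+1)%N) c) d h' =
    path_sum (fun i b c => R_weight (z * a (m.+1 + i)%N) t (e (m.+1 + i)%N) b (e' (m.+1 + i)%N) c) d h'.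
  have ext W W' d' g : (forall i b c, W i b c = W' i b c) -> path_sum W d' g = path_sum W' d' g :> K.
    elim: d' W W' g => //= d' IHd W W' g hW; apply: eq_bigr => c _; rewrite hW.
    by congr (_ * _); apply: IHd => i b' c'.
  by apply: ext => i b c; rewrite addSnnS.
rewrite [path_sum _ _ _]/= addn0 big_bool /= !E big_cons.
have := nz m; set w := 1 - t * a m * z => wnz.
have wE : 1 - t * (z * a m) = w by rewrite /w; ring.
rewrite !cons !IH; set S1 := path_sum _ d true; set S0 := path_sum _ d false.
rewrite /R_weight wE; set q := \prod_(_ <- _) _.
case: (e m); case: h; case: (e' m) => /=; try by field.
Qed.
End FreeBoundary.

Section TransferCoefficients.
Variables (R : realType) (n' : nat) (t : R) (a : nat -> R).
Local Notation n := n'.+1.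
Local Notation K := {fraction {poly R}}.

Definition wfun (w : word n) p := w (inord p).
Definition Ptr (e e' : word n) : {poly R} :=
  Phi t%:P 'X (@Bf _) false (site_seq (fun p => (a p)%:P) (wfun e) 0 n)
    (is_word _ (word_seq (wfun e') 0 n)).
Definition Qn : {poly R} := \prod_(p <- iota 0 n) (1 - (a p)%:P * 'X).

Lemma prod_iota_ord (A : comNzRingType) (F : nat -> A) : \prod_(p <- iota 0 n) F p = \prod_(i < n) F i.
Proof. by rewrite -[n in LHS]subn0 -(big_mkord xpredT). Qed.

Lemma Qn0 : Qn`_0 = 1.
Proof.
rewrite /Qn -horner_coef0 horner_prod big1 // => p _.
by rewrite hornerD hornerN hornerM hornerX !hornerC mulr0 subr0.
Qed.

Lemma one_sub_neq0 (c : R) : 1 - c *: 'X != 0 :> {poly R}.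
Proof.
apply/eqP => /(congr1 (fun p : {poly R} => p`_0)).
by rewrite coefB coef1 coefZ coefX mulr0 subr0 coef0 => /eqP; rewrite oner_eq0.
Qed.

Lemma transfer_tildeE (e e' : word n) :
  transfer_tilde t (fun i : 'I_n => a i) (enum_rank e') (enum_rank e) = tofrac (Ptr e e') / tofrac Qn.
Proof.
rewrite !mxE !enum_rankK; set c := (\prod_(i < n) _).
pose tK := tofrac (t%:P : {poly R}); pose aK p := tofrac ((a p)%:P : {poly R}).
have PE : tofrac (Ptr e e') =
    Phi tK (alpha R) (@Bf _) false (site_seq aK (wfun e) 0 n) (is_word _ (word_seq (wfun e') 0 n)).
  rewrite /Ptr -Phi_morph /site_seq -map_comp; apply: Phi_ext => u.
  by rewrite /is_word rmorph_nat.
have nz p : 1 - tK * aK p * alpha R != 0.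
  rewrite -tofrac1 /tK /aK /alpha -!tofracM -tofracB tofrac_eq0 -polyCM mul_polyC.
  exact: one_sub_neq0.
have nz1 p : 1 - alpha R * aK p != 0.
  by rewrite -tofrac1 /aK /alpha -tofracM -tofracB tofrac_eq0 mulrC mul_polyC; exact: one_sub_neq0.
rewrite PE (Phi_path_sum _ _ _ _ _ nz) prod_iota_ord.
have QE : tofrac Qn = \prod_(i < n) (1 - alpha R * aK i).
  rewrite /Qn prod_iota_ord rmorph_prod; apply: eq_bigr => i _.
  by rewrite rmorphB rmorph1 rmorphM mulrC.
rewrite QE mulrAC -prodf_div /c; congr (_ * _).
  by apply: eq_bigr => i _; congr (_ / _); rewrite /tK /aK /const_alpha mulrAC.
rewrite /transfer_coef -path_sumE; apply: eq_bigr => h _; apply: eq_bigr => i _.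
by rewrite !add0n /wfun !inord_val.
Qed.

Lemma transfer_seriesE (e e' : word n) r :
  \sum_(i < r.+1) Qn`_i * transfer_series t (fun i : 'I_n => a i) (r - i) (enum_rank e') (enum_rank e) =
  (Ptr e e')`_r.
Proof.
rewrite -(@series_coefP _ (Ptr e e') Qn) ?Qn0 ?oner_eq0 //; apply: eq_bigr => i _.
by rewrite [transfer_series _ _ _ _ _]mxE transfer_tildeE.
Qed.

Lemma transfer_series_mx r (A : 'M[R]_#|word n|) :
  (forall e e', A (enum_rank e') (enum_rank e) = (Ptr e e')`_r) ->
  \sum_(i < r.+1) Qn`_i *: transfer_series t (fun i : 'I_n => a i) (r - i) = A.
Proof.
move=> hA; apply/matrixP => x y; rewrite -[x]enum_valK -[y]enum_valK hA -transfer_seriesE.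
by rewrite summxE; apply: eq_bigr => i _; rewrite [LHS]mxE.
Qed.
End TransferCoefficients.

Section Intertwiner.
Variables (R : realType) (t : R) (n' k : nat) (a : nat -> R).
Local Notation n := n'.+1.
Local Notation N := (n' + k)%N.
Hypothesis t_neq0 : t != 0.
Hypothesis pow_neq1 : forall m, (0 < m)%N -> 1 - t ^+ m != 0.
Hypothesis a_tail : forall p, (n <= p)%N -> a p = 0.
Implicit Types (s : seq nat).

(* Colours [>= n] are read as letters 2.  The [k] auxiliary sites [p >= n] have [a p = 0]; the
   normalization [cpoch] makes pushing a letter 2 into them equivalent to a free right boundary. *)
Definition cpoch j : R := \prod_(i < j) (1 - t ^+ (k - i)).
Definition chi (e : word n) (u : seq (option bool)) : R :=
  (take n u == word_seq (wfun e) 0 n)%:R * (cpoch (count_mem (Some true) (drop n u)))^-1.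
Definition sword s : word n := [ffun i : 'I_n => (i : nat) \in drop n s].
Definition tail_twos s := count (fun p => p \in drop n s) (iota n k).

Lemma word_seqD f i j : word_seq f 0 (i + j) = word_seq f 0 i ++ word_seq f i j.
Proof. by rewrite /word_seq iotaD map_cat. Qed.

Lemma size_word_seq f i j : size (word_seq f i j) = j.
Proof. by rewrite size_map size_iota. Qed.

Lemma word_listE s : word_list n' k a s = word_seq (fun p => p \in drop n s) 0 (n + k).
Proof. by rewrite /word_list /word_of /sites -map_comp. Qed.

Lemma word_seq_eq f (e : word n) :
  (word_seq f 0 n == word_seq (wfun e) 0 n) = (e == [ffun i : 'I_n => f i]).
Proof.
apply/eqP/eqP => [h|->].
  apply/ffunP => i; rewrite ffunE.
  have := congr1 (fun u => nth None u i) h.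
  rewrite /word_seq !(nth_map 0%N) ?size_iota // nth_iota // add0n /wfun inord_val.
  by case.
by rewrite /word_seq; apply: eq_map_iota => q hq; rewrite /wfun ffunE inordK.
Qed.

Lemma count_word_seq f i j : count_mem (Some true) (word_seq f i j) = count f (iota i j).
Proof. by rewrite count_map; apply: eq_count => p /=; case: (f p). Qed.

Lemma chi_word e s : chi e (word_list n' k a s) = (e == sword s)%:R * (cpoch (tail_twos s))^-1.
Proof.
by rewrite /chi word_listE word_seqD take_size_cat ?drop_size_cat ?size_word_seq //
  word_seq_eq count_word_seq.
Qed.

Lemma uniq_state s : perm_eq s (iota 0 N.+1) -> uniq s.
Proof. by move=> hs; rewrite (perm_uniq hs) iota_uniq. Qed.

Lemma tail_twosD s : perm_eq s (iota 0 N.+1) ->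
  (count (fun p => p \in drop n s) (iota 0 n) + tail_twos s)%N = k.
Proof.
move=> hs; rewrite /tail_twos -count_cat -(iotaD 0 n k) -(seq.permP hs).
set f := fun p => _; rewrite -(cat_take_drop n s) count_cat /f.
have us : uniq (take n s ++ drop n s) by rewrite cat_take_drop uniq_state.
move: us; rewrite cat_uniq => /and3P [_ hd _].
rewrite (@eq_in_count _ _ pred0 (take n s)).
  by rewrite count_pred0 (@eq_in_count _ _ predT) ?count_predT ?size_drop ?(size_perm_iota hs) // subSS addKn.

by move=> p hp /=; apply: contraNF hd => hq; apply/hasP; exists p.
Qed.

Lemma Phi_sites e s : perm_eq s (iota 0 N.+1) ->
  Phi t%:P 'X (@B0 _) false (site_polys n' k a s) (fun u => (chi e u)%:P) =
  ((cpoch (tail_twos s))^-1)%:P * Ptr t a (sword s) e.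
Proof.
move=> hs; set f := fun p => p \in drop n s; set j := tail_twos s.
have jk : (j <= k)%N by have := tail_twosD hs; lia.
pose aP p := (a p)%:P : {poly R}.
have -> : site_polys n' k a s = site_seq aP f 0 n ++ site_seq aP f n k.
  by rewrite /site_polys /lift_sites /sites -map_comp /site_seq -map_cat -iotaD.
rewrite Phi_cat; set tl := site_seq aP f n k.
have tl0 : all (fun y => y.1 == 0) tl.
  apply/allP => y /mapP [p]; rewrite mem_iota => /andP [hp _] -> /=.
  by rewrite /aP a_tail.
have twos : count (fun y => y.2) tl = j by rewrite count_map.
have ones : count (fun y => ~~ y.2) tl = (k - j)%N.
  have := count_predC (fun y : {poly R} * bool => y.2) tl.
  by rewrite twos size_map size_iota => <-; rewrite addKn.
pose w := word_seq (wfun e) 0 n.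
have -> : Ptr t a (sword s) e = Phi t%:P 'X (@Bf _) false (site_seq aP f 0 n) (is_word _ w).
  congr Phi; apply: eq_map_iota => q hq; congr pair.
  by rewrite /wfun ffunE inordK.
have chi_cat u v : size u = n -> chi e (u ++ v) = (u == w)%:R * (cpoch (count_mem (Some true) v))^-1.
  by move=> su; rewrite /chi take_size_cat // drop_size_cat.
have chi_ext B h' phi psi : (forall v, phi v = psi v) ->
    (B = fun h psi => Phi t%:P 'X (@B0 {poly R}) h tl psi) -> B h' phi = B h' psi.
  move=> hv ->; rewrite -[RHS]mul1r; apply: Phi_base => h'' v _; rewrite mul1r.
  by rewrite /B0; case: h''.
have base1 u : size u = n -> Phi t%:P 'X (@B0 _) false tl (fun v => (chi e (u ++ v))%:P) =
    ((cpoch j)^-1)%:P * (is_word {poly R} w u).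
  move=> su; rewrite Phi_tail_one // chi_cat // polyCM mulrC; congr (_%:P * _).
    by rewrite -twos /tl /word_of -map_comp count_map; congr (cpoch _)^-1;
      rewrite count_map; apply: eq_count => p /=; case: (f p).
  by rewrite /is_word; case: eqP.
have szf : size (site_seq aP f 0 n) = n by rewrite size_map size_iota.
case: (ltngtP j k) => [jlt|jgt|jE]; last 2 first.
- by have := jk; lia.
- apply: Phi_base_ones; last by move=> u su; rewrite base1 ?su // /Bf cats0.
  have h0 : count f (iota 0 n) = 0%N by have := tail_twosD hs; rewrite -/f -/j; lia.
  apply/allP => y /mapP [p hp ->] /=; apply: contraT; rewrite negbK => fp.
  by have : has f (iota 0 n) by [apply/hasP; exists p]; rewrite has_count h0.
apply: Phi_base => h u su; rewrite szf in su; rewrite /Bf cats0.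
case: h; last exact: base1.
pose g i : {poly R} := (u == w)%:R * ((cpoch i)^-1)%:P.
have -> : Phi t%:P 'X (@B0 _) true tl (fun v => (chi e (u ++ v))%:P) =
          Phi t%:P 'X (@B0 _) true tl (fun v => g (count_mem (Some true) v)).
  apply: (chi_ext (fun h psi => Phi t%:P 'X (@B0 {poly R}) h tl psi)) => // v.
  by rewrite chi_cat // polyCM /g; case: eqP.
rewrite Phi_tail_two // ones twos /g /is_word mulrCA mulrC; congr (_ * _).
rewrite -polyC1 -[t%:P ^+ _]polyC_exp -polyCB -polyCM; congr (_%:P).
by rewrite /cpoch big_ord_recr /= invfM mulrCA mulfV ?mulr1 // pow_neq1 //; lia.
Qed.

Definition rho : 'M[R]_(#|word n|, #|state N.+1|) :=
  \matrix_(i, j) chi (enum_val i) (word_list n' k a (ssval (enum_val j))).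

Lemma row_rho i : row i rho = rowf N.+1 (fun s => chi (enum_val i) (word_list n' k a s)).
Proof. by apply/rowP => j; rewrite !mxE. Qed.

Lemma mulmx_rho p (A : 'M[R]_(p, #|word n|)) i j : let s := ssval (enum_val j) in
  (A *m rho) i j = A i (enum_rank (sword s)) * (cpoch (tail_twos s))^-1.
Proof.
move=> s; rewrite mxE (bigD1 (enum_rank (sword s))) //= !mxE enum_rankK chi_word eqxx mul1r.
rewrite big1 ?addr0 // => l hl; rewrite mxE chi_word.
by rewrite (negbTE (_ : enum_val l != _)) ?mul0r ?mulr0 // -(inj_eq enum_rank_inj) enum_valK.
Qed.

Local Notation Tser := (transfer_series t (fun i : 'I_n => a i)).

Lemma Qser_Qn : Qser n' k a = Qn n' a.
Proof.
rewrite /Qser (_ : N.+1 = (n + k)%N) // iotaD big_cat [X in _ * X = _]big_seq.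
rewrite [X in _ * X = _]big1 ?mulr1 // => p.
by rewrite mem_iota => /andP [hp _]; rewrite a_tail // mul0r subr0.
Qed.

Lemma rho_Mres r :
  (1 - t) *: (rho *m Mres t n' k a r) + (Qn n' a)`_r *: rho =
  \sum_(i < r.+1) (Qn n' a)`_i *: (Tser (r - i) *m rho).
Proof.
apply/row_matrixP => e; rewrite linearD !linearZ /= row_mul row_rho rowf_Mres_word //.
apply/rowP => j; rewrite !mxE summxE; set s := ssval (enum_val j).
rewrite Phi_sites ?state_perm // Qser_Qn subrK coefCM -transfer_seriesE mulr_sumr.
apply: eq_bigr => i _; rewrite [RHS]mxE mulmx_rho enum_valK -/s.
by rewrite mulrC mulrA.
Qed.

Lemma Tser_rho0 : Tser 0 *m rho = rho.
Proof.
by have := rho_Mres 0; rewrite mulmx0 scaler0 add0r big_ord1 Qn0 !scale1r subn0 => <-.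
Qed.

Lemma Tser_rho r : (0 < r)%N -> Tser r *m rho = (1 - t) *: (rho *m (X0 t n' k a ^+ r *m Csym t n' k)).
Proof.
elim/ltn_ind: r => -[//|r] IH _.
have := rho_Mres r.+1; rewrite MresE (mulmx_sumr rho) scaler_sumr.
have -> : \sum_(i < r.+2) (Qn n' a)`_i *: (Tser (r.+1 - i) *m rho) =
    (Qn n' a)`_r.+1 *: rho + \sum_(1 <= j < r.+2) (Qn n' a)`_(r.+1 - j) *: (Tser j *m rho).
  rewrite -(big_mkord xpredT (fun i => (Qn n' a)`_i *: (Tser (r.+1 - i) *m rho))).
  rewrite big_nat_rev add0n big_ltn //= (_ : r.+2 - 1 = r.+1)%N // subnn Tser_rho0; congr (_ + _).
  by apply: eq_big_nat => j hj; rewrite subSS subKn //; case/andP: hj.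
rewrite addrC => /addrI; rewrite !(@big_nat_recr _ _ _ r.+1) //= subnn Qser_Qn Qn0 !scale1r.
set S1 := \sum_(_ <= _ < _) _; set S2 := \sum_(_ <= _ < _) _.
suff -> : S1 = S2 by move/addrI.
apply: eq_big_nat => j /andP [j0 jr]; rewrite IH //.
by rewrite -scalemxAr scalerA mulrC -scalerA.
Qed.
End Intertwiner.

Section IntertwinerSymmetric.
Variables (R : realType) (t : R) (n' k : nat) (a : nat -> R).
Local Notation n := n'.+1.
Local Notation N := (n' + k)%N.
Hypothesis t_neq0 : t != 0.
Hypothesis pow_neq1 : forall m, (0 < m)%N -> 1 - t ^+ m != 0.
Hypothesis a_tail : forall p, (n <= p)%N -> a p = 0.
Local Notation T := (@Tmx R N t).
Local Notation rho := (rho t n' k a).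

Lemma Td_drop m d (G : seq nat -> R) s : (m.+1 < d)%N -> Td t m (fun u => G (drop d u)) s = G (drop d s).
Proof.
elim: m d s => [|m IH] [|d] [|x s] //= h; last exact: IH.
by case: s => [|y s] //; case: d h => [|d] //= _; case: ifP => _ //; ring.
Qed.

Lemma rho_T m : (m < n')%N -> rho *m T m.+1 = rho.
Proof.
move=> hm; apply/row_matrixP => e; rewrite row_mul row_rho rowf_Tmx; apply: rowf_ext => s _ /=.
pose G (zs : seq nat) := chi t k (enum_val e) (word_seq (fun p => p \in zs) 0 (n + k)).
transitivity (Td t m (fun u => G (drop n u)) s).
  by apply: local_ext => [|u _]; [exact: local_Td | rewrite word_listE].
by rewrite Td_drop // word_listE.
Qed.

Definition Xop (i : 'I_n) : 'M[R]_#|state N.+1| := Xmx N t (awt t a) i.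

Lemma Xop_comm i j : GRing.comm (Xop i) (Xop j).
Proof. by apply: Xmx_comm => //; have := ltn_ord i; have := ltn_ord j; lia. Qed.

Lemma XiT m : (m < n')%N ->
  Xop (inord m) * T m.+1 = T m.+1 * Xop (inord m.+1) + (1 - t) *: Xop (inord m).
Proof. by move=> hm; rewrite /Xop !inordK; [apply: Xmx_T => // | | ]; lia. Qed.

Lemma XjT m : (m < n')%N ->
  Xop (inord m.+1) * T m.+1 = T m.+1 * Xop (inord m) - (1 - t) *: Xop (inord m).
Proof. by move=> hm; rewrite /Xop !inordK; [apply: Xmx_ST => // | | ]; lia. Qed.

Lemma XkT m (i : 'I_n) : (m < n')%N -> i != inord m -> i != inord m.+1 -> Xop i * T m.+1 = T m.+1 * Xop i.
Proof.
move=> hm; rewrite -!val_eqE /= !inordK; [|lia|lia] => h1 h2.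
by apply: Xmx_comm_T => //; have := ltn_ord i; try lia; rewrite eq_sym.
Qed.

Lemma rho_symC f :
  rho *m ev Xop f *m matC t T n' 0 = rho *m ev Xop (symC t n' 0 f).
Proof. by apply: ev_matC; [exact: Xop_comm|exact: XiT|exact: XjT|exact: XkT|exact: rho_T|]. Qed.

Lemma rho_symQ f :
  rho *m ev Xop f *m matQ t T n' 0 = rho *m ev Xop (symQ t n' 0 f).
Proof. by apply: ev_matQ; [exact: Xop_comm|exact: XiT|exact: XjT|exact: XkT|exact: rho_T|]. Qed.

Lemma transfer_series_rho r : (0 < r)%N ->
  transfer_series t (fun i : 'I_n => a i) r *m rho =
  rho *m ev Xop ((1 - t) *: symC t n' 0 ('X_ord0 ^+ r)).
Proof.
move=> r0; rewrite Tser_rho // evZ -scalemxAr -rho_symC (evXn Xop_comm) evXi.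
by rewrite -mulmxA.
Qed.
End IntertwinerSymmetric.

(** * Positivity *)

Section Nonnegativity.
Variables (R : realFieldType) (N : nat) (t : R) (wt : nat -> R).
Hypothesis t01 : 0 <= t <= 1.
Hypothesis wt_ge0 : forall p, 0 <= wt p.
Implicit Types F : seq nat -> R.
Local Notation mx := 'M[R]_#|state N.+1|.

Definition nnmx p q (A : 'M[R]_(p, q)) := forall i j, 0 <= A i j.

Lemma nnmxM p q r (A : 'M[R]_(p, q)) (B : 'M[R]_(q, r)) : nnmx A -> nnmx B -> nnmx (A *m B).
Proof. by move=> hA hB i j; rewrite mxE sumr_ge0 // => l _; rewrite mulr_ge0. Qed.

Lemma nnmxD p q (A B : 'M[R]_(p, q)) : nnmx A -> nnmx B -> nnmx (A + B).
Proof. by move=> hA hB i j; rewrite mxE addr_ge0. Qed.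

Lemma nnmxZ p q c (A : 'M[R]_(p, q)) : 0 <= c -> nnmx A -> nnmx (c *: A).
Proof. by move=> hc hA i j; rewrite mxE mulr_ge0. Qed.

Lemma nnmx1 p : nnmx (1%:M : 'M[R]_p).
Proof. by move=> i j; rewrite mxE ler0n. Qed.

Lemma nnmxX p (A : 'M[R]_p) r : nnmx A -> nnmx (A ^+ r).
Proof. by move=> hA; elim: r => [|r IH]; [exact: nnmx1|rewrite exprS; apply: nnmxM]. Qed.

Lemma Td_ge0 i F : (forall u, 0 <= F u) -> forall s, 0 <= Td t i F s.
Proof.
case/andP: t01 => t0 t1.
elim: i F => [|i IH] F hF [|x s] //=; last exact: IH.
by case: s => [|y s] //; case: ifP => _ //; rewrite addr_ge0 // mulr_ge0 // subr_ge0.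
Qed.

Lemma Om_ge0 F : (forall u, 0 <= F u) -> forall s, 0 <= Om wt F s.
Proof. by move=> hF [|x s] //=; rewrite mulr_ge0. Qed.

Lemma nnmx_Tmx i : nnmx (Tmx N t i).
Proof. by move=> p q; rewrite mxE; apply: Td_ge0 => u; rewrite ler0n. Qed.

Lemma nnmx_ommx : nnmx (ommx N wt).
Proof. by move=> p q; rewrite mxE; apply: Om_ge0 => u; rewrite ler0n. Qed.

Lemma nnmx_Wop r : nnmx (Wop N (Tmx N t) (ommx N wt) r).
Proof.
apply: nnmxM; first exact: nnmx_ommx.
by elim: (N - r)%N => [|d IH]; [exact: nnmx1 | apply: nnmxM IH; apply: nnmx_Tmx].
Qed.

Lemma nnmx_matC d m : nnmx (matC t (Tmx N t) d m).
Proof.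
elim: d m => [|d IH] m /=; first exact: nnmx1.
apply: nnmxD; first by apply: nnmxZ; [apply: exprn_ge0; case/andP: t01|exact: nnmx1].
by apply: nnmxM; [exact: nnmx_Tmx | exact: IH].
Qed.

Lemma nnmx_matQ d m : nnmx (matQ t (Tmx N t) d m).
Proof.
elim: d m => [|d IH] m; first exact: nnmx1.
by apply: nnmxM; [exact: IH | exact: nnmx_matC].
Qed.
End Nonnegativity.

Section DominantMonomials.
Variables (R : comNzRingType) (n' : nat).
Local Notation n := n'.+1.

Lemma prod_dominant (x : nat -> R) (l : nat -> nat) : (forall i, (i < n')%N -> (l i.+1 <= l i)%N) ->
  \prod_(i < n) x i ^+ l i =
  \prod_(r < n) (\prod_(0 <= i < r.+1) x i) ^+ (l r - (if r == n' :> nat then 0 else l r.+1)).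
Proof.
move=> hl; pose d r := (l r - (if r == n' then 0 else l r.+1))%N.
have tel i : (i <= n')%N -> l i = (\sum_(i <= r < n) d r)%N.
  move=> /subnKC; move: (n' - i)%N => m; elim: m i => [|m IH] i hm.
    by rewrite addn0 in hm; rewrite hm big_nat1 /d eqxx subn0.
  rewrite big_ltn; last by rewrite ltnS -hm leq_addr.
  rewrite -IH; last by rewrite addSnnS.
  rewrite /d ifF ?subnK ?hl //; [|apply/eqP => e]; move: hm; last by rewrite e; lia.
  by lia.
rewrite -(big_mkord xpredT (fun i => x i ^+ l i)).
rewrite -(big_mkord xpredT (fun r => (\prod_(0 <= i < r.+1) x i) ^+ d r)).
transitivity (\prod_(0 <= i < n) \prod_(0 <= r < n | (i <= r)%N) x i ^+ d r).
  apply: eq_big_nat => i hi; rewrite tel; last by lia.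
  by rewrite expr_sum (big_nat_widenl _ 0).
rewrite (exchange_big_dep_nat xpredT) //=; apply: eq_big_nat => r hr.
by rewrite -prodrXl [RHS](big_nat_widen _ _ n).
Qed.
End DominantMonomials.

Section EntrywiseBounds.
Variables (R : realFieldType) (t : R) (wt : nat -> R).
Hypothesis t01 : 0 <= t <= 1.
Hypothesis wt_ge0 : forall p, 0 <= wt p.
Implicit Types (F G : seq nat -> R) (s us vs xs : seq nat).

Let t_ge0 : 0 <= t. Proof. by case/andP: t01. Qed.

Lemma Td_lower F us x y s : (forall u, 0 <= F u) ->
  (if (x < y)%N then 1 else t) * F (us ++ y :: x :: s) <= Td t (size us) F (us ++ x :: y :: s).
Proof.
move=> hF; rewrite -[size us]addn0 Td_cat /=; case: ifP => _; first by rewrite mul1r.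
by rewrite lerDr mulr_ge0 // subr_ge0; case/andP: t01.
Qed.

Lemma chain_ge0 m d F : (forall u, 0 <= F u) -> forall s, 0 <= chain t m d F s.
Proof. by elim: d m => [|d IH] m hF //=; apply: Td_ge0 => // u; apply: IH. Qed.

Lemma chain_lower F us x vs : (forall u, 0 <= F u) -> all (fun y => y < x)%N vs ->
  t ^+ size vs * F (us ++ rcons vs x) <= chain t (size us) (size vs) F (us ++ x :: vs).
Proof.
move=> hF; elim: vs us => [|y vs IH] us /=; first by rewrite mul1r.
case/andP => yx hv; have := @Td_lower (chain t (size us).+1 (size vs) F) us x y vs.
rewrite ltnNge (ltnW yx) /= => h; apply: le_trans (h _); last exact: chain_ge0.
rewrite exprS -mulrA ler_wpM2l //.
by have := IH (rcons us y) hv; rewrite size_rcons !cat_rcons.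
Qed.

Lemma Cd_ge0 d m F : (forall u, 0 <= F u) -> forall s, 0 <= Cd t d m F s.
Proof.
elim: d m F => [|d IH] m F hF s //=; rewrite addr_ge0 ?mulr_ge0 ?exprn_ge0 //.
by apply: IH; apply: Td_ge0.
Qed.

Lemma Cd_lower F us xs z : (forall u, 0 <= F u) -> all (fun x => x < z)%N xs ->
  F (us ++ z :: xs) <= Cd t (size xs) (size us) F (us ++ rcons xs z).
Proof.
elim: xs us F => [|x xs IH] us F hF /= => [_|/andP [xz hx]]; first exact: lexx.
have hT : forall u, 0 <= Td t (size us) F u by apply: Td_ge0.
apply: (@le_trans _ _ (Cd t (size xs) (size us).+1 (Td t (size us) F) (us ++ x :: rcons xs z))).
  have := IH (rcons us x) _ hT hx; rewrite size_rcons !cat_rcons; apply: le_trans.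
  by have := @Td_lower F us x z xs hF; rewrite xz mul1r.
by rewrite lerDr mulr_ge0 // exprn_ge0.
Qed.

Fixpoint Qd d m F : seq nat -> R := if d is d'.+1 then Cd t d m (Qd d' m.+1 F) else F.

Lemma Qd_ge0 d m F : (forall u, 0 <= F u) -> forall s, 0 <= Qd d m F s.
Proof. by elim: d m => [|d IH] m hF //=; apply: (@Cd_ge0 d.+1) => u; apply: IH. Qed.

Lemma Qd_lower F us d m : (forall u, 0 <= F u) ->
  F (us ++ rev (iota m d.+1)) <= Qd d (size us) F (us ++ iota m d.+1).
Proof.
move=> hF; elim: d us => [|d IH] us; first exact: lexx.
have -> : iota m d.+2 = rcons (iota m d.+1) (m + d.+1)%N by rewrite -cats1 -(addn1 d.+1) iotaD.
rewrite rev_rcons; have := IH (rcons us (m + d.+1)%N); rewrite size_rcons !cat_rcons.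
move/le_trans; apply; have := @Cd_lower (Qd d (size us).+1 F) us (iota m d.+1) (m + d.+1)%N.
rewrite size_iota; apply; first exact: Qd_ge0.
by apply/allP => p; rewrite mem_iota; lia.
Qed.

Variable N : nat.
Definition Wf r F := chain t r (N - r) (Om wt F).

Lemma Wf_ge0 r F : (forall u, 0 <= F u) -> forall s, 0 <= Wf r F s.
Proof. by move=> hF; apply: chain_ge0; apply: Om_ge0. Qed.

Lemma Wf_lower r F us x vs : (forall u, 0 <= F u) -> size us = r -> size vs = (N - r)%N ->
  all (fun y => y < x)%N vs ->
  t ^+ (N - r) * wt x * F (x :: us ++ vs) <= Wf r F (us ++ x :: vs).
Proof.
move=> hF su sv hv; have := chain_lower (F := Om wt F) us (Om_ge0 wt_ge0 hF) hv.
by rewrite -rcons_cat Om_rcons su sv mulrA.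
Qed.

Lemma iter_Wf_lower r F us1 us2 vs : (forall u, 0 <= F u) -> (size us1 + size us2)%N = r.+1 ->
  size vs = (N - r)%N -> all (fun x => all (fun y => y < x)%N vs) us2 ->
  (\prod_(x <- us2) (t ^+ (N - r) * wt x)) * F (us2 ++ us1 ++ vs) <=
  iter (size us2) (Wf r) F (us1 ++ us2 ++ vs).
Proof.
move=> hF; have hI m : forall u, 0 <= iter m (Wf r) F u.
  by elim: m => [|m IH] //= u; apply: Wf_ge0.
elim/last_ind: us2 us1 => [|us2 x IH] us1 hs sv; first by rewrite big_nil mul1r.
rewrite all_rcons => /andP [hx h2]; rewrite size_rcons addnS in hs; case: hs => hs.
rewrite size_rcons; have -> : \prod_(y <- rcons us2 x) (t ^+ (N - r) * wt y) =
    t ^+ (N - r) * wt x * \prod_(y <- us2) (t ^+ (N - r) * wt y).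
  by rewrite -cats1 big_cat big_seq1 [LHS]mulrC.
rewrite /= !cat_rcons [us1 ++ us2 ++ _]catA.
have s12 : size (us1 ++ us2) = r by rewrite size_cat.
apply: le_trans (Wf_lower (hI _) s12 sv hx); rewrite -catA.
have := IH (x :: us1); rewrite /= addSn hs => /(_ erefl sv h2) => h.
rewrite -mulrA ler_wpM2l //.
by rewrite mulr_ge0 // exprn_ge0.
Qed.
End EntrywiseBounds.

Section DiagonalBound.
Variables (R : realType) (t : R) (n' : nat) (a : nat -> R).
Local Notation n := n'.+1.
Local Notation N := (n' + 0)%N.
Hypothesis t01 : 0 < t <= 1.
Hypothesis a_ge0 : forall p, 0 <= a p.
Local Notation mx := 'M[R]_#|state N.+1|.
Local Notation T := (@Tmx R N t).

Let t_neq0 : t != 0. Proof. by case/andP: t01 => /gt_eqF ->. Qed.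
Let t_ge0 : 0 <= t <= 1. Proof. by case/andP: t01 => /ltW -> ->. Qed.
Let wt_ge0 p : 0 <= awt t a p.
Proof. by rewrite mulr_ge0 // exprn_ge0 // invr_ge0; case/andP: t_ge0. Qed.

Lemma rowf_matQ F d m : rowf N.+1 F *m matQ t T d m = rowf N.+1 (Qd t d m F).
Proof.
elim: d m F => [|d IH] m F; first by rewrite /= mulmx1.
by rewrite [matQ _ _ _ _]/= mulmxA IH -/(matC t T d.+1 m) (@rowf_matC R t n' 0).
Qed.

Lemma rowf_Wop F r m :
  rowf N.+1 F *m (Wop N T (ommx N (awt t a)) r) ^+ m = rowf N.+1 (iter m (Wf t (awt t a) N r) F).
Proof.
elim: m F => [|m IH] F; first by rewrite mulmx1.
by rewrite exprS rowfM rowfM rowf_ommx (@rowf_dprod R t n' 0) IH -iterSr.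
Qed.

Lemma rowf_delta (A : mx) i j :
  (rowf N.+1 (fun s => (s == ssval (enum_val i))%:R) *m A) 0 j = A i j.
Proof.
rewrite mxE (bigD1 i) //= mxE eqxx mul1r big1 ?addr0 // => l li.
by rewrite mxE (inj_eq val_inj) (inj_eq enum_val_inj) (negbTE li) mul0r.
Qed.

Variables (w0 w1 : 'I_#|state N.+1|).
Hypothesis w0E : ssval (enum_val w0) = rev (iota 0 N.+1).
Hypothesis w1E : ssval (enum_val w1) = iota 0 N.+1.

Lemma matQ_lower : 1 <= matQ t T N 0 w0 w1.
Proof.
rewrite -rowf_delta rowf_matQ mxE w1E w0E.
have := @Qd_lower _ _ t_ge0 (fun s => (s == rev (iota 0 N.+1))%:R) [::] N 0.
by rewrite cat0s eqxx; apply => u; rewrite ler0n.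
Qed.

Lemma prod_Xmx_lower r : (r <= N)%N ->
  \prod_(i < r.+1) a (N - r + i)%N <= (\prod_(0 <= i < r.+1) Xmx N t (awt t a) i) w0 w0.
Proof.
move=> hr; rewrite prod_Xmx // mxE -rowf_delta rowf_Wop mxE w0E.
set us := rev (iota (N - r) r.+1); set vs := rev (iota 0 (N - r)).
have splitE : rev (iota 0 N.+1) = us ++ vs.
  by rewrite -rev_cat -[X in iota X r.+1]add0n -iotaD addnS subnK.
pose F s : R := (s == rev (iota 0 N.+1))%:R.
have F0 u : 0 <= F u by rewrite ler0n.
have su : size us = r.+1 by rewrite size_rev size_iota.
have sv : size vs = (N - r)%N by rewrite size_rev size_iota.
have h : all (fun x => all (fun y => y < x)%N vs) us.
  apply/allP => x; rewrite mem_rev mem_iota => hx.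
  by apply/allP => y; rewrite mem_rev mem_iota; lia.
have := iter_Wf_lower t_ge0 wt_ge0 (us1 := [::]) F0 su sv h.
rewrite su !cat0s -splitE /F eqxx mulr1; set P := \prod_(x <- us) _ => hP.
have -> : \prod_(i < r.+1) a (N - r + i)%N = t ^+ (\sum_(i < r.+1) i) * P.
  rewrite /P /us (perm_big _ (permEl (perm_rev _))) -[X in iota X]addn0 iotaDl big_map.
  rewrite prod_iota_ord expr_sum -big_split /=.
  apply: eq_bigr => i _; rewrite /awt mulrA -exprD addnC [_ * (a _ * _)]mulrCA exprVn.
  by rewrite mulfV ?mulr1 // expf_neq0.
by rewrite ler_wpM2l ?exprn_ge0 //; case/andP: t_ge0.
Qed.
End DiagonalBound.

Section DominantEvaluation.
Variables (R : realType) (t : R) (n' k : nat) (a : nat -> R) (lam : n'.+1.-tuple nat).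
Local Notation n := n'.+1.
Local Notation N := (n' + k)%N.
Hypothesis t01 : 0 < t <= 1.
Hypothesis a_ge0 : forall p, 0 <= a p.
Hypothesis lam_sorted : sorted geq lam.
Local Notation X := (@Xop R t n' k a).
Local Notation mx := 'M[R]_#|state N.+1|.

Let t_neq0 : t != 0. Proof. by case/andP: t01 => /gt_eqF ->. Qed.
Let t_ge0 : 0 <= t <= 1. Proof. by case/andP: t01 => /ltW -> ->. Qed.
Let wt_ge0 p : 0 <= awt t a p.
Proof. by rewrite mulr_ge0 // exprn_ge0 // invr_ge0; case/andP: t_ge0. Qed.

Definition gaps r := (nth 0 lam r - (if r == n' :> nat then 0 else nth 0 lam r.+1))%N.

Lemma ev_dominant : ev X (\prod_(i < n) 'X_i ^+ tnth lam i) =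
  \prod_(r < n) (\prod_(0 <= i < r.+1) Xmx N t (awt t a) i : mx) ^+ gaps r.
Proof.
have ev_prod I (s : seq I) (P : pred I) (F : I -> {mpoly R[n]}) :
    ev X (\prod_(i <- s | P i) F i) = \prod_(i <- s | P i) ev X (F i).
  elim/big_rec2: _ => [|i A f _ <-]; first exact: ev1.
  exact/evM/Xop_comm.
pose x i : {mpoly R[n]} := 'X_(inord i).
transitivity (ev X (\prod_(i < n) x i ^+ nth 0%N lam i)).
  by congr ev; apply: eq_bigr => i _; rewrite /x inord_val (tnth_nth 0%N).
rewrite prod_dominant => [|i hi]; last first.
  have tr : transitive geq by move=> u v w /= h1 h2; apply: leq_trans h2 h1.
  apply: (sorted_ltn_nth tr 0%N lam_sorted); rewrite ?inE ?size_tuple //.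
  by apply: leqW.
rewrite ev_prod; apply: eq_bigr => r _; rewrite (evXn (Xop_comm k a t_neq0)); congr (_ ^+ _).
rewrite ev_prod; apply: eq_big_nat => i hi; rewrite /x evXi /Xop inordK //.
by have := ltn_ord r; lia.
Qed.

Lemma nnmx_prod_Xmx r : (r <= N)%N -> nnmx (\prod_(0 <= i < r.+1) Xmx N t (awt t a) i : mx).
Proof.
move=> hr; rewrite prod_Xmx //; apply: nnmxZ; first by rewrite exprn_ge0 //; case/andP: t_ge0.
by apply: nnmxX; apply: nnmx_Wop.
Qed.

Lemma nnmx_dominant : nnmx (ev X (\prod_(i < n) 'X_i ^+ tnth lam i)).
Proof.
rewrite ev_dominant; apply: big_ind => [|A B|r _]; [exact: nnmx1 | exact: nnmxM |].
by apply/nnmxX/nnmx_prod_Xmx; have := ltn_ord r; lia.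
Qed.
End DominantEvaluation.

Section ColumnSumBound.
Variables (R : realType) (t : R) (n' : nat) (a : nat -> R) (lam : n'.+1.-tuple nat).
Local Notation n := n'.+1.
Local Notation N := (n' + 0)%N.
Hypothesis t01 : 0 < t <= 1.
Hypothesis a_ge0 : forall p, 0 <= a p.
Hypothesis lam_sorted : sorted geq lam.
Local Notation mx := 'M[R]_#|state N.+1|.

Definition dominant_bound : R := \prod_(r < n) (\prod_(i < r.+1) a (N - r + i)%N) ^+ gaps lam r.

Lemma column_sum_bound : exists j, dominant_bound <=
  (const_mx 1 *m ev (@Xop R t n' 0 a) (\prod_(i < n) 'X_i ^+ tnth lam i) *m
    matQ t (Tmx N t) n' 0 : 'rV_#|state N.+1|) 0 j.
Proof.
have t_ge0 : 0 <= t <= 1 by case/andP: t01 => /ltW -> ->.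
have [x0 x0E] : exists x : state N.+1, ssval x = rev (iota 0 N.+1).
  by apply: perm_state; rewrite perm_rev.
have [x1 x1E] : exists x : state N.+1, ssval x = iota 0 N.+1 by exact: perm_state.
pose w0 := enum_rank x0; pose w1 := enum_rank x1.
have w0E : ssval (enum_val w0) = rev (iota 0 N.+1) by rewrite enum_rankK.
have w1E : ssval (enum_val w1) = iota 0 N.+1 by rewrite enum_rankK.
have hQ : 1 <= matQ t (Tmx N t) n' 0 w0 w1.
  by rewrite -[X in matQ _ _ X]addn0; apply: matQ_lower.
have nnX := @nnmx_dominant R t n' 0 a lam t01 a_ge0 lam_sorted.
set A := ev _ _ in nnX *; have hA : dominant_bound <= A w0 w0.
  rewrite /A ev_dominant //.
  pose good c (M : mx) := [/\ nnmx M, 0 <= c & c <= M w0 w0].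
  have good1 : good 1 1 by split; rewrite ?ler01 // ?mxE ?eqxx //; exact: nnmx1.
  have goodM c M d M' : good c M -> good d M' -> good (c * d) (M * M').
    move=> [h1 h2 h3] [h4 h5 h6]; split; [exact: nnmxM | exact: mulr_ge0 |].
    rewrite mxE (bigD1 w0) //=; apply: (@le_trans _ _ (M w0 w0 * M' w0 w0)).
      exact: ler_pM.
    by rewrite lerDl sumr_ge0 // => i _; rewrite mulr_ge0.
  have goodX c M m : good c M -> good (c ^+ m) (M ^+ m).
    by move=> h; elim: m => [|m IH] //; rewrite !exprS; apply: goodM.
  suff [] : good dominant_bound (\prod_(r < n)
     (\prod_(0 <= i < r.+1) Xmx N t (awt t a) i : mx) ^+ gaps lam r) by [].
  apply: (big_ind2 good) => // r _; apply: goodX; have hr : (r <= N)%N by have := ltn_ord r; lia.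
  split; [exact: nnmx_prod_Xmx | by rewrite prodr_ge0 |].
  exact: (@prod_Xmx_lower R t n' a t01 a_ge0 w0 w0E).
exists w1; rewrite mxE (bigD1 w0) //=.
have nnU : nnmx (const_mx 1 *m A : 'rV_#|state N.+1|).
  by apply: nnmxM => // i j; rewrite mxE ler01.
apply: (@le_trans _ _ ((const_mx 1 *m A : 'rV_#|state N.+1|) 0 w0)); last first.
  rewrite -[X in X <= _]addr0 lerD //; first by rewrite ler_peMr // .
  by rewrite sumr_ge0 // => i _; rewrite mulr_ge0 //; apply: nnmx_matQ.
apply: (le_trans hA); rewrite mxE (bigD1 w0) //= mxE mul1r lerDl.
by rewrite sumr_ge0 // => i _; rewrite mxE mul1r.
Qed.
End ColumnSumBound.

(** * Passage to the limit and conclusion *)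

Section RegularFunctions.
Variable R : realType.
Implicit Types (f g : R -> R) (p q : {poly R}).

Definition regular f := exists p q, forall t, 0 <= t < 1 -> 0 < q.[t] /\ f t = p.[t] / q.[t].

Lemma regular_poly f p : (forall t, 0 <= t < 1 -> f t = p.[t]) -> regular f.
Proof. by move=> h; exists p, 1 => t ht; rewrite hornerE ltr01 divr1 h. Qed.

Lemma regularD f g : regular f -> regular g -> regular (fun t => f t + g t).
Proof.
move=> [p [q h]] [p' [q' h']]; exists (p * q' + p' * q), (q * q') => t ht.
have [q0 ->] := h t ht; have [q0' ->] := h' t ht; rewrite !hornerE mulr_gt0 //; split=> //.
by field; rewrite !gt_eqF.
Qed.

Lemma regularM f g : regular f -> regular g -> regular (fun t => f t * g t).
Proof.
move=> [p [q h]] [p' [q' h']]; exists (p * p'), (q * q') => t ht.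
have [q0 ->] := h t ht; have [q0' ->] := h' t ht; rewrite !hornerM; split; first exact: mulr_gt0.
by rewrite mulf_div.
Qed.

Lemma regular_cst c : regular (fun=> c).
Proof. by apply: (@regular_poly _ c%:P) => t _; rewrite hornerC. Qed.

Lemma regular_sum (I : Type) (s : seq I) (P : pred I) (F : I -> R -> R) :
  (forall i, regular (F i)) -> regular (fun t => \sum_(i <- s | P i) F i t).
Proof.
move=> h; elim: s => [|i s [p [q IH]]].
  by apply: (@regular_poly _ 0) => t _; rewrite big_nil horner0.
have [p' [q' h']] : regular (fun t => (P i)%:R * F i t + \sum_(i <- s | P i) F i t).
  by apply: regularD; [apply: regularM (h i); exact: regular_cst | exists p, q].
exists p', q' => t /h'; rewrite big_cons.
by case: (P i) => [] [q0]; rewrite ?mul1r ?mul0r ?add0r.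
Qed.

Lemma regular_ext f g : (forall t, 0 <= t < 1 -> f t = g t) -> regular f -> regular g.
Proof. by move=> e [p [q h]]; exists p, q => t ht; rewrite -e //; apply: h. Qed.

Lemma regular_ge f c t : regular f -> (forall u, 0 < u < 1 -> c <= f u) -> 0 <= t < 1 -> c <= f t.
Proof.
move=> hf hc /andP []; rewrite le_eqVlt => /predU1P [<- _|t0 t1]; last by apply: hc; rewrite t0.
have [p [q h]] : regular (fun t => f t - c) by apply: regularD hf _; exact: regular_cst.
have z01 : (0 : R) <= (0 : R) < 1 by rewrite lexx ltr01.
have [q0 e0] := h 0 z01; rewrite -subr_ge0 e0; apply: divr_ge0; last exact: ltW.
rewrite leNgt; apply/negP => p0.
have pge u : 0 < u < 1 -> 0 <= p.[u].
  move=> hu; have u01 : 0 <= u < 1 by case/andP: hu => /ltW -> ->.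
  have [qu eu] := h u u01; have := hc u hu.
  by rewrite -subr_ge0 eu pmulr_lge0 // invr_gt0.
have [B hB] := poly_itv_bound (p %/ 'X) 0 1.
pose r := p %/ 'X; have pE u : p.[u] = r.[u] * u + p.[0].
  rewrite {1}(divp_eq p 'X) hornerD hornerM hornerX; congr (_ + _).
  by rewrite -['X]subr0 -polyC0 modp_XsubC hornerC.
have B0 : 0 <= B by apply: le_trans (hB 0 _); rewrite ?normr_ge0 // lexx ler01.
pose u := Num.min 2^-1 (- p.[0] / (2 * (B + 1))).
have D0 : 0 < 2 * (B + 1) by rewrite mulr_gt0 // ltr_wpDl.
have u0 : 0 < u by rewrite lt_min invr_gt0 ltr0n divr_gt0 // oppr_gt0.
have u1 : u < 1 by rewrite gt_min invf_lt1 ?ltr0n // ltr1n.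
have := pge u; rewrite u0 u1 => /(_ isT); apply/negP; rewrite -ltNge pE.
have ru : r.[u] * u <= B * u.
  rewrite ler_wpM2r ?(ltW u0) //; apply: le_trans (ler_norm _) (hB u _).
  by rewrite (ltW u0) (ltW u1).
have uB : u <= - p.[0] / (2 * (B + 1)) by rewrite ge_min lexx orbT.
rewrite ler_pdivlMr // in uB.
have Bu : 0 <= B * u by rewrite mulr_ge0 // ltW.
by nra.
Qed.

Lemma regular_geom r : (0 < r)%N -> regular (fun t => (1 - t ^+ r)^-1).
Proof.
move=> r0; exists 1, (1 - 'X^r) => t /andP [t0 t1]; rewrite hornerD hornerN hornerXn hornerC div1r; split=> //.
by rewrite subr_gt0 exprn_ilt1 // -lt0n.
Qed.

Definition regular_mx m n (M : R -> 'M[R]_(m, n)) := forall i j, regular (fun t => M t i j).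

Lemma regular_mxD m n (M M' : R -> 'M[R]_(m, n)) :
  regular_mx M -> regular_mx M' -> regular_mx (fun t => M t + M' t).
Proof.
by move=> h h' i j; apply: (@regular_ext (fun t => M t i j + M' t i j)) => [t _|];
  [rewrite mxE | apply: regularD].
Qed.

Lemma regular_mxZ m n c (M : R -> 'M[R]_(m, n)) :
  regular c -> regular_mx M -> regular_mx (fun t => c t *: M t).
Proof.
by move=> h h' i j; apply: (@regular_ext (fun t => c t * M t i j)) => [t _|];
  [rewrite mxE | apply: regularM].
Qed.

Lemma regular_mxM m n l (M : R -> 'M[R]_(m, n)) (M' : R -> 'M[R]_(n, l)) :
  regular_mx M -> regular_mx M' -> regular_mx (fun t => M t *m M' t).
Proof.
move=> h h' i j; apply: (@regular_ext (fun t => \sum_k M t i k * M' t k j)) => [t _|].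
  by rewrite mxE.
by apply: regular_sum => k; apply: regularM.
Qed.

Lemma regular_mx_cst m n (A : 'M[R]_(m, n)) : regular_mx (fun=> A).
Proof. by move=> i j; apply: regular_cst. Qed.
End RegularFunctions.

Section TransferRegular.
Variables (R : realType) (n' : nat) (a : nat -> R).
Local Notation n := n'.+1.
Local Notation Tser t r := (transfer_series t (fun i : 'I_n => a i) r).

Lemma Ptr_poly (e e' : word n) r : exists p : {poly R}, forall t, (Ptr t a e e')`_r = p.[t].
Proof.
pose P := Phi (('X : {poly R})%:P) 'X (@Bf _) false
  (site_seq (fun p => (a p)%:P%:P) (wfun e) 0 n) (is_word {poly {poly R}} (word_seq (wfun e') 0 n)).
exists P`_r => t.
pose f : {rmorphism {poly {poly R}} -> {poly R}} := map_poly (horner_eval t).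
have fC (p : {poly R}) : f p%:P = p.[t]%:P by rewrite /f /= map_polyC.
have fX : f 'X = 'X by rewrite /f /= map_polyX.
suff -> : Ptr t a e e' = f P by rewrite /f /= coef_map.
rewrite /P -Phi_morph fC fX hornerX /Ptr /site_seq -map_comp.
rewrite [in RHS](eq_map (g := fun p => ((a p)%:P, wfun e p))); last by move=> p /=; rewrite fC hornerC.
by apply: Phi_ext => u; rewrite /is_word rmorph_nat.
Qed.

Lemma transfer_series_last t r : Tser t r = \matrix_(i, j) (Ptr t a (enum_val j) (enum_val i))`_r -
  \sum_(1 <= i < r.+1) (Qn n' a)`_i *: Tser t (r - i).
Proof.
set A := \matrix_(i, j) _.
have <- : \sum_(i < r.+1) (Qn n' a)`_i *: Tser t (r - i) = A.
  by apply: transfer_series_mx => e e'; rewrite mxE !enum_rankK.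
rewrite -(big_mkord xpredT (fun i => (Qn n' a)`_i *: Tser t (r - i))) big_ltn // Qn0 scale1r subn0.
by rewrite addrK.
Qed.

Lemma regular_transfer_series r : regular_mx (fun t => Tser t r).
Proof.
elim/ltn_ind: r => r IH i j.
have [p hp] := Ptr_poly (enum_val j) (enum_val i) r.
pose F l t := - (Qn n' a)`_l * (if (0 < l)%N then Tser t (r - l) i j else 0).
apply: (@regular_ext _ (fun t => p.[t] + \sum_(1 <= l < r.+1) F l t)).
  move=> t _; rewrite transfer_series_last [RHS]mxE [X in _ = X + _]mxE hp; congr (_ + _).
  rewrite mxE summxE -sumrN; apply: eq_big_nat => l /andP [l0 _].
  by rewrite /F l0 mulNr; congr (- _); rewrite [RHS]mxE.
apply: regularD; first by apply: (@regular_poly _ _ p).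
case: r IH {p hp} @F => [|r] IH F; first by apply: (@regular_poly _ _ 0) => t _; rewrite big_geq ?horner0.
apply: regular_sum => l; apply: regularM; first exact: regular_cst.
by rewrite /F; case: ltnP => l0; [apply: IH; lia | exact: regular_cst].
Qed.
End TransferRegular.

Section PhiSums.
Variables (P : comNzRingType) (t z : P).
Implicit Types (s : seq (P * bool)) (phi psi : seq (option bool) -> P).

Lemma Phi_one h s : Phi t z (@Bf P) h s (fun=> 1) = \prod_(x <- s) (1 - t * x.1 * z).
Proof.
elim: s h => [|[a e] s IH] h; first by rewrite big_nil.
by rewrite big_cons /=; case: e; case: h; rewrite !IH; ring.
Qed.

Lemma Phi_eq_words h s phi psi :
  (forall u, size u = size s -> all isSome u -> phi u = psi u) ->
  Phi t z (@Bf P) h s phi = Phi t z (@Bf P) h s psi.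
Proof.
elim: s h phi psi => [|[a e] s IH] h phi psi hp /=; first exact: hp.
have E b h' : Phi t z (@Bf P) h' s (fun u => phi (Some b :: u)) =
    Phi t z (@Bf P) h' s (fun u => psi (Some b :: u)).
  by apply: IH => u su hu; apply: hp; rewrite /= ?su.
by case: e {hp}; case: h; rewrite !E.
Qed.

Lemma Phi_sum (I : Type) (r : seq I) h s (F : I -> seq (option bool) -> P) :
  Phi t z (@Bf P) h s (fun u => \sum_(i <- r) F i u) = \sum_(i <- r) Phi t z (@Bf P) h s (F i).
Proof.
elim: s h F => [|[a e] s IH] h F //=.
by case: e; case: h; rewrite ?(IH _ (fun i u => F i (_ :: u))) ?mulr_sumr -?big_split.
Qed.
End PhiSums.

Section ColumnSums.
Variables (R : realType) (t : R) (n' : nat) (a : nat -> R).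
Local Notation n := n'.+1.
Local Notation Tser r := (transfer_series t (fun i : 'I_n => a i) r).
Local Notation ones := (const_mx 1 : 'rV[R]_#|word n|).
Local Notation evala := (meval (fun i : 'I_n => a i)).

Lemma sum_Ptr (e : word n) :
  \sum_(e' : word n) Ptr t a e e' = \prod_(i < n) (1 - (t * a i) *: 'X).
Proof.
transitivity (\prod_(x <- site_seq (fun p => (a p)%:P) (wfun e) 0 n) (1 - t%:P * x.1 * 'X)); last first.
  by rewrite big_map prod_iota_ord; apply: eq_bigr => i _; rewrite -polyCM mul_polyC.
rewrite -(Phi_one _ _ false) -Phi_sum; apply: Phi_eq_words => u; rewrite size_map size_iota => su hu.
pose w : word n := [ffun i : 'I_n => odflt false (nth None u i)].
rewrite (bigD1 w) //= big1 => [|e' ne].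
  rewrite addr0 /is_word (_ : u == _) //; apply/eqP/(@eq_from_nth _ None).
    by rewrite size_word_seq.
  move=> i; rewrite su => hi; rewrite /word_seq (nth_map 0%N) ?size_iota // nth_iota // add0n.
  rewrite /wfun ffunE inordK //; have := all_nthP None hu i; rewrite su => /(_ hi).
  by case: (nth None u i).
rewrite /is_word; case: eqP => // uE; case/eqP: ne; apply/ffunP => i; rewrite ffunE uE.
by rewrite /word_seq (nth_map 0%N) ?size_iota // nth_iota // add0n /wfun inord_val.
Qed.

Lemma mesym_eval r : evala (mesym n R r) = esum (fun i : 'I_n => a i) r.
Proof. by rewrite esum_mesym /esum; apply: eq_bigr => J _; apply: eq_bigr => i _; exact: mevalXU. Qed.

Lemma Qn_coef r : (Qn n' a)`_r = (-1) ^+ r * evala (mesym n R r).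
Proof.
rewrite mesym_eval -coef_prod1subX /Qn prod_iota_ord; congr (polyseq _)`_r.
by apply: eq_bigr => i _; rewrite mul1r mul_polyC.
Qed.

Lemma column_sum_recursion r :
  \sum_(i < r.+1) (Qn n' a)`_i *: (ones *m Tser (r - i)) =
  ((- t) ^+ r * evala (mesym n R r)) *: ones.
Proof.
pose A : 'M_#|word n| := \matrix_(i, j) (Ptr t a (enum_val j) (enum_val i))`_r.
have hA : \sum_(i < r.+1) (Qn n' a)`_i *: Tser (r - i) = A.
  by apply: transfer_series_mx => e e'; rewrite mxE !enum_rankK.
transitivity (ones *m A).
  by rewrite -hA mulmx_sumr; apply: eq_bigr => i _; rewrite scalemxAr.
rewrite mesym_eval -coef_prod1subX; apply/rowP => j; rewrite !mxE mulr1 -(sum_Ptr (enum_val j)).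
rewrite coef_sum (reindex_onto enum_rank enum_val) /=; last by move=> i _; rewrite enum_valK.
apply: eq_big => [e|e _]; first by rewrite enum_rankK eqxx.
by rewrite !mxE mul1r enum_rankK.
Qed.

Lemma column_sum_transfer r : (0 < r)%N ->
  ones *m Tser r = evala ((1 - t) *: symC t n' 0 ('X_ord0 ^+ r)) *: ones.
Proof.
have zero : ones *m Tser 0 = ones.
  have := column_sum_recursion 0; rewrite big_ord1 Qn0 scale1r subnn => ->.
  by rewrite expr0 mul1r mesym0E rmorph1 scale1r.
elim/ltn_ind: r => -[//|r] IH _.
pose E m := evala (mesym n R m); pose G m := evala ((1 - t) *: symC t n' 0 ('X_ord0 ^+ m)).
have hrel : (- t) ^+ r.+1 * E r.+1 =
    (-1) ^+ r.+1 * E r.+1 + \sum_(1 <= m < r.+2) (-1) ^+ (r.+1 - m) * E (r.+1 - m)%N * G m.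
  rewrite /E -mevalZ mesym_hl_relation mevalD mevalZ; congr (_ + _).
  by rewrite [LHS]rmorph_sum; apply: eq_bigr => m _; rewrite [LHS]mevalM mevalZ.
rewrite -/(G r.+1); have := column_sum_recursion r.+1.
rewrite -/(E r.+1) hrel -Qn_coef scalerDl.
rewrite -(big_mkord xpredT (fun i => (Qn n' a)`_i *: (ones *m Tser (r.+1 - i)))).
rewrite big_nat_rev add0n big_ltn // (_ : r.+2 - 1 = r.+1)%N // subnn zero => /addrI.
rewrite !(@big_nat_recr _ _ _ r.+1) //= !subSS !subnn subn0 Qn0 scale1r.
rewrite {2}/E expr0 mul1r mesym0E meval1 mul1r scalerDl.
set S1 := \sum_(_ <= _ < _) _; set S2 := \sum_(_ <= _ < _) _.
suff -> : S1 = S2 *: ones by move/addrI.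
rewrite /S1 /S2 scaler_suml; apply: eq_big_nat => j /andP [j0 jr].
by rewrite subSS subKn ?(ltnW jr) // IH // Qn_coef scalerA.
Qed.
End ColumnSums.

Lemma word_state n' (e : word n'.+1) : exists k (j : 'I_#|state (n' + k).+1|),
  forall (R : realType) (t : R) a p (A : 'M[R]_(p, #|word n'.+1|)) i,
    (A *m rho t n' k a) i j = A i (enum_rank e).
Proof.
pose u := filter (wfun e) (iota 0 n'.+1); pose v := filter (predC (wfun e)) (iota 0 n'.+1).
pose k := size u; pose s := (v ++ iota n'.+1 k) ++ u.
have sz : (size v + k)%N = n'.+1.
  by rewrite addnC /k !size_filter count_predC size_iota.
have [x xE] : exists x : state (n' + k).+1, ssval x = s.
  apply: perm_state; rewrite /s perm_catC catA (_ : (n' + k).+1 = (n'.+1 + k)%N) // iotaD perm_cat2r.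
  by rewrite perm_filterC.
have dE : drop n'.+1 s = u by rewrite /s drop_size_cat // size_cat size_iota.
have sE : sword n' s = e.
  apply/ffunP => i; rewrite ffunE dE mem_filter mem_iota add0n ltn_ord andbT.
  by rewrite leq0n andbT /wfun inord_val.
have t0 : tail_twos n' k s = 0%N.
  rewrite /tail_twos dE (@eq_in_count _ _ pred0) ?count_pred0 // => p; rewrite mem_iota => hp.
  by rewrite mem_filter mem_iota; apply/negP => /andP [_]; lia.
exists k, (enum_rank x) => R t a p A i.
by rewrite mulmx_rho enum_rankK xE sE t0 /cpoch big_ord0 invr1 mulr1.
Qed.

Lemma ones_rho (R : realType) (t : R) n' a :
  (const_mx 1 : 'rV_#|word n'.+1|) *m rho t n' 0 a = const_mx 1.
Proof. by apply/rowP => j; rewrite mulmx_rho !mxE /tail_twos /cpoch big_ord0 invr1 mulr1. Qed.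

Section Lifts.
Variables (R : realType) (n' : nat) (a : nat -> R) (t0 : R).
Local Notation n := n'.+1.
Variable Theta : {lrmorphism sympoly n R -> 'M[R]_#|word n|}.
Hypothesis a_tail : forall p, (n <= p)%N -> a p = 0.
Hypothesis t0_01 : 0 <= t0 < 1.
Hypothesis Theta_g : forall k, (1 <= k <= n)%N ->
  Theta (HL_g n t0 k) = transfer_series t0 (fun i : 'I_n => a i) k.
Local Notation ones := (const_mx 1 : 'rV[R]_#|word n|).
Local Notation evala := (meval (fun i : 'I_n => a i)).
Implicit Types (F G : R -> sympoly n R) (c : R -> R).

Let pos_neq0 (t : R) : 0 < t < 1 -> t != 0. Proof. by case/andP => /gt_eqF ->. Qed.

(* The intertwining relation pins down the column of [M t] at a word with [k] letters 2; it is
   only required where the affine Hecke algebra exists, and reaches [t = 0] by regularity. *)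
Definition lifts F := exists M : R -> 'M[R]_#|word n|,
  [/\ regular_mx M,
      forall (t : R) k, 0 < t < 1 -> M t *m rho t n' k a = rho t n' k a *m ev (Xop t k a) (F t),
      forall t : R, 0 <= t < 1 -> ones *m M t = evala (F t) *: ones
    & M t0 = Theta (F t0)].

Lemma lifts_ext F G : (forall t : R, 0 <= t < 1 -> F t = G t) -> lifts F -> lifts G.
Proof.
move=> FG [M [h1 h2 h3 h4]]; exists M; split=> // [t k ht|t ht|].
- by rewrite h2 // FG //; case/andP: ht => /ltW -> ->.
- by rewrite h3 // FG.
- by rewrite h4 FG.
Qed.

Lemma lifts1 : lifts (fun=> 1).
Proof.
exists (fun=> 1%:M); split=> [|t k _|t _|]; first exact: regular_mx_cst.
- by rewrite mul1mx ev1 mulmx1.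
- by rewrite mulmx1 meval1 scale1r.
- by rewrite (rmorph1 Theta).
Qed.

Lemma liftsD F G : lifts F -> lifts G -> lifts (fun t => F t + G t).
Proof.
move=> [M [h1 h2 h3 h4]] [M' [k1 k2 k3 k4]]; exists (fun t => M t + M' t); split=> [|t k ht|t ht|].
- exact: regular_mxD.
- by rewrite mulmxDl h2 // k2 // evD mulmxDr.
- by rewrite mulmxDr h3 // k3 // mevalD scalerDl.
- by rewrite h4 k4 rmorphD.
Qed.

Lemma liftsZ c F : regular c -> lifts F -> lifts (fun t => c t *: F t).
Proof.
move=> hc [M [h1 h2 h3 h4]]; exists (fun t => c t *: M t); split=> [|t k ht|t ht|].
- exact: regular_mxZ.
- by rewrite -scalemxAl h2 // evZ scalemxAr.
- by rewrite -scalemxAr h3 // mevalZ scalerA.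
- by rewrite h4 linearZ.
Qed.

Lemma liftsM F G : lifts F -> lifts G -> lifts (fun t => F t * G t).
Proof.
move=> [M [h1 h2 h3 h4]] [M' [k1 k2 k3 k4]]; exists (fun t => M t *m M' t); split=> [|t k ht|t ht|].
- exact: regular_mxM.
- rewrite -mulmxA k2 // mulmxA h2 // -mulmxA; congr (_ *m _).
  exact/esym/evM/Xop_comm/pos_neq0.
- by rewrite mulmxA h3 // -scalemxAl k3 // scalerA mevalM.
- by rewrite h4 k4 rmorphM.
Qed.

Lemma lifts_sum (I : eqType) (s : seq I) (F : I -> R -> sympoly n R) :
  (forall i, i \in s -> lifts (F i)) -> lifts (fun t => \sum_(i <- s) F i t).
Proof.
elim: s => [|i s IH] h.
  apply: (@lifts_ext (fun t => 0 *: 1)) => [t _|]; first by rewrite big_nil scale0r.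
  by apply: liftsZ lifts1; exact: regular_cst.
apply: (@lifts_ext (fun t => F i t + \sum_(j <- s) F j t)) => [t _|]; first by rewrite big_cons.
by apply: liftsD; [apply: h; rewrite mem_head | apply: IH => j js; apply: h; rewrite inE js orbT].
Qed.

Lemma lifts_g k : (1 <= k <= n)%N -> lifts (fun t => HL_g n t k).
Proof.
move=> hk; have k0 : (0 < k)%N by case/andP: hk.
exists (fun t => transfer_series t (fun i : 'I_n => a i) k); split=> [|t m ht|t ht|].
- exact: regular_transfer_series.
- have t01 : 0 <= t < 1 by case/andP: ht => /ltW -> ->.
  rewrite HL_gE // transfer_series_rho // ?pos_neq0 // => r r0.
  by case/andP: t01 => tge tlt; rewrite subr_eq0 eq_sym lt_eqF // exprn_ilt1 // -lt0n.
- by rewrite HL_gE // column_sum_transfer.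
- by rewrite Theta_g.
Qed.

Lemma mpoly_of_sum (I : Type) (s : seq I) (F : I -> sympoly n R) :
  (\sum_(i <- s) F i : sympoly n R) = \sum_(i <- s) (F i : {mpoly R[n]}) :> {mpoly R[n]}.
Proof. by elim: s => [|i s IH]; rewrite ?big_nil ?big_cons -?IH. Qed.

Definition elementary r : sympoly n R := Sympoly (mesym_sym n R r).

Lemma elementary_relation (t : R) r : 0 <= t < 1 -> (0 < r)%N ->
  elementary r = (1 - t ^+ r)^-1 *: \sum_(s <- iota 1 r) ((-1) ^+ s.+1 *: elementary (r - s)) * HL_g n t s.
Proof.
move=> ht r0; apply: val_inj; rewrite [RHS]linearZ /= mpoly_of_sum.
have nz : 1 - t ^+ r != 0.
  by case/andP: ht => tge tlt; rewrite subr_eq0 eq_sym lt_eqF // exprn_ilt1 // -lt0n.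
apply: (scalerI nz); rewrite scalerA mulfV // scale1r.
have hrel := mesym_hl_relation n' t r; rewrite /index_iota subSS subn0 in hrel.
set S := \sum_(s <- _) _ in hrel.
have -> : \sum_(s <- iota 1 r) (((-1) ^+ s.+1 *: elementary (r - s)) * HL_g n t s : {mpoly R[n]}) =
    - (-1) ^+ r *: S.
  rewrite /S scaler_sumr; apply: eq_big_seq => s; rewrite mem_iota => /andP [s0 sr].
  rewrite -HL_gE // [RHS]scalerAl scalerA; congr (_ * _).
  rewrite mulNr -exprD (_ : r + (r - s) = (r - s).*2 + s)%N; last by lia.
  by rewrite exprD -mul2n exprM sqrrN !expr1n mul1r exprS mulN1r.
have -> : S = ((- t) ^+ r - (-1) ^+ r) *: mesym n R r.
  by apply: (addrI ((-1) ^+ r *: mesym n R r)); rewrite -hrel -scalerDl addrC subrK.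
have sgn : (-1) ^+ r * (-1) ^+ r = 1 :> R by rewrite -exprMn mulrNN mulr1 expr1n.
rewrite scalerA; congr (_ *: _).
by rewrite (exprNn t) mulNr mulrBr mulrA sgn mul1r opprB.
Qed.

Lemma lifts_elementary r : (r <= n)%N -> lifts (fun=> elementary r).
Proof.
elim/ltn_ind: r => -[|r] IH hr.
  by apply: lifts_ext lifts1 => t _; apply: val_inj; rewrite /= mesym0E.
apply: (@lifts_ext (fun t => (1 - t ^+ r.+1)^-1 *:
  \sum_(s <- iota 1 r.+1) ((-1) ^+ s.+1 *: elementary (r.+1 - s)) * HL_g n t s)).
  by move=> t ht; rewrite -elementary_relation.
apply: liftsZ; first exact: regular_geom.
apply: lifts_sum => s; rewrite mem_iota => /andP [s0 sr].
apply: liftsM; last by apply: lifts_g; lia.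
apply: (@liftsZ (fun=> (-1) ^+ s.+1) (fun=> elementary (r.+1 - s))); first exact: regular_cst.
by apply: IH; lia.
Qed.

Lemma lifts_sym (f : sympoly n R) : lifts (fun=> f).
Proof.
have [q [qE _]] := sym_fundamental (valP f).
suff [g [gE hg]] : exists g : sympoly n R,
    (g : {mpoly R[n]}) = q \mPo [tuple mesym n R i.+1 | i < n] /\ lifts (fun=> g).
  by apply: lifts_ext hg => t _; apply: val_inj; rewrite /= gE qE.
elim/mpoly_alg_ind: q {qE} => [||i|p q [g [gE hg]] [h [hE hh]]|c p q [g [gE hg]] [h [hE hh]]].
- exists 0; split; first by rewrite comp_mpoly0.
  apply: (@lifts_ext (fun=> 0 *: 1)) => [t _|]; first by rewrite scale0r.
  by apply: (liftsZ _ lifts1); exact: regular_cst.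
- by exists 1; split; [rewrite rmorph1 | exact: lifts1].
- exists (elementary i.+1); split; first by rewrite comp_mpolyXU -tnth_nth tnth_mktuple.
  exact: lifts_elementary.
- by exists (g * h); split; [rewrite rmorphM /= -gE -hE | exact: liftsM].
- exists (c *: g + h); split; first by rewrite linearP /= -gE -hE.
  apply: liftsD => //; apply: (@liftsZ (fun=> c)) => //; exact: regular_cst.
Qed.

Lemma lifts_HL (lam : n.-tuple nat) : lifts (fun t => HL_v t lam *: HL t lam).
Proof.
pose mon : {mpoly R[n]} := \prod_(i < n) 'X_i ^+ tnth lam i.
have [P hP] := family_symQ mon (add0n n').
have Psym : forall j, P`_j \is symmetric.
  apply: family_coef_sym => t; rewrite -hP.
  apply: (@symQ_sym R n' _ t mon (@tofrac {mpoly R[n]})); exact: tofrac_inj.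
apply: (@lifts_ext (fun t => \sum_(j <- iota 0 (size P)) t ^+ j *: Sympoly (Psym j))).
  move=> t ht; apply: val_inj; rewrite [RHS]linearZ /= -(symQ_HL ht) hP horner_coef mpoly_of_sum.
  rewrite -[size P]subn0 big_mkord subn0; apply: eq_bigr => j _.
  by rewrite -rmorphXn /= mulrC mul_mpolyC.
apply: lifts_sum => j _; apply: (@liftsZ (fun t => t ^+ j) (fun=> Sympoly (Psym j))).
  by apply: (@regular_poly _ _ 'X^j) => t _; rewrite hornerXn.
exact: lifts_sym.
Qed.

Hypothesis a_gt0 : forall p, (p < n)%N -> 0 < a p.
Variable lam : n.-tuple nat.
Hypothesis lam_sorted : sorted geq lam.

Lemma stochastic_HL : stochastic ((evala (HL t0 lam))^-1 *: Theta (HL t0 lam)).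
Proof.
have a_ge0 p : 0 <= a p by case: (ltnP p n) => hp; [exact/ltW/a_gt0 | rewrite a_tail].
have [M [h1 h2 h3 h4]] := lifts_HL lam.
pose mon : {mpoly R[n]} := \prod_(i < n) 'X_i ^+ tnth lam i.
have ltl (t : R) : 0 < t < 1 -> 0 <= t < 1 by case/andP => /ltW -> ->.
have ltr (t : R) : 0 < t < 1 -> 0 < t <= 1 by case/andP => -> /ltW ->.
have Mrho (t : R) k : 0 < t < 1 ->
    M t *m rho t n' k a = rho t n' k a *m ev (Xop t k a) mon *m matQ t (Tmx (n' + k) t) n' 0.
  by move=> ht; rewrite h2 // rho_symQ ?pos_neq0 // symQ_HL // ltl.
have M_ge0 i j (t : R) : 0 <= t < 1 -> 0 <= M t i j.
  apply: regular_ge (h1 i j) _ => u hu; rewrite -[j]enum_valK.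
  have [k [l hl]] := word_state (enum_val j); rewrite -(hl _ u a) Mrho //.
  have u01 : 0 <= u <= 1 by case/andP: hu => /ltW -> /ltW ->.
  apply: nnmxM; last exact: nnmx_matQ.
  apply: nnmxM; last exact: nnmx_dominant (ltr _ hu) a_ge0 lam_sorted.
  move=> x y; rewrite mxE chi_word mulr_ge0 ?ler0n // invr_ge0 prodr_ge0 // => m _.
  by rewrite subr_ge0 exprn_ile1 //; case/andP: u01.
have col (t : R) j : 0 <= t < 1 -> \sum_i M t i j = evala (HL_v t lam *: HL t lam).
  move=> ht; have := congr1 (fun v : 'rV_#|word n| => v 0 j) (h3 t ht).
  rewrite mxE [X in _ = X]mxE mxE mulr1 => <-.
  by apply: eq_bigr => i _; rewrite mxE mul1r.
have P_gt0 : 0 < evala (HL_v t0 lam *: HL t0 lam).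
  have c_gt0 : 0 < dominant_bound a lam.
    apply: prodr_gt0 => r _; rewrite exprn_gt0 // prodr_gt0 // => i _; apply: a_gt0.
    by have := ltn_ord i; have := ltn_ord r; lia.
  apply: (lt_le_trans c_gt0); pose j := enum_rank ([ffun=> false] : word n).
  rewrite -(col t0 j t0_01).
  apply: (regular_ge (f := fun t => \sum_i M t i j)) t0_01 => [|t ht].
    by apply: regular_sum => i.
  have [l hl] := column_sum_bound (ltr _ ht) a_ge0 lam_sorted.
  apply: (le_trans hl); rewrite -(ones_rho t n' a) -!mulmxA (mulmxA (rho _ _ _ _)) -Mrho //.
  by rewrite mulmxA h3 ?ltl // -scalemxAl ones_rho !mxE mulr1 col ?ltl.
have v_gt0 : 0 < HL_v t0 lam by exact: HL_v_gt0.
rewrite mevalZ pmulr_rgt0 // in P_gt0.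
have ME i j : Theta (HL t0 lam) i j = (HL_v t0 lam)^-1 * M t0 i j.
  by rewrite h4 linearZ mxE mulrA mulVf ?mul1r // gt_eqF.
split=> [i j|j].
  by rewrite mxE ME !mulr_ge0 ?invr_ge0 ?M_ge0 // ltW.
under eq_bigr => i _ do rewrite mxE ME.
by rewrite -!mulr_sumr col // mevalZ mulKf ?mulVf // gt_eqF.
Qed.
End Lifts.

Theorem corollary1p7 (R : realType) (n : nat) (t : R) (a : 'I_n -> R)
    (Theta : {lrmorphism sympoly n R -> 'M[R]_#|word n|}) (lam : n.-tuple nat) :
  (0 < n)%N -> 0 <= t < 1 -> (forall i, 0 < a i) ->
  (forall k, (1 <= k <= n)%N -> Theta (HL_g n t k) = transfer_series t a k) ->
  sorted geq lam ->
  stochastic (((HL t lam : {mpoly R[n]}).@[a])^-1 *: Theta (HL t lam)).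
Proof.
case: n a Theta lam => // n' a Theta lam _ t01 a_gt0 Theta_g lam_sorted.
pose b p := if (p < n'.+1)%N then a (inord p) else 0.
have aE : a = fun i : 'I_n'.+1 => b i.
  by apply: boolp.funext => i; rewrite /b ltn_ord inord_val.
rewrite aE in Theta_g *.
apply: stochastic_HL => // p hp; last by rewrite /b hp.
by rewrite /b ltnNge hp.
Qed.
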